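(* (i) If $\int_0^\infty t^{\varepsilon}\pi_\tau(t)\,dt<\infty$ for some $\varepsilon>0$, then the Markov chain produced by Algorithm 2 is geometrically ergodic. (ii) If $\pi_\tau$ is supported in $(0,\overline{\tau^2}]$ for some $0<\overline{\tau^2}<\infty$ (i.e. $\tau^2\le\overline{\tau^2}$ almost surely under the prior), then the Markov chain produced by Algorithm 3 is geometrically ergodic.
   Context: Let $n\ge p\ge 1$, $y\in\mathbb R^n$, $X\in\mathbb R^{n\times p}$ with $X^\top X$ invertible, $a',b'>0$, $\pi_\tau$ a probability density on $(0,\infty)$ and $\pi_\lambda$ a probability density on $\mathbb R$. $\mathrm{IG}(\alpha,\beta)$ is the inverse gamma distribution with density $\propto x^{-\alpha-1}e^{-\beta/x}$. Fix $d>0$ such that $(X^\top X)^{-1}-dI_p$ is positive definite, and put $A=I_p/d+\{(X^\top X)^{-1}-dI_p\}^{-1}$, $b=\{(X^\top X)^{-1}-dI_p\}^{-1}(X^\top X)^{-1}X^\top y$. The state is $(\theta,\tilde\beta,\sigma^2,\tau^2,\lambda)\in\mathbb R^p\times\mathbb R^p\times(0,\infty)\times(0,\infty)\times\mathbb R^p$; write $\Lambda=\mathrm{diag}(\lambda_1,\dots,\lambda_p)$, $\circ$ for the entrywise product, and $R(\tau^2,\lambda)=y^\top[I_n-X\Lambda\{I_p/\tau^2+\Lambda X^\top X\Lambda\}^{-1}\Lambda X^\top]y/2+b'$. (These chains target the posterior of $y_i\sim N(x_i^\top\beta,\sigma^2)$, $\beta_k\sim N(0,\sigma^2\tau^2\lambda_k^2)$,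 $\lambda_k\sim\pi_\lambda$, $\tau^2\sim\pi_\tau$, $\sigma^2\sim\mathrm{IG}(a',b')$, reparametrized by $\tilde\beta_k=\beta_k/(\sqrt{\tau^2}\lambda_k)$ and augmented with a latent $\theta$.) Algorithm 2: one iteration does, in order: (a) independently for $k=1,\dots,p$, draw $\lambda_k$ from the density on $\mathbb R$ proportional to $\lambda\mapsto\exp[-\{\sqrt{\tau^2}\lambda\tilde\beta_k-\theta_k\}^2/(2d\sigma^2)]\pi_\lambda(\lambda)$; (b) draw $\tau^2$ from the density on $(0,\infty)$ proportional to $t\mapsto \pi_\tau(t)\,|I_p+t\Lambda X^\top X\Lambda|^{-1/2}\,R(t,\lambda)^{-(n/2+a')}$; (c) draw $\sigma^2\sim\mathrm{IG}(n/2+a',R(\tau^2,\lambda))$; draw $\tilde\beta\sim N_p\big(\{I_p+\tau^2\Lambda X^\top X\Lambda\}^{-1}\Lambda X^\top y\sqrt{\tau^2},\ \sigma^2\{I_p+\tau^2\Lambda X^\top X\Lambda\}^{-1}\big)$; draw $\theta\sim N_p\big(A^{-1}\{\sqrt{\tau^2}(\lambda\circ\tilde\beta)/d+b\},\ \sigma^2A^{-1}\big)$. Algorithm 3 is identical except that step (b) is replaced by: draw $\tau^2$ from the density on $(0,\infty)$ proportional to $t\mapsto\exp\{-t\,\tilde\beta^\top\Lambda X^\top X\Lambda\tilde\beta/(2\sigma^2)+\sqrt t\,\tilde\beta^\top\Lambda X^\top y/\sigma^2\}\pi_\tau(t)$, using the current $\tilde\beta,\sigma^2$ and the new $\lambda$.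 *)

(* Defs.v *)
From HB Require Import structures.
From mathcomp Require Import all_boot all_order all_algebra.
From mathcomp Require Import all_classical all_reals all_analysis.
Set Implicit Arguments. Unset Strict Implicit. Unset Printing Implicit Defensive.
Import Order.TTheory GRing.Theory Num.Theory.
Local Open Scope classical_set_scope.
Local Open Scope ring_scope.

Fixpoint iint (R : realType) (k : nat) (g : seq R -> \bar R) : \bar R :=
  match k with
  | 0 => g [::]
  | k'.+1 => (\int[@lebesgue_measure R]_x iint k' (fun s => g (x :: s)))%E
  end.

Definition vint (R : realType) (p : nat) (g : 'cV[R]_p -> \bar R) : \bar R :=
  iint p (fun s => g (\col_i nth 0 s i)).

Definition ndens (R : realType) (D : set R) (h : R -> R) (x : R) : R :=
  h x / fine (\int[@lebesgue_measure R]_(u in D) (h u)%:E)%E.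

Definition ndensv (R : realType) (p : nat) (h : 'cV[R]_p -> R) (v : 'cV[R]_p) : R :=
  h v / fine (vint (fun w => (h w)%:E)).

Definition pos_def (R : realType) (p : nat) (M : 'M[R]_p) : Prop :=
  M^T = M /\ forall v : 'cV[R]_p, v != 0 -> 0 < (v^T *m M *m v) 0 0.

Record state (R : realType) (p : nat) := mkState {
  s_theta : 'cV[R]_p; s_beta : 'cV[R]_p; s_sig2 : R; s_tau2 : R; s_lam : 'cV[R]_p }.

Definition state_gen (R : realType) (p : nat) : set (set (state R p)) :=
  [set A | exists B : set R, measurable B /\
     (A = [set x | B (s_sig2 x)] \/ A = [set x | B (s_tau2 x)] \/
      exists i : 'I_p, A = [set x | B (s_theta x i 0)] \/
                       A = [set x | B (s_beta x i 0)] \/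
                       A = [set x | B (s_lam x i 0)])].

Definition state_measurable (R : realType) (p : nat) : set (set (state R p)) :=
  <<s @state_gen R p >>.

Definition Lam (R : realType) (p : nat) (l : 'cV[R]_p) : 'M[R]_p := diag_mx l^T.

Definition XtX (R : realType) (n p : nat) (X : 'M[R]_(n, p)) : 'M[R]_p := X^T *m X.

Definition Amat (R : realType) (n p : nat) (X : 'M[R]_(n, p)) (d : R) : 'M[R]_p :=
  d^-1 *: 1%:M + invmx (invmx (XtX X) - d *: 1%:M).

Definition bvec (R : realType) (n p : nat) (X : 'M[R]_(n, p)) (y : 'cV[R]_n) (d : R)
  : 'cV[R]_p :=
  invmx (invmx (XtX X) - d *: 1%:M) *m invmx (XtX X) *m X^T *m y.

Definition Rfun (R : realType) (n p : nat) (X : 'M[R]_(n, p)) (y : 'cV[R]_n) (b' : R)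
  (t : R) (l : 'cV[R]_p) : R :=
  (y^T *m (1%:M - X *m Lam l *m invmx (t^-1 *: 1%:M + Lam l *m XtX X *m Lam l)
           *m Lam l *m X^T) *m y) 0 0 / 2 + b'.

Definition h_lam (R : realType) (d : R) (pil : R -> R)
  (t bk thk s2 : R) (u : R) : R :=
  expR (- (Num.sqrt t * u * bk - thk) ^+ 2 / (2 * d * s2)) * pil u.

Definition h_tau2 (R : realType) (n p : nat) (X : 'M[R]_(n, p)) (y : 'cV[R]_n)
  (a' b' : R) (pit : R -> R) (x : state R p) (l : 'cV[R]_p) (t : R) : R :=
  pit t * powR (\det (1%:M + t *: (Lam l *m XtX X *m Lam l))) (- (1 / 2))
        * powR (Rfun X y b' t l) (- (n%:R / 2 + a')).

Definition h_tau3 (R : realType) (n p : nat) (X : 'M[R]_(n, p)) (y : 'cV[R]_n)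
  (pit : R -> R) (x : state R p) (l : 'cV[R]_p) (t : R) : R :=
  let be := s_beta x in let s2 := s_sig2 x in
  expR (- t * (be^T *m Lam l *m XtX X *m Lam l *m be) 0 0 / (2 * s2)
        + Num.sqrt t * (be^T *m Lam l *m X^T *m y) 0 0 / s2) * pit t.

(* (c) sigma^2 ~ IG(n/2 + a', R(tau^2, lambda)) *)
Definition h_sig2 (R : realType) (n p : nat) (X : 'M[R]_(n, p)) (y : 'cV[R]_n)
  (a' b' : R) (t : R) (l : 'cV[R]_p) (s : R) : R :=
  powR s (- (n%:R / 2 + a') - 1) * expR (- Rfun X y b' t l / s).

(* (c) beta~ ~ N_p(M^{-1} Lam X^T y sqrt t, s2 M^{-1}), M = I + t Lam X^T X Lam *)
Definition h_beta (R : realType) (n p : nat) (X : 'M[R]_(n, p)) (y : 'cV[R]_n)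
  (t s2 : R) (l : 'cV[R]_p) (v : 'cV[R]_p) : R :=
  let M := 1%:M + t *: (Lam l *m XtX X *m Lam l) in
  let m := Num.sqrt t *: (invmx M *m Lam l *m X^T *m y) in
  expR (- ((v - m)^T *m M *m (v - m)) 0 0 / (2 * s2)).

(* (c) theta ~ N_p(A^{-1}(sqrt t (lambda o beta~)/d + b), s2 A^{-1}) *)
Definition h_theta (R : realType) (n p : nat) (X : 'M[R]_(n, p)) (y : 'cV[R]_n) (d : R)
  (t s2 : R) (l be : 'cV[R]_p) (v : 'cV[R]_p) : R :=
  let A := Amat X d in
  let m := invmx A *m ((Num.sqrt t / d) *: (Lam l *m be) + bvec X y d) in
  expR (- ((v - m)^T *m A *m (v - m)) 0 0 / (2 * s2)).

(* One iteration of the Gibbs-type sampler, as an operator on nonnegative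
   test functions: (P f)(x) = E[ f(X_1) | X_0 = x ].  The tau^2-update is
   given by the unnormalised density htau (x = current state, l = new lambda). *)
Definition gibbs_op (R : realType) (n p : nat) (X : 'M[R]_(n, p)) (y : 'cV[R]_n)
  (a' b' d : R) (pil : R -> R) (htau : state R p -> 'cV[R]_p -> R -> R)
  (f : state R p -> \bar R) (x : state R p) : \bar R :=
  (vint (fun l : 'cV[R]_p =>
     (\prod_(k < p) ndens setT
        (h_lam d pil (s_tau2 x) (s_beta x k 0) (s_theta x k 0) (s_sig2 x)) (l k 0))%:E *
     \int[@lebesgue_measure R]_(t in [set u : R | (0 < u)%R])
       ((ndens [set u : R | (0 < u)%R] (htau x l) t)%:E *
        \int[@lebesgue_measure R]_(s in [set u : R | (0 < u)%R])
          ((ndens [set u : R | (0 < u)%R] (h_sig2 X y a' b' t l) s)%:E *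
           vint (fun be : 'cV[R]_p =>
             (ndensv (h_beta X y t s l) be)%:E *
             vint (fun th : 'cV[R]_p =>
               (ndensv (h_theta X y d t s l be) th)%:E *
               f (mkState th be s t l)))))))%E.

Definition alg2_op (R : realType) (n p : nat) (X : 'M[R]_(n, p)) (y : 'cV[R]_n)
  (a' b' d : R) (pit pil : R -> R) :=
  gibbs_op X y a' b' d pil (h_tau2 X y a' b' pit).

Definition alg3_op (R : realType) (n p : nat) (X : 'M[R]_(n, p)) (y : 'cV[R]_n)
  (a' b' d : R) (pit pil : R -> R) :=
  gibbs_op X y a' b' d pil (h_tau3 X y pit).

Definition valid_state (R : realType) (p : nat) (x : state R p) : Prop :=
  0 < s_sig2 x /\ 0 < s_tau2 x.

Definition geom_ergodic (R : realType) (p : nat)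
  (P : (state R p -> \bar R) -> state R p -> \bar R) : Prop :=
  exists (pi : set (state R p) -> R) (M : state R p -> R) (rho : R),
    0 <= rho < 1 /\
    forall x, valid_state x -> forall (m : nat) (A : set (state R p)),
      @state_measurable R p A ->
      (`| iter m P (fun z => (\1_A z)%:E) x - (pi A)%:E | <= (M x * rho ^+ m)%:E)%E.

Definition prob_density (R : realType) (D : set R) (f : R -> R) : Prop :=
  measurable_fun setT f /\ (forall x, 0 <= f x) /\
  (\int[@lebesgue_measure R]_(x in D) (f x)%:E = 1)%E.

(* Main.v *)
(* Both chains are uniformly ergodic: the two-step kernel satisfies Doeblin's
   condition, so it contracts oscillations and the constant M does not depend
   on the initial state.

   In the coordinates beta~/sigma, theta/sigma the old state enters the
   lambda-update only through tau^2 beta~_k^2/sigma^2 and theta_k^2/sigma^2,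
   so on a region where these are bounded (and sigma^2 >= 1) one step dominates
   a fixed nonzero measure.  That region is reached in one step from anywhere
   with probability bounded below:
   - b' <= R(tau^2, lambda) <= |y|^2/2 + b', so sigma^2 >= 1 has probability
     bounded below uniformly in tau^2 and lambda;
   - the precision matrices dominate the identity, and the conditional mean m of
     beta~ satisfies |m| <= |y| and tau |X Lambda m| <= |y|, so beta~/sigma and
     tau Lambda beta~/sigma (X is injective), hence theta/sigma, are tight
     uniformly in lambda;
   - in Algorithm 2, t |-> det(I + t Lambda X^T X Lambda)^(-1/2) is decreasing,
     so, up to constants, the tau^2-update is stochastically smaller than pi_tau;
     in Algorithm 3, tau^2 is bounded.
   One step is the composition of five updates, each changing one component of
   the state. *)
Require Import Defs.
From HB Require Import structures.
From mathcomp Require Import all_boot all_order all_algebra.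
From mathcomp Require Import all_classical all_reals all_analysis.
From mathcomp Require Import measurable_realfun ring lra.
Set Implicit Arguments. Unset Strict Implicit. Unset Printing Implicit Defensive.
Import Order.TTheory GRing.Theory Num.Theory.
Local Open Scope classical_set_scope.
Local Open Scope ring_scope.

(** [geom_ergodic] is phrased through operators on nonnegative test functions, and the proof stays
    there: the range of [iter m P f] over valid states shrinks, and the limit of each indicator is
    read off as a supremum, with no invariant measure built beforehand. Outside the valid states a
    normalizing integral can be infinite and the kernel then loses its mass, so [P 1 = 1] is
    restricted to valid states and is transported by monotonicity rather than by rewriting.

    Two factors degenerate as the new lambda grows. In Algorithm 2 the determinant factor tends to
    0; it is only compared with its own value at a median of [pit], and this value cancels after
    normalization. In Algorithm 3 the exponent contains [X *m Lam l *m be], which is unbounded in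
    [l] even when beta~/sigma is bounded, so the domination cannot be expected to be uniform in
    lambda. The minorant of the tau^2-update is therefore allowed to depend on the lambda drawn in
    the same step and to lose mass like [expR (- (k * sqn l))]; integrated against the minorant of
    the lambda-update this still leaves a positive mass. With this relaxation one abstract argument
    covers both algorithms. *)

(** * Integrals as functionals *)

(* States, vectors and sequences carry no canonical measurable structure:
   measurability of a function on such a type [U] is tested on the measurable
   families [T -> U], [T] an arbitrary measurable space. *)
Definition elements (U : Type) : Type :=
  forall d (T : measurableType d), (T -> U) -> Prop.

Definition real_elt (R : realType) : elements R :=
  fun d T u => measurable_fun [set: T] u.

Definition mx_elt (R : realType) (m n : nat) : elements 'M[R]_(m, n) :=
  fun d T M => forall i j, measurable_fun [set: T] (fun z => M z i j).
Arguments mx_elt {R m n} d T M.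

Definition seq_elt (R : realType) : elements (seq R) :=
  fun d T s => forall i, measurable_fun [set: T] (fun z => nth 0 (s z) i).

Definition meas (R : realType) (U : Type) (elt : elements U) (f : U -> \bar R) :=
  forall d (T : measurableType d) (u : T -> U), elt d T u ->
    measurable_fun [set: T] (fun z => f (u z)).

(** Joint measurability on the product of [T0] and [U] although [U] has no sigma-algebra: both
    arguments are tested along maps from a common space. *)
Definition pmeas (R : realType) (U : Type) (elt : elements U) d0
    (T0 : measurableType d0) (g : T0 -> U -> \bar R) :=
  forall d (T : measurableType d) (phi : T -> T0) (u : T -> U),
    measurable_fun [set: T] phi -> elt d T u ->
    measurable_fun [set: T] (fun z => g (phi z) (u z)).

(** Common interface of integrals over the line, over [(0, +oo)] and of iterated integrals.
    [int_meas] makes parametrized integrals measurable, so that integrals can be nested; [D] is the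
    domain of integration, so that [int_le] compares integrands only where they count. *)
Record integrator (R : realType) (U : Type) (elt : elements U) (D : set U)
    (I : (U -> \bar R) -> \bar R) : Prop := Integrator {
  int_meas : forall d (T : measurableType d) (g : T -> U -> \bar R),
    pmeas elt g -> (forall z u, 0 <= g z u)%E ->
    measurable_fun [set: T] (fun z => I (g z));
  int_ge0 : forall f, (forall u, 0 <= f u)%E -> (0 <= I f)%E;
  int_add : forall f g, meas elt f -> meas elt g ->
    (forall u, 0 <= f u)%E -> (forall u, 0 <= g u)%E ->
    I (fun u => f u + g u)%E = (I f + I g)%E;
  int_scale : forall (k : R) f, 0 <= k -> meas elt f -> (forall u, 0 <= f u)%E ->
    I (fun u => k%:E * f u)%E = (k%:E * I f)%E;
  int_le : forall f g, meas elt f -> meas elt g ->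
    (forall u, 0 <= f u)%E -> (forall u, 0 <= g u)%E ->
    (forall u, D u -> f u <= g u)%E -> (I f <= I g)%E }.

Lemma measurable_integral (R : realType) d (T : measurableType d) (D : set R)
    (g : T -> R -> \bar R) :
  measurable D -> measurable_fun [set: T * R] (fun z => g z.1 z.2) ->
  (forall z u, 0 <= g z u)%E ->
  measurable_fun [set: T] (fun z => \int[@lebesgue_measure R]_(u in D) g z u)%E.
Proof.
move=> mD mg g0.
(* The restriction to [D] is turned into an indicator factor, which makes this the inner integral of
   a function on the full product. *)
rewrite (_ : (fun _ => _) = fubini_F (@lebesgue_measure R)
    (fun z : T * measurableTypeR R => (g z.1 z.2 * (\1_D z.2)%:E)%E)); last first.
  apply/funext => z; rewrite /fubini_F /= integral_mkcond.
  apply: eq_integral => x _; rewrite patchE indicE.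
  by case: ifP; rewrite ?mule1 ?mule0.
apply: measurable_fun_fubini_tonelli_F.
  apply: emeasurable_funM => //.
  apply/measurable_EFinP.
  by apply: measurableT_comp; [exact: measurable_indic|exact: measurable_snd].
by move=> x; rewrite mule_ge0// lee_fin indicE.
Qed.

Lemma real_integrator (R : realType) (D : set R) : measurable D ->
  integrator (@real_elt R) D
    (fun f : R -> \bar R => \int[@lebesgue_measure R]_(u in D) f u)%E.
Proof.
move=> mD.
have mm (f : R -> \bar R) : meas (@real_elt R) f -> measurable_fun D f.
  by move=> mf; apply: measurable_funTS; apply: (mf _ _ id); exact: measurable_id.
split.
- move=> d T g mg g0; apply: measurable_integral => //.
  by apply: (mg _ (T * R)%type fst snd);
    [exact: measurable_fst|exact: measurable_snd].
- by move=> f f0; apply: integral_ge0.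
- by move=> f g mf mg f0 g0; rewrite ge0_integralD//; exact: mm.
- by move=> k f k0 mf f0; rewrite ge0_integralZl_EFin//; exact: mm.
- by move=> f g mf mg f0 g0 fg; apply: ge0_le_integral => //; exact: mm.
Qed.

Lemma seq_elt_cons (R : realType) d (T : measurableType d) (x : T -> R)
    (s : T -> seq R) :
  measurable_fun [set: T] x -> seq_elt s -> seq_elt (fun z => x z :: s z).
Proof. by move=> mx ms [|i] //=. Qed.

Lemma pmeas_meas (R : realType) (U : Type) (elt : elements U) d0
    (T0 : measurableType d0) (g : T0 -> U -> \bar R) z :
  pmeas elt g -> meas elt (g z).
Proof. by move=> mg d T u mu; apply: (mg _ _ (fun=> z)). Qed.

Lemma pmeas_cons (R : realType) (g : seq R -> \bar R) :
  meas (@seq_elt R) g -> pmeas (@seq_elt R) (fun (x : R) s => g (x :: s)).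
Proof. by move=> mg d T x s mx ms; apply: mg; exact: seq_elt_cons. Qed.

Lemma meas_cons (R : realType) (g : seq R -> \bar R) x :
  meas (@seq_elt R) g -> meas (@seq_elt R) (fun s => g (x :: s)).
Proof. by move=> mg; exact: (pmeas_meas (g := fun x s => g (x :: s)) x (pmeas_cons mg)). Qed.

Lemma iint_ge0 (R : realType) k (f : seq R -> \bar R) :
  (forall u, 0 <= f u)%E -> (0 <= iint k f)%E.
Proof.
by elim: k f => [|k IH] f f0 //=; apply: integral_ge0 => x _; exact: IH.
Qed.

Lemma measurable_iint (R : realType) k d (T : measurableType d)
    (g : T -> seq R -> \bar R) :
  pmeas (@seq_elt R) g -> (forall z u, 0 <= g z u)%E ->
  measurable_fun [set: T] (fun z => iint k (g z)).
Proof.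
elim: k d T g => [|k IH] d T g mg g0 /=.
  by apply: (mg _ _ id) => //; move=> i; exact: measurable_cst.
apply: (@measurable_integral _ _ _ setT (fun z x => iint k (fun s => g z (x :: s)))) => //.
  apply: (IH _ _ (fun (zx : T * R) s => g zx.1 (zx.2 :: s))) => // d' T' phi u mphi mu.
  apply: mg; first exact: measurableT_comp.
  by apply: seq_elt_cons => //; exact: measurableT_comp.
by move=> z x; exact: iint_ge0.
Qed.

Lemma iint_integrator (R : realType) k :
  integrator (@seq_elt R) setT (@iint R k).
Proof.
have mi j f : meas (@seq_elt R) f -> (forall u, 0 <= f u)%E ->
    measurable_fun setT (fun x : R => iint j (fun s => f (x :: s))).
  by move=> mf f0; apply: measurable_iint => //; exact: pmeas_cons.
split.
- by move=> d T g; exact: measurable_iint.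
- by move=> f; exact: iint_ge0.
- elim: k => [|k IH] f g mf mg f0 g0 //=.
  rewrite -ge0_integralD//; try by [exact: mi|move=> x _; exact: iint_ge0].
  by apply: eq_integral => x _; rewrite IH//; exact: meas_cons.
- elim: k => [|k IH] c f c0 mf f0 //=.
  rewrite -ge0_integralZl_EFin//; try by [exact: mi|move=> x _; exact: iint_ge0].
  by apply: eq_integral => x _; rewrite IH//; exact: meas_cons.
- elim: k => [|k IH] f g mf mg f0 g0 fg //=; first exact: fg.
  apply: ge0_le_integral => //; try by [exact: mi|move=> x _; exact: iint_ge0].
  by move=> x _; apply: IH => //; try exact: meas_cons; move=> s _; exact: fg.
Qed.

Lemma mx_elt_col (R : realType) p d (T : measurableType d) (s : T -> seq R) :
  seq_elt s -> mx_elt d T (fun z => \col_(i < p) nth 0 (s z) i).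
Proof.
by move=> ms i j; apply: eq_measurable_fun (ms i) => z _; rewrite mxE.
Qed.

Lemma vint_integrator (R : realType) p :
  integrator (@mx_elt R p 1) setT (@vint R p).
Proof.
have ms f : meas (@mx_elt R p 1) f ->
    meas (@seq_elt R) (fun s => f (\col_(i < p) nth 0 s i)).
  by move=> mf d T s ms; apply: mf; exact: mx_elt_col.
have [I1 I2 I3 I4 I5] := iint_integrator R p.
split.
- move=> d T g mg g0; apply: I1 => // d' T' phi u mphi mu.
  by apply: mg => //; exact: mx_elt_col.
- by move=> f f0; apply: I2.
- by move=> f g mf mg f0 g0; apply: I3 => //; exact: ms.
- by move=> k f k0 mf f0; apply: I4 => //; exact: ms.
- by move=> f g mf mg f0 g0 fg; apply: I5 => //; try exact: ms; move=> s _; exact: fg.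
Qed.

(** * Positive operators and Doeblin contraction *)

(** A kernel seen through its action on nonnegative functions. The algebraic identities hold at
    every state; the comparison is relative to [valid], and so it also says that [P f] on valid
    states depends only on the values of [f] there. *)
Record pos_op (R : realType) (S : Type) (elt : elements S) (valid : S -> Prop)
    (P : (S -> \bar R) -> S -> \bar R) : Prop := PosOp {
  po_ge0 : forall f, (forall x, 0 <= f x)%E -> forall x, (0 <= P f x)%E;
  po_meas : forall f, meas elt f -> (forall x, 0 <= f x)%E -> meas elt (P f);
  po_add : forall f g, meas elt f -> meas elt g ->
    (forall x, 0 <= f x)%E -> (forall x, 0 <= g x)%E ->
    forall x, P (fun z => f z + g z)%E x = (P f x + P g x)%E;
  po_scale : forall (k : R) f, 0 <= k -> meas elt f -> (forall x, 0 <= f x)%E ->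
    forall x, P (fun z => k%:E * f z)%E x = (k%:E * P f x)%E;
  po_le : forall f g, meas elt f -> meas elt g ->
    (forall x, 0 <= f x)%E -> (forall x, 0 <= g x)%E ->
    (forall x, valid x -> f x <= g x)%E -> forall x, valid x -> (P f x <= P g x)%E }.

Lemma pos_op_comp (R : realType) (S : Type) (elt : elements S) (valid : S -> Prop)
    (P Q : (S -> \bar R) -> S -> \bar R) :
  pos_op elt valid P -> pos_op elt valid Q -> pos_op elt valid (fun f => P (Q f)).
Proof.
move=> [p1 p2 p3 p4 p5] [q1 q2 q3 q4 q5]; split.
- by move=> f f0; exact/p1/q1.
- by move=> f mf f0; apply: p2; [exact: q2|exact: q1].
- move=> f g mf mg f0 g0 x; rewrite -p3; try exact: q2; try exact: q1.
  by congr P; apply/funext => z; exact: q3.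
- move=> k f k0 mf f0 x; rewrite -p4//; [|exact: q2|exact: q1].
  by congr P; apply/funext => z; exact: q4.
- by move=> f g mf mg f0 g0 fg; apply: p5; by [exact: q2|exact: q1|exact: q5].
Qed.

Lemma pos_op_scale (R : realType) (S : Type) (elt : elements S) (valid : S -> Prop)
    (P : (S -> \bar R) -> S -> \bar R) (k : R) : 0 <= k ->
  pos_op elt valid P -> pos_op elt valid (fun f x => k%:E * P f x)%E.
Proof.
move=> k0 [p1 p2 p3 p4 p5]; split.
- by move=> f f0 x; rewrite mule_ge0// p1.
- by move=> f mf f0 d T u mu; apply: emeasurable_funM => //; exact: p2.
- by move=> f g mf mg f0 g0 x; rewrite p3// ge0_muleDr// p1.
- by move=> c f c0 mf f0 x; rewrite p4// muleCA.
- by move=> f g mf mg f0 g0 fg x vx; rewrite lee_wpmul2l// p5.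
Qed.

Definition unital (R : realType) (S : Type) (valid : S -> Prop)
    (P : (S -> \bar R) -> S -> \bar R) :=
  forall x, valid x -> P (fun=> 1%E) x = 1%E.

(** [Q] maps 1 to 1 only on valid states, so it cannot be rewritten under [P]; two comparisons by
    [po_le] take the place of the rewriting. *)
Lemma unital_comp (R : realType) (S : Type) (elt : elements S) (valid : S -> Prop)
    (P Q : (S -> \bar R) -> S -> \bar R) :
  pos_op elt valid P -> pos_op elt valid Q -> unital valid P -> unital valid Q ->
  unital valid (fun f => P (Q f)).
Proof.
move=> opP opQ P1 Q1 x vx; rewrite -[RHS](P1 x vx).
have m1 : meas elt (fun _ : S => 1%E : \bar R) by move=> d T u _; exact: measurable_cst.
have mQ1 := po_meas opQ m1 (fun=> lee01).
have Q0 := po_ge0 opQ (fun _ : S => lee01 : (0 <= 1 :> \bar R)%E).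
apply/eqP; rewrite eq_le; apply/andP.
by split; apply: (po_le opP) => // z vz; rewrite Q1.
Qed.

Definition ind (R : realType) (S : Type) (A : S -> bool) (x : S) : \bar R :=
  ((A x)%:R)%:E.
Arguments ind R {S} A x.

Lemma ind_ge0 (R : realType) (S : Type) (A : S -> bool) x : (0 <= ind R A x)%E.
Proof. by rewrite lee_fin. Qed.

(** Lower bounds are propagated backwards through the updates: what the later updates achieve from
    [A] is multiplied by the probability [c'] that the present update leads from [B] into [A]. *)
Lemma lower_comp (R : realType) (S : Type) (elt : elements S) (valid : S -> Prop)
    (P : (S -> \bar R) -> S -> \bar R) f (A B : S -> bool) (c c' : R) :
  pos_op elt valid P -> 0 <= c -> meas elt f -> (forall x, 0 <= f x)%E ->
  meas elt (ind R A) ->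
  (forall x, valid x -> c%:E * ind R A x <= f x)%E ->
  (forall x, valid x -> c'%:E * ind R B x <= P (ind R A) x)%E ->
  forall x, valid x -> ((c * c')%:E * ind R B x <= P f x)%E.
Proof.
move=> opP c0 mf f0 mA fA PB x vx.
apply: (@le_trans _ _ (P (fun z => c%:E * ind R A z) x)%E); last first.
  apply: (po_le opP) => //; first by move=> d T u mu; apply: emeasurable_funM => //; exact: mA.
  by move=> z; rewrite mule_ge0// ind_ge0.
rewrite (po_scale opP)//; last exact: ind_ge0.
by rewrite EFinM -muleA lee_wpmul2l//; exact: PB.
Qed.

(** * Kernels that redraw one component of the state from a weight *)

Section stage.
Context (R : realType) (S U : Type) (eltS : elements S) (eltU : elements U).
Context (valid : S -> Prop) (D : set U) (I : (U -> \bar R) -> \bar R).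
Context (w : S -> U -> R) (upd : S -> U -> S).

Definition stage (f : S -> \bar R) (x : S) : \bar R :=
  I (fun u => (w x u)%:E * f (upd x u))%E.

Definition meas2 (h : S -> U -> R) :=
  forall d (T : measurableType d) (x : T -> S) (u : T -> U),
    eltS x -> eltU u -> measurable_fun [set: T] (fun z => h (x z) (u z)).

Definition meas_upd :=
  forall d (T : measurableType d) (x : T -> S) (u : T -> U),
    eltS x -> eltU u -> eltS (fun z => upd (x z) (u z)).

Hypothesis int : integrator eltU D I.
Hypothesis cstS : forall d (T : measurableType d) x, eltS (fun _ : T => x).
Hypothesis compS : forall d d' (T : measurableType d) (T' : measurableType d')
  (x : T' -> S) (phi : T -> T'), measurable_fun [set: T] phi -> eltS x ->
  eltS (x \o phi).
Hypothesis w0 : forall x u, 0 <= w x u.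
Hypothesis mw : meas2 w.
Hypothesis mupd : meas_upd.
Hypothesis vupd : forall x u, valid x -> D u -> valid (upd x u).

Lemma stage_pmeas f d (T : measurableType d) (x : T -> S) :
  meas eltS f -> eltS x ->
  pmeas eltU (fun z u => (w (x z) u)%:E * f (upd (x z) u))%E.
Proof.
move=> mf mx d' T' phi u mphi mu.
have mxp := compS mphi mx.
apply: emeasurable_funM.
  by apply/measurable_EFinP; exact: (mw mxp mu).
by apply: mf; exact: (mupd mxp mu).
Qed.

Lemma stage_meas1 f x : meas eltS f ->
  meas eltU (fun u => (w x u)%:E * f (upd x u))%E.
Proof.
move=> mf.
exact: (pmeas_meas (g := fun (_ : R) u => (w x u)%:E * f (upd x u))%E 0
  (stage_pmeas (x := fun _ : R => x) mf (cstS _ _))).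
Qed.

Lemma stage_ge0 f x : (forall x, 0 <= f x)%E -> (0 <= stage f x)%E.
Proof. by move=> f0; apply: (int_ge0 int) => u; rewrite mule_ge0// lee_fin. Qed.

Lemma le_stage f g x : meas eltS f -> meas eltS g ->
  (forall x, 0 <= f x)%E -> (forall x, 0 <= g x)%E ->
  (forall u, D u -> f (upd x u) <= g (upd x u))%E -> (stage f x <= stage g x)%E.
Proof.
move=> mf mg f0 g0 fg; apply: (int_le int).
- exact: stage_meas1.
- exact: stage_meas1.
- by move=> u; rewrite mule_ge0// lee_fin.
- by move=> u; rewrite mule_ge0// lee_fin.
- by move=> u Du; rewrite lee_wpmul2l ?lee_fin//; exact: fg.
Qed.

Lemma stage_pos_op : pos_op eltS valid stage.
Proof.
split.
- by move=> f f0 x; exact: stage_ge0.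
- move=> f mf f0 d T x mx; apply: (int_meas int); first exact: stage_pmeas.
  by move=> z u; rewrite mule_ge0// lee_fin.
- move=> f g mf mg f0 g0 x; rewrite /stage -(int_add int).
  + by congr I; apply/funext => u; rewrite ge0_muleDr.
  + exact: stage_meas1.
  + exact: stage_meas1.
  + by move=> u; rewrite mule_ge0// lee_fin.
  + by move=> u; rewrite mule_ge0// lee_fin.
- move=> k f k0 mf f0 x; rewrite /stage -(int_scale int)//.
  + by congr I; apply/funext => u; rewrite muleCA.
  + exact: stage_meas1.
  + by move=> u; rewrite mule_ge0// lee_fin.
- by move=> f g mf mg f0 g0 fg x vx; apply: le_stage => // u Du; apply: fg; exact: vupd.
Qed.

End stage.

Lemma stage_le_weight (R : realType) (S U : Type) (eltS : elements S)
    (eltU : elements U) (D : set U) (I : (U -> \bar R) -> \bar R)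
    (w w' : S -> U -> R) (upd : S -> U -> S) f x :
  integrator eltU D I ->
  (forall d (T : measurableType d) x, eltS d T (fun _ : T => x)) ->
  (forall d d' (T : measurableType d) (T' : measurableType d')
    (x : T' -> S) (phi : T -> T'), measurable_fun [set: T] phi -> eltS d' T' x ->
    eltS d T (x \o phi)) ->
  (forall x u, 0 <= w x u) -> (forall x u, 0 <= w' x u) ->
  meas2 eltS eltU w -> meas2 eltS eltU w' -> meas_upd eltS eltU upd ->
  meas eltS f -> (forall x, 0 <= f x)%E -> (forall u, D u -> w x u <= w' x u) ->
  (stage I w upd f x <= stage I w' upd f x)%E.
Proof.
move=> int cstS compS w0 w'0 mw mw' mupd mf f0 ww'; apply: (int_le int).
- exact: (stage_meas1 cstS compS mw mupd).
- exact: (stage_meas1 cstS compS mw' mupd).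
- by move=> u; rewrite mule_ge0// lee_fin.
- by move=> u; rewrite mule_ge0// lee_fin.
- by move=> u Du; rewrite lee_wpmul2r// lee_fin ww'.
Qed.

(** * Uniform convergence from a minorization of the two-step kernel *)

Section doeblin.
Context (R : realType) (S : Type) (elt : elements S) (valid : S -> Prop).
Context (P : (S -> \bar R) -> S -> \bar R) (K : (S -> \bar R) -> S -> \bar R) (x0 : S).
Hypothesis opP : pos_op elt valid P.
Hypothesis opK : pos_op elt valid K.
Hypothesis vx0 : valid x0.
Hypothesis P1 : unital valid P.
Hypothesis minor : forall f (b : R) x, meas elt f -> (forall x, 0 <= f x <= b%:E)%E ->
  valid x -> (K f x0 <= P (P f) x)%E.
Hypothesis K1 : (0 < K (fun=> 1%E) x0)%E.

Let meas_cst c : meas elt (fun _ : S => c : \bar R).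
Proof. by move=> d T u _; exact: measurable_cst. Qed.

Let P_cst (c : R) x : 0 <= c -> valid x -> P (fun=> c%:E) x = c%:E.
Proof.
move=> c0 vx; have := po_scale opP c0 (meas_cst 1%E) (fun=> lee01) x.
by rewrite P1// mule1.
Qed.

Let PP := pos_op_comp opP opP.

Let PP_cst (c : R) x : 0 <= c -> valid x -> P (P (fun=> c%:E)) x = c%:E.
Proof.
move=> c0 vx; rewrite -[RHS](P_cst c0 vx); apply/eqP; rewrite eq_le.
have c0' : forall x : S, (0 <= c%:E)%E by move=> _; rewrite lee_fin.
have mPc : meas elt (P (fun=> c%:E)) by apply: (po_meas opP).
have Pc0 := po_ge0 opP c0'.
by apply/andP; split; apply: (po_le opP) => // z vz; rewrite P_cst.
Qed.

Let ge_cst (f : S -> \bar R) (a : R) : 0 <= a -> meas elt f -> (forall x, 0 <= f x)%E ->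
  (forall x, valid x -> a%:E <= f x)%E -> forall x, valid x -> (a%:E <= P f x)%E.
Proof.
move=> a0 mf f0 af x vx; rewrite -(P_cst a0 vx).
by apply: (po_le opP) => // z; rewrite lee_fin.
Qed.

Let le_cst (f : S -> \bar R) (b : R) : 0 <= b -> meas elt f -> (forall x, 0 <= f x)%E ->
  (forall x, valid x -> f x <= b%:E)%E -> forall x, valid x -> (P f x <= b%:E)%E.
Proof.
move=> b0 mf f0 fb x vx; rewrite -(P_cst b0 vx).
by apply: (po_le opP) => // z; rewrite lee_fin.
Qed.

Let K1le1 : (K (fun=> 1%E) x0 <= 1)%E.
Proof.
rewrite -[leRHS](PP_cst ler01 vx0); apply: (minor (b := 1)) => //= _.
by rewrite lexx lee_fin ler01.
Qed.

Let e := fine (K (fun=> 1%E) x0).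

Let eE : K (fun=> 1%E) x0 = e%:E.
Proof.
rewrite /e fineK// ge0_fin_numE; last exact: ltW.
by rewrite (le_lt_trans K1le1)// ltry.
Qed.

Let e01 : 0 < e <= 1.
Proof. by rewrite -!lte_fin -lee_fin -eE K1 K1le1. Qed.

(* Doeblin: [K . x0] is the common part of all the two-step kernels, [e] its mass. *)
Lemma oscillation_contraction (f : S -> \bar R) (a b : R) : 0 <= a -> a <= b ->
  meas elt f -> (forall x, 0 <= f x)%E ->
  (forall x, valid x -> a%:E <= f x <= b%:E)%E ->
  exists a' b' : R, [/\ 0 <= a', a' <= b', b' - a' <= (1 - e) * (b - a) &
    forall x, valid x -> (a'%:E <= P (P f) x <= b'%:E)%E].
Proof.
move=> a0 ab mf f0 fab.
(* [F] is real-valued and lies in [[a, b]] at every state, while [f] is controlled only on valid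
   ones, where both agree. Thus [F - a] and [b - F] are nonnegative and bounded everywhere, as
   [minor] requires. *)
pose F x := Num.max a (Num.min b (fine (f x))).
have aF x : a <= F x by rewrite le_max lexx.
have Fb x : F x <= b by rewrite ge_max ab ge_min lexx.
have fF x : valid x -> f x = (F x)%:E.
  move=> /fab/andP[af fb].
  have ff : f x \is a fin_num.
    by rewrite ge0_fin_numE// (le_lt_trans fb)// ltry.
  rewrite -[LHS](fineK ff); congr EFin; rewrite /F.
  move: af fb; rewrite -(fineK ff) !lee_fin => af fb.
  by rewrite (min_idPr fb) (max_idPr af).
have mF d (T : measurableType d) (u : T -> S) : elt u ->
    measurable_fun [set: T] (fun z => F (u z)).
  move=> mu; apply: measurable_maxr; first exact: measurable_cst.
  apply: measurable_minr; first exact: measurable_cst.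
  by apply: measurableT_comp => //; exact: mf.
(* The minorization is applied to the distances to both endpoints: [K g1 x0] raises the lower bound,
   [K g2 x0] lowers the upper one, and together they amount to [(b - a) * e]. *)
pose g1 x := (F x - a)%:E; pose g2 x := (b - F x)%:E.
have g10 x : (0 <= g1 x)%E by rewrite lee_fin subr_ge0.
have g20 x : (0 <= g2 x)%E by rewrite lee_fin subr_ge0.
have mg1 : meas elt g1.
  by move=> d T u mu; apply/measurable_EFinP; apply: measurable_funB => //; exact: mF.
have mg2 : meas elt g2.
  by move=> d T u mu; apply/measurable_EFinP; apply: measurable_funB => //; exact: mF.
have mFE : meas elt (fun x => (F x)%:E).
  by move=> d T u mu; apply/measurable_EFinP; exact: mF.
have F0 x : (0 <= (F x)%:E)%E by rewrite lee_fin (le_trans a0).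
have ba0 : 0 <= b - a by rewrite subr_ge0.
have sumP x : valid x -> (P (P g1) x + P (P g2) x = (b - a)%:E)%E.
  move=> vx; rewrite -(po_add PP)// -[RHS](PP_cst ba0 vx).
  by congr (P (P _)); apply/funext => z; rewrite -EFinD; congr EFin; ring.
have PF x : valid x -> (P (P f) x = P (P g1) x + a%:E)%E.
  move=> vx; transitivity (P (P (fun z => (F z)%:E)) x).
    by apply/eqP; rewrite eq_le; apply/andP; split; apply: (po_le PP) => // z vz;
      rewrite fF.
  rewrite -(PP_cst a0 vx) -(po_add PP)//.
    by congr (P (P _)); apply/funext => z; rewrite -EFinD; congr EFin; ring.
have sumK : (K g1 x0 + K g2 x0 = ((b - a) * e)%:E)%E.
  rewrite -(po_add opK)// EFinM -eE -(po_scale opK)//.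
  congr K; apply/funext => z; rewrite mule1 -EFinD; congr EFin; ring.
have Kg10 : (0 <= K g1 x0)%E by exact: (po_ge0 opK).
have Kg20 : (0 <= K g2 x0)%E by exact: (po_ge0 opK).
have Kf1 : K g1 x0 \is a fin_num.
  by rewrite ge0_fin_numE// (@le_lt_trans _ _ ((b - a) * e)%:E)%E ?ltry// -sumK leeDl.
have Kf2 : K g2 x0 \is a fin_num.
  by rewrite ge0_fin_numE// (@le_lt_trans _ _ ((b - a) * e)%:E)%E ?ltry// -sumK leeDr.
move: sumK Kg10 Kg20; rewrite -(fineK Kf1) -(fineK Kf2).
set n1 := fine _; set n2 := fine _.
rewrite -EFinD !lee_fin => -[sumK] n10 n20.
have bnd x : valid x -> ((a + n1)%:E <= P (P f) x <= (b - n2)%:E)%E.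
  move=> vx; rewrite PF//.
  have m1 : (n1%:E <= P (P g1) x)%E.
    rewrite /n1 fineK//; apply: (minor (b := b - a)) => // z.
    by rewrite g10 lee_fin lerB.
  have m2 : (n2%:E <= P (P g2) x)%E.
    rewrite /n2 fineK//; apply: (minor (b := b - a)) => // z.
    by rewrite g20 lee_fin lerB.
  have := sumP x vx.
  have p1 : (0 <= P (P g1) x)%E by exact: (po_ge0 PP).
  have p2 : (0 <= P (P g2) x)%E by exact: (po_ge0 PP).
  move: m1 m2 p1 p2; case: (P (P g1) x) => [u1| |] //; case: (P (P g2) x) => [u2| |] //.
  rewrite -!EFinD !lee_fin => m1 m2 p1 p2 [H].
  by apply/andP; split; lra.
exists (a + n1), (b - n2); split => //.
- by rewrite addr_ge0.
(* The new bounds are in the right order because they enclose the value at the valid state [x0]. *)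
- by have /bnd/andP[/le_trans/[apply]] := vx0; rewrite lee_fin.
- by rewrite mulrBl mul1r (mulrC e) -sumK; lra.
Qed.

Lemma oscillation_decay (f : S -> \bar R) : meas elt f -> (forall x, 0 <= f x <= 1)%E ->
  forall m, exists a b : R, [/\ 0 <= a, a <= b, b - a <= (1 - e) ^+ m./2 &
    forall x, valid x -> (a%:E <= iter m P f x <= b%:E)%E].
Proof.
move=> mf f01.
have f0 x : (0 <= f x)%E by have /andP[] := f01 x.
have mi m : meas elt (iter m P f) /\ forall x, (0 <= iter m P f x)%E.
  elim: m => [|m [IH1 IH2]] //=; split; [exact: (po_meas opP)|exact: (po_ge0 opP)].
have main m : exists a b : R, [/\ 0 <= a, a <= b, b - a <= (1 - e) ^+ m &
    forall x, valid x -> (a%:E <= iter m.*2 P f x <= b%:E)%E].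
  elim: m => [|m [a [b [a0 ab abm H]]]].
    exists 0, 1; split => //; first by rewrite subr0 expr0.
  have [m1 m2] := mi m.*2.
  have [a' [b' [a0' ab' abm' H']]] := oscillation_contraction a0 ab m1 m2 H.
  exists a', b'; split => //; apply: (le_trans abm'); rewrite exprS.
  by rewrite ler_wpM2l// subr_ge0; case/andP: e01.
move=> m; have [a [b [a0 ab abm H]]] := main m./2.
exists a, b; split => //.
have [m1 m2] := mi m./2.*2.
have b0 := le_trans a0 ab.
(* For odd [m] one more application of the unital operator [P] keeps the constant bounds. *)
rewrite -(odd_double_half m); case: (odd m) => //= x vx; apply/andP; split.
  by apply: ge_cst => // z vz; have /andP[] := H z vz.
by apply: le_cst => // z vz; have /andP[] := H z vz.
Qed.

(** Constant lower bounds of an iterate remain lower bounds of all later iterates, and likewise for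
    upper bounds. Hence the supremum of all lower bounds lies between the bounds of every single
    iterate, and its distance to each value is at most their gap. *)
Lemma iter_converges (f : S -> \bar R) : meas elt f -> (forall x, 0 <= f x <= 1)%E ->
  exists l : R, forall m x, valid x ->
    (`| iter m P f x - l%:E | <= (2 * (1 - e / 2) ^+ m)%:E)%E.
Proof.
move=> mf f01.
have f0 x : (0 <= f x)%E by have /andP[] := f01 x.
have mi m : meas elt (iter m P f) /\ forall x, (0 <= iter m P f x)%E.
  elim: m => [|m [IH1 IH2]] //=; split; [exact: (po_meas opP)|exact: (po_ge0 opP)].
pose low := [set r : R | 0 <= r /\
  exists m, forall x, valid x -> (r%:E <= iter m P f x)%E].
have mono m k (c : R) : 0 <= c -> (forall x, valid x -> (c%:E <= iter m P f x)%E) ->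
    forall x, valid x -> (c%:E <= iter (k + m) P f x)%E.
  move=> c0 H; elim: k => [|k IH] //= x vx.
  by apply: ge_cst => //; [exact: (mi _).1|exact: (mi _).2].
have mono' m k (c : R) : 0 <= c -> (forall x, valid x -> (iter m P f x <= c%:E)%E) ->
    forall x, valid x -> (iter (k + m) P f x <= c%:E)%E.
  move=> c0 H; elim: k => [|k IH] //= x vx.
  by apply: le_cst => //; [exact: (mi _).1|exact: (mi _).2].
have upper m (b : R) : 0 <= b -> (forall x, valid x -> (iter m P f x <= b%:E)%E) ->
    ubound low b.
  move=> b0 H r [r0 [m' H']].
  have h1 := mono _ m _ r0 H' _ vx0.
  have h2 := mono' _ m' _ b0 H _ vx0.
  by rewrite addnC in h2; have := le_trans h1 h2; rewrite lee_fin.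
have ub1 : ubound low 1.
  by apply: (upper 0%N) => // x _; have /andP[] := f01 x.
exists (sup low) => m x vx.
have [a [b [a0 ab abm H]]] := oscillation_decay mf f01 m.
have lowa : low a by split => //; exists m => z vz; have /andP[] := H z vz.
have lb : a <= sup low by apply: ub_le_sup => //; exists 1.
have ubd : sup low <= b.
  apply: ge_sup; first by exists a.
  by apply: (upper m); [exact: le_trans ab|move=> z vz; have /andP[] := H z vz].
(* One step has rate [1 - e / 2], since [1 - e <= (1 - e / 2) ^+ 2]. The factor 2 pays for the
   unmatched step when [m] is odd, because [1 - e / 2 >= 1 / 2]. *)
have : b - a <= 2 * (1 - e / 2) ^+ m.
  apply: (le_trans abm); case/andP: e01 => e0 e1.
  have q0 : 0 <= 1 - e by rewrite subr_ge0.
  have r0 : 0 <= 1 - e / 2 by lra.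
  apply: (@le_trans _ _ ((1 - e / 2) ^+ (m./2.*2))).
    rewrite -mul2n exprM; apply: lerXn2r; rewrite ?nnegrE//; first by rewrite sqr_ge0.
    rewrite (_ : _ ^+ 2 = 1 - e + (e / 2) ^+ 2); last by field.
    by rewrite lerDl sqr_ge0.
  rewrite -{2}(odd_double_half m) exprD; case: (odd m) => /=; rewrite ?expr1 ?expr0.
    rewrite mulrA -[leLHS]mul1r ler_wpM2r ?exprn_ge0//; lra.
  by rewrite mul1r -[leLHS]mul1r ler_wpM2r ?exprn_ge0//; lra.
move=> ba; have /andP[] := H x vx.
have := (mi m).2 x; case: (iter m P f x) => [v| |] // _; rewrite !lee_fin => av vb.
by rewrite ler_norml; apply/andP; split; lra.
Qed.

Theorem doeblin : exists2 rho : R, 0 <= rho < 1 &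
  forall f, meas elt f -> (forall x, 0 <= f x <= 1)%E ->
  exists l : R, forall m x, valid x ->
    (`| iter m P f x - l%:E | <= (2 * rho ^+ m)%:E)%E.
Proof.
exists (1 - e / 2); last exact: iter_converges.
by case/andP: e01 => e0 e1; apply/andP; split; lra.
Qed.

End doeblin.

(** By [VC] the operator [V] is a measure detached from the starting state. The first step reaches
    [C] with probability at least [delta] and the second one dominates [V] from there, so
    [delta * V] can serve as the common part of the two-step kernels. *)
Lemma doeblin_local (R : realType) (S : Type) (elt : elements S) (valid : S -> Prop)
    (P V : (S -> \bar R) -> S -> \bar R) (x0 : S) (C : S -> bool) (delta : R) :
  pos_op elt valid P -> pos_op elt valid V -> unital valid P -> valid x0 -> C x0 ->
  meas elt (ind R C) -> 0 < delta ->
  (forall x, valid x -> delta%:E * ind R (fun=> true) x <= P (ind R C) x)%E ->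
  (forall f x, V f x = V f x0) ->
  (forall f x, meas elt f -> (forall x, 0 <= f x)%E -> valid x -> C x ->
    (V f x <= P f x)%E) ->
  (0 < V (fun=> 1%E) x0)%E ->
  exists2 rho : R, 0 <= rho < 1 &
  forall f, meas elt f -> (forall x, 0 <= f x <= 1)%E ->
  exists l : R, forall m x, valid x ->
    (`| iter m P f x - l%:E | <= (2 * rho ^+ m)%:E)%E.
Proof.
move=> opP opV P1 vx0 C0 mC delta0 hit VC minorC V1.
have opK := pos_op_scale (ltW delta0) opV.
apply: (doeblin opP opK vx0 P1); last by rewrite mule_gt0.
move=> f b x mf fb vx.
have f0 z : (0 <= f z)%E by have /andP[] := fb z.
have fleb z : (f z <= b%:E)%E by have /andP[] := fb z.
have b_ge0 : 0 <= b by rewrite -lee_fin (le_trans (f0 x0)).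
have m1 : meas elt (fun _ : S => 1%E : \bar R) by move=> d T u _; exact: measurable_cst.
have Pb : P (fun=> b%:E) x0 = b%:E.
  by have := po_scale opP b_ge0 m1 (fun=> lee01) x0; rewrite P1// mule1.
(* [V f x0] is finite because [x0] itself lies in [C] and there [V f <= P f <= b]; it can then serve
   as the real constant in [lower_comp]. *)
have Vb : (V f x0 <= b%:E)%E.
  apply: (le_trans (minorC _ _ mf f0 vx0 C0)); rewrite -Pb.
  by apply: (po_le opP) => // d T u _; exact: measurable_cst.
have V0 : (0 <= V f x0)%E by exact: (po_ge0 opV).
have Vf : V f x0 \is a fin_num by rewrite ge0_fin_numE// (le_lt_trans Vb)// ltry.
have nu0 : 0 <= fine (V f x0) by rewrite fine_ge0.
have low z : valid z -> ((fine (V f x0))%:E * ind R C z <= P f z)%E.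
  move=> vz; rewrite /ind; case: (boolP (C z)) => [Cz|_].
    by rewrite mule1 fineK// -(VC f z); exact: minorC.
  by rewrite mule0; exact: (po_ge0 opP).
have := lower_comp opP nu0 (po_meas opP mf f0) (po_ge0 opP f0) mC low hit vx.
by rewrite /ind mule1 EFinM fineK// muleC.
Qed.

(** * Measurability of matrices and states *)

Section real_elements.
Context (R : realType) d (T : measurableType d).
Implicit Types f g : T -> R.

Lemma measurable_funV f : measurable_fun setT f -> measurable_fun setT (fun z => (f z)^-1).
Proof.
move=> mf.
rewrite (_ : (fun _ => _) = (fun z => f z * powR (f z ^+ 2) (-1))); last first.
  apply/funext => z; rewrite powR_inv1 ?sqr_ge0//.
  have [->|fz] := eqVneq (f z) 0; first by rewrite mul0r invr0.
  by rewrite expr2 invfM mulrA divff// mul1r.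
apply: measurable_funM => //.
by apply: (@measurableT_comp _ _ _ _ _ _ (@powR R ^~ (-1))) => //; exact: measurable_funX.
Qed.

Lemma measurable_sqrt f : measurable_fun setT f -> measurable_fun setT (fun z => Num.sqrt (f z)).
Proof.
move=> mf; apply: (@measurableT_comp _ _ _ _ _ _ (@Num.sqrt R)) => //.
apply: continuous_measurable_fun => x; exact: sqrt_continuous.
Qed.

Lemma measurable_powRl f (a : R) :
  measurable_fun setT f -> measurable_fun setT (fun z => powR (f z) a).
Proof. by move=> mf; apply: (@measurableT_comp _ _ _ _ _ _ (@powR R ^~ a)). Qed.

Lemma measurable_expRf f :
  measurable_fun setT f -> measurable_fun setT (fun z => expR (f z)).
Proof. by move=> mf; apply: measurableT_comp. Qed.

Lemma measurable_sumR (I : Type) (r : seq I) (F : I -> T -> R) :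
  (forall i, measurable_fun setT (F i)) ->
  measurable_fun setT (fun z => \sum_(i <- r) F i z).
Proof.
move=> mF; elim: r => [|i r IH].
  by under eq_fun do rewrite big_nil; exact: measurable_cst.
by under eq_fun do rewrite big_cons; exact: measurable_funD.
Qed.

Lemma measurable_prodR (I : Type) (r : seq I) (F : I -> T -> R) :
  (forall i, measurable_fun setT (F i)) ->
  measurable_fun setT (fun z => \prod_(i <- r) F i z).
Proof.
move=> mF; elim: r => [|i r IH].
  by under eq_fun do rewrite big_nil; exact: measurable_cst.
by under eq_fun do rewrite big_cons; exact: measurable_funM.
Qed.

Lemma measurable_ind f g : measurable_fun setT f -> measurable_fun setT g ->
  measurable_fun setT (fun z => ((f z <= g z)%R%:R : R)).
Proof.
move=> mf mg.
rewrite (_ : (fun _ => _) = (fun z => if f z <= g z then 1 else 0)); last first.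
  by apply/funext => z; case: (f z <= g z).
by apply: measurable_fun_ifT => //; exact: measurable_fun_ler.
Qed.

End real_elements.

Section mx_elements.
Context (R : realType) d (T : measurableType d).

Lemma mx_elt_cst m n (M : 'M[R]_(m, n)) : mx_elt d T (fun=> M).
Proof. by move=> i j; exact: measurable_cst. Qed.

Lemma mx_elt_add m n (M N : T -> 'M[R]_(m, n)) : mx_elt d T M -> mx_elt d T N ->
  mx_elt d T (fun z => M z + N z).
Proof.
by move=> mM mN i j; under eq_fun do rewrite mxE; exact: measurable_funD.
Qed.

Lemma mx_elt_opp m n (M : T -> 'M[R]_(m, n)) : mx_elt d T M ->
  mx_elt d T (fun z => - M z).
Proof.
by move=> mM i j; under eq_fun do rewrite mxE; exact: measurable_funN.
Qed.

Lemma mx_elt_scale m n (c : T -> R) (M : T -> 'M[R]_(m, n)) :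
  measurable_fun setT c -> mx_elt d T M -> mx_elt d T (fun z => c z *: M z).
Proof.
by move=> mc mM i j; under eq_fun do rewrite mxE; exact: measurable_funM.
Qed.

Lemma mx_elt_mul m n q (M : T -> 'M[R]_(m, n)) (N : T -> 'M[R]_(n, q)) :
  mx_elt d T M -> mx_elt d T N -> mx_elt d T (fun z => M z *m N z).
Proof.
move=> mM mN i j; under eq_fun do rewrite mxE.
by apply: measurable_sumR => k; apply: measurable_funM; [exact: mM|exact: mN].
Qed.

Lemma mx_elt_tr m n (M : T -> 'M[R]_(m, n)) :
  mx_elt d T M -> mx_elt d T (fun z => (M z)^T).
Proof. by move=> mM i j; under eq_fun do rewrite mxE; exact: mM. Qed.

Lemma mx_elt_Lam n (l : T -> 'cV[R]_n) :
  mx_elt d T l -> mx_elt d T (fun z => Lam (l z)).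
Proof.
move=> ml i j; rewrite /Lam; under eq_fun do rewrite !mxE.
by case: (i == j) => /=; [exact: ml|exact: measurable_cst].
Qed.

Lemma measurable_det n (M : T -> 'M[R]_n) :
  mx_elt d T M -> measurable_fun setT (fun z => \det (M z)).
Proof.
move=> mM; apply: measurable_sumR => s; apply: measurable_funM => //.
by apply: measurable_prodR => i.
Qed.

Lemma mx_elt_inv n (M : T -> 'M[R]_n) :
  mx_elt d T M -> mx_elt d T (fun z => invmx (M z)).
Proof.
move=> mM i j.
(* Cramer's formula on the measurable set where the determinant is nonzero; elsewhere [invmx]
   returns its argument. *)
rewrite (_ : (fun _ => _) = (fun z => if \det (M z) != 0 then
    (\det (M z))^-1 * ((-1) ^+ (j + i) * \det (row' j (col' i (M z)))) else M z i j)); last first.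
  apply/funext => z; rewrite /invmx unitmxE unitfE; case: ifP => // _.
  by rewrite !mxE.
have mdet := measurable_det mM.
apply: measurable_fun_ifT => //.
  by apply: measurable_neg; apply: measurable_fun_eqr => //; exact: measurable_cst.
apply: measurable_funM; first exact: measurable_funV.
apply: measurable_funM => //; apply: measurable_det => i' j'.
by under eq_fun do rewrite !mxE; exact: mM.
Qed.

End mx_elements.

Definition state_elt (R : realType) (p : nat) : elements (state R p) :=
  fun d T x => [/\ mx_elt d T (fun z => s_theta (x z)),
    mx_elt d T (fun z => s_beta (x z)), measurable_fun setT (fun z => s_sig2 (x z)),
    measurable_fun setT (fun z => s_tau2 (x z)) &
    mx_elt d T (fun z => s_lam (x z))].

Lemma state_elt_cst (R : realType) p d (T : measurableType d) (x : state R p) :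
  state_elt (fun _ : T => x).
Proof. by split; try exact: mx_elt_cst; exact: measurable_cst. Qed.

Lemma state_elt_comp (R : realType) p d d' (T : measurableType d)
    (T' : measurableType d') (x : T' -> state R p) (phi : T -> T') :
  measurable_fun [set: T] phi -> state_elt x -> state_elt (x \o phi).
Proof.
move=> mphi [h1 h2 h3 h4 h5]; split.
- by move=> i j; exact: (measurableT_comp (h1 i j)).
- by move=> i j; exact: (measurableT_comp (h2 i j)).
- exact: (measurableT_comp h3).
- exact: (measurableT_comp h4).
- by move=> i j; exact: (measurableT_comp (h5 i j)).
Qed.

(** Links the sigma-algebra in [geom_ergodic] with the tests by families of states: the sets with
    measurable preimage form a sigma-algebra that contains the generators. *)
Lemma meas_state_indic (R : realType) p (A : set (state R p)) :
  state_measurable A -> meas (@state_elt R p) (fun z => (\1_A z : R)%:E).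
Proof.
move=> mA d T x mx; apply/measurable_EFinP.
suff mxA : measurable (x @^-1` A).
  rewrite (_ : (fun _ => _) = \1_(x @^-1` A)); first exact: measurable_indic.
  by apply/funext => z; rewrite !indicE.
move: A mA; apply: smallest_sub.
  split => [|A|F].
  - by rewrite /= preimage_set0.
  - by rewrite /= setTD preimage_setC => ?; exact: measurableC.
  - by rewrite /= preimage_bigcup => ?; exact: bigcupT_measurable.
move=> A [B [mB]]; case: mx => h1 h2 h3 h4 h5.
have meq (f : T -> R) : measurable_fun setT f -> measurable (f @^-1` B).
  by move=> mf; rewrite -[X in measurable X]setTI; exact: mf.
by move=> [->|[->|[i [->|[->|->]]]]]; [exact: (meq _ h3)|exact: (meq _ h4)|
  exact: (meq _ (h1 i 0))|exact: (meq _ (h2 i 0))|exact: (meq _ (h5 i 0))].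
Qed.

(** * One-dimensional integrals *)

Section real_integrals.
Import numFieldNormedType.Exports.
Context (R : realType).
Local Notation mu := (@lebesgue_measure R).
Implicit Types (D : set R) (f w e h : R -> R).

(** If the integral of [e * w] vanished, then [e * w] would be zero almost everywhere on [D], and so
    would [w] because [e] is positive there. No positive lower bound on [e] enters. *)
Lemma integral_weight_gt0 D w e : measurable D ->
  measurable_fun setT w -> measurable_fun setT e ->
  (forall x, 0 <= w x) -> (forall x, D x -> 0 < e x) ->
  (0 < \int[mu]_(x in D) (w x)%:E)%E -> (0 < \int[mu]_(x in D) (e x * w x)%:E)%E.
Proof.
move=> mD mw me w0 e0 iw.
have ew0 x : D x -> 0 <= e x * w x by move=> Dx; rewrite mulr_ge0// ltW// e0.
rewrite lt_def integral_ge0 ?andbT; last by move=> x Dx; rewrite lee_fin ew0.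
apply/eqP => H.
have mew : measurable_fun D (fun x => (e x * w x)%:E).
  by apply: measurable_funTS; apply/measurable_EFinP; exact: measurable_funM.
have mwE : measurable_fun D (fun x => (w x)%:E).
  by apply: measurable_funTS; apply/measurable_EFinP.
have : (\int[mu]_(x in D) `|(e x * w x)%:E| = 0)%E.
  rewrite -H; apply: eq_integral => x /set_mem Dx.
  by rewrite gee0_abs// lee_fin ew0.
move/(ae_eq_integral_abs mu mD mew) => ae.
have : (\int[mu]_(x in D) `|(w x)%:E| = 0)%E.
  apply/(ae_eq_integral_abs mu mD mwE).
  apply: filterS ae => x /[swap] Dx /(_ Dx) /= [] /eqP.
  by rewrite mulf_eq0 gt_eqF ?e0//= => /eqP ->.
move=> W; move: iw; rewrite (_ : (\int[mu]_(x in D) (w x)%:E = 0)%E) ?ltxx//.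
by rewrite -W; apply: eq_integral => x _; rewrite gee0_abs// lee_fin.
Qed.

Lemma ndens_ge0 D h x : (forall x, 0 <= h x) -> 0 <= ndens D h x.
Proof.
move=> h0; rewrite /ndens divr_ge0// fine_ge0//.
by apply: integral_ge0 => u _; rewrite lee_fin.
Qed.

Lemma integral_ndens D h : measurable D -> measurable_fun setT h ->
  (forall x, 0 <= h x) ->
  (0 < \int[mu]_(x in D) (h x)%:E < +oo)%E ->
  (\int[mu]_(x in D) (ndens D h x)%:E = 1)%E.
Proof.
move=> mD mh h0 /andP[I0 Iy]; rewrite /ndens.
have If : (\int[mu]_(x in D) (h x)%:E)%E \is a fin_num by rewrite ge0_fin_numE// ltW.
set c := fine _.
have c0 : 0 < c by rewrite /c fine_gt0// I0 Iy.
under eq_integral do rewrite mulrC EFinM.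
rewrite ge0_integralZl_EFin//.
- by rewrite -(fineK If) -EFinM mulVf// gt_eqF.
- by move=> x _; rewrite lee_fin.
- by apply: measurable_funTS; apply/measurable_EFinP.
- by rewrite invr_ge0 ltW.
Qed.

Lemma integral_affine (f : R -> \bar R) (c m : R) : 0 < c ->
  measurable_fun setT f -> (forall x, 0 <= f x)%E ->
  (\int[mu]_x f (c * x + m)%R = (c^-1)%:E * \int[mu]_x f x)%E.
Proof.
move=> c0 mf f0.
pose phi : R -> measurableTypeR R := fun x => c * x + m.
have mphi : measurable_fun setT phi.
  by apply: measurable_funD; [exact: measurable_funM|exact: measurable_cst].
pose k : {nonneg R} := NngNum (ltW c0).
pose nu := measure_function_pushforward__canonical__measure_function_Measure
  mu mphi.
have E A : measurable A -> mu A = mscale k nu A.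
  apply: lebesgue_measure_unique => _ [[a b]] _ <- /=.
  change (mu `]a, b]%classic = c%:E * mu (phi @^-1` `]a, b]%classic))%E.
  rewrite (_ : phi @^-1` _ = `](a - m) / c, (b - m) / c]%classic); last first.
    apply/seteqP; split => x; rewrite /phi /= !in_itv /=;
      by rewrite ltr_pdivrMr// ler_pdivlMr// ltrBlDr lerBrDr (mulrC x).
  rewrite !lebesgue_measure_itv /= !lte_fin ltr_pM2r ?invr_gt0// ltrD2r.
  case: ifP => _; rewrite ?mule0// -EFinM; congr EFin; field.
  by rewrite gt_eqF.
transitivity (\int[nu]_x f x)%E; first by rewrite ge0_integral_pushforward.
transitivity ((c^-1)%:E * \int[mscale k nu]_x f x)%E.
  by rewrite ge0_integral_mscale//= muleA -EFinM mulVf ?gt_eqF// mul1e.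
congr (_ * _)%E; apply: eq_measure_integral => A mA _; exact/esym/E.
Qed.

Lemma integral_gauss_fin (k m : R) : 0 < k ->
  exists c : R, 0 < c /\ (\int[mu]_x (expR (- (k * (x - m) ^+ 2)))%:E = c%:E)%E.
Proof.
move=> k0.
have sk : 0 < Num.sqrt k by rewrite sqrtr_gt0.
exists ((Num.sqrt k)^-1 * Num.sqrt pi).
split; first by rewrite mulr_gt0 ?invr_gt0// sqrtr_gt0 pi_gt0.
rewrite EFinM -integralT_gauss.
rewrite -(@integral_affine (fun x => (gauss_fun x)%:E) _ (- (Num.sqrt k * m)))//.
- apply: eq_integral => x _; rewrite /gauss_fun; congr (expR _)%:E.
  by rewrite -mulrBr exprMn sqr_sqrtr// ltW.
- by apply/measurable_EFinP; exact: measurable_gauss_fun.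
- by move=> x; rewrite lee_fin gauss_fun_ge0.
Qed.

(** This is [z <= expR z] at [z = b * x / a], raised to the power [a]. *)
Lemma powR_expR_le (a b x : R) : 0 < a -> 0 < b -> 0 <= x ->
  powR x a * expR (- (b * x)) <= powR (a / b) a.
Proof.
move=> a0 b0 x0; rewrite expRN ler_pdivrMr ?expR_gt0//.
rewrite -[leLHS](_ : powR (a / b * (b * x / a)) a = _); last first.
  by congr powR; field; rewrite !gt_eqF.
have y0 : 0 <= b * x / a by rewrite divr_ge0 ?mulr_ge0// ltW.
rewrite powRM//; last by rewrite ltW// divr_gt0.
rewrite ler_wpM2l ?powR_ge0//.
have : powR (b * x / a) a <= powR (expR (b * x / a)) a.
  apply: ge0_ler_powR; rewrite ?nnegrE ?expR_ge0//; first exact: ltW.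
  by apply: le_trans (expR_ge1Dx _); rewrite lerDr.
move/le_trans; apply.
by rewrite /powR gt_eqF ?expR_gt0// expRK mulrC divfK// gt_eqF.
Qed.

Lemma cvg_powRN_pinfty (a : R) : 0 < a -> powR x (- a) @[x --> +oo] --> (0 : R).
Proof.
move=> a0; apply/cvgrPdist_le => e e0; near=> x.
have x0 : 0 < x by near: x; exact: nbhs_pinfty_gt.
rewrite sub0r normrN ger0_norm ?powR_ge0// powRN invf_ple ?posrE ?powR_gt0//.
have -> : e^-1 = powR (powR e^-1 a^-1) a.
  by rewrite -powRrM mulVf ?gt_eqF// powRr1// invr_ge0 ltW.
apply: (ge0_ler_powR (ltW a0)); rewrite ?nnegrE; [exact: powR_ge0|exact: ltW|].
by near: x; exact: nbhs_pinfty_ge.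
Unshelve. all: by end_near. Qed.

Lemma integral_powR_tail (a : R) : 0 < a ->
  (\int[mu]_(x in `[1%R, +oo[) (powR x (- a - 1))%:E = (a^-1)%:E)%E.
Proof.
move=> a0.
have cpow (c x : R) : 0 < x -> {for x, continuous (fun x : R => powR x c)}.
  move=> x0; apply/differentiable_continuous/derivable1_diffP.
  by apply: derivable_powR; rewrite in_itv/= andbT.
have dF (x : R) : 0 < x -> is_derive x 1 (fun x : R => - a^-1 * powR x (- a))
    (- a^-1 * (- a * powR x (- a - 1))).
  by move=> x0; apply: (@is_deriveZ _ _ _ (fun x : R => powR x (- a)) (- a^-1));
    exact: is_derive1_powR.
rewrite (@ge0_continuous_FTC2y _ _ (fun x => - a^-1 * powR x (- a)) 1 0).
- by rewrite powR1 mulr1 sub0e -EFinN opprK.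
- by move=> x _; exact: powR_ge0.
- apply: continuous_in_subspaceT => x /set_mem /=; rewrite in_itv/= andbT => x1.
  by apply: cpow; rewrite (lt_le_trans _ x1).
- by rewrite -[0](mulr0 (- a^-1)); apply: cvgMl_tmp; exact: cvg_powRN_pinfty.
- move=> x x1; have /dF [] // : 0 < x by rewrite (lt_trans _ x1).
- apply: cvg_at_right_filter; apply: cvgMl_tmp; exact: cpow.
- move=> x; rewrite in_itv/= andbT => x1; rewrite derive1E.
  have /dF D : 0 < x by rewrite (lt_trans _ x1).
  by rewrite (@derive_val _ _ _ _ _ _ _ D) mulrA mulrNN mulVf ?mul1r// gt_eqF.
Qed.

End real_integrals.

(** * Normalized densities, iterated integrals and the inverse gamma weight *)

Section normalized_density.
Context (R : realType) (U : Type) (elt : elements U) (D : set U).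
Context (I : (U -> \bar R) -> \bar R) (int : integrator elt D I).
Context (h : U -> R).
Hypothesis mh : meas elt (fun u => (h u)%:E).
Hypothesis h0 : forall u, 0 <= h u.
Let Ih := I (fun u => (h u)%:E).

Lemma density_ge0 u : 0 <= h u / fine Ih.
Proof.
by rewrite divr_ge0// fine_ge0//; apply: (int_ge0 int) => ?; rewrite lee_fin.
Qed.

Lemma int_density g : (0 < Ih < +oo)%E -> meas elt g -> (forall u, 0 <= g u)%E ->
  I (fun u => (h u / fine Ih)%:E * g u)%E =
  ((fine Ih)^-1%:E * I (fun u => (h u)%:E * g u))%E.
Proof.
move=> hI mg g0; rewrite -(int_scale int).
- by congr I; apply/funext => u; rewrite mulrC EFinM muleA.
- by rewrite invr_ge0 ltW// fine_gt0.
- by move=> d T u mu; apply: emeasurable_funM; [exact: mh|exact: mg].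
- by move=> u; rewrite mule_ge0// lee_fin.
Qed.

Let Ih_fin : (0 < Ih < +oo)%E -> Ih = (fine Ih)%:E.
Proof. by move=> /andP[h1 h2]; rewrite fineK// ge0_fin_numE// ltW. Qed.

Lemma int_density1 : (0 < Ih < +oo)%E ->
  I (fun u => (h u / fine Ih)%:E * 1)%E = 1%E.
Proof.
move=> hI; rewrite int_density//.
have -> : (fun u => (h u)%:E * 1)%E = (fun u => (h u)%:E).
  by apply/funext => u; rewrite mule1.
by rewrite -/Ih [X in (_ * X)%E]Ih_fin// -EFinM mulVf// gt_eqF// fine_gt0.
Qed.

(** The common form of the hitting estimates: an unnormalized mass bounded below against a
    normalizer bounded above, neither of them computed. *)
Lemma int_density_ge g (c1 c2 : R) : 0 < c1 -> (0 < Ih)%E -> (Ih <= c2%:E)%E ->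
  meas elt g -> (forall u, 0 <= g u)%E -> (c1%:E <= I (fun u => (h u)%:E * g u))%E ->
  ((c1 / c2)%:E <= I (fun u => (h u / fine Ih)%:E * g u))%E.
Proof.
move=> c1p I0 Ic mg g0 cI.
have hI : (0 < Ih < +oo)%E by rewrite I0 (le_lt_trans Ic)// ltry.
have f0 : 0 < fine Ih by rewrite fine_gt0.
have fc : fine Ih <= c2 by rewrite -lee_fin -Ih_fin.
rewrite int_density//.
apply: (@le_trans _ _ ((fine Ih)^-1%:E * c1%:E)%E).
  rewrite -EFinM lee_fin mulrC ler_wpM2r ?(ltW c1p)//.
  by rewrite lef_pV2// posrE// (lt_le_trans f0).
by rewrite lee_wpmul2l// lee_fin invr_ge0 ltW.
Qed.

End normalized_density.

Lemma meas_real (R : realType) (f : R -> \bar R) :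
  measurable_fun setT f -> meas (@real_elt R) f.
Proof. by move=> mf d T u mu; exact: (measurableT_comp mf). Qed.

Section iterated.
Context (R : realType).
Local Notation mu := (@lebesgue_measure R).

Lemma eq_iint k (f g : seq R -> \bar R) : (forall s, size s = k -> f s = g s) ->
  iint k f = iint k g.
Proof.
elim: k f g => [|k IH] f g fg /=; first exact: fg.
by apply: eq_integral => x _; apply: IH => s sk; apply: fg; rewrite /= sk.
Qed.

Lemma vint_prod p (F : 'I_p -> R -> R) (c : 'I_p -> R) :
  (forall k, measurable_fun setT (F k)) -> (forall k x, 0 <= F k x) ->
  (forall k, \int[mu]_x (F k x)%:E = (c k)%:E)%E ->
  vint (fun v : 'cV[R]_p => (\prod_(k < p) F k (v k 0))%:E) = (\prod_(k < p) c k)%:E.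
Proof.
move=> mF F0 Fc; rewrite /vint.
rewrite (@eq_iint _ _ (fun s => (\prod_(k < p) F k (nth 0 s k))%:E)); last first.
  by move=> s _; congr EFin; apply: eq_bigr => k _; rewrite mxE.
elim: p F c mF F0 Fc => [|p IH] F c mF F0 Fc /=; first by rewrite !big_ord0.
rewrite big_ord_recl EFinM -Fc.
transitivity (\int[mu]_x ((\prod_(k < p) c (lift ord0 k))%:E * (F ord0 x)%:E))%E.
  apply: eq_integral => x _; rewrite muleC -(IH (fun k => F (lift ord0 k)))//.
  rewrite -(int_scale (iint_integrator R p))//.
  - by apply: eq_iint => s _; rewrite big_ord_recl EFinM.
  - move=> d T s ms; apply/measurable_EFinP; apply: measurable_prodR => k.
    by apply: measurableT_comp => //; exact: mF.
  - by move=> s; rewrite lee_fin prodr_ge0.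
rewrite ge0_integralZl_EFin//; first by rewrite muleC.
- by move=> x _; rewrite lee_fin.
- by apply/measurable_EFinP; exact: mF.
- apply: prodr_ge0 => k _; rewrite -lee_fin -Fc.
  by apply: integral_ge0 => x _; rewrite lee_fin.
Qed.

(** The shift is indexed by [nat], so that the recursion of [iint] can drop its first term at any
    length. *)
Fixpoint affine_seq (c : R) (m : nat -> R) (s : seq R) : seq R :=
  if s is x :: s' then (c * x + m 0%N) :: affine_seq c (fun i => m i.+1) s' else [::].

Lemma nth_affine_seq (c : R) m s i : (i < size s)%N ->
  nth 0 (affine_seq c m s) i = c * nth 0 s i + m i.
Proof. by elim: s i m => [|x s IH] [|i] m //= si; exact: IH. Qed.

Lemma iint_affine k (c : R) m (f : seq R -> \bar R) : 0 < c ->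
  meas (@seq_elt R) f -> (forall s, 0 <= f s)%E ->
  iint k (fun s => f (affine_seq c m s)) = ((c^-1 ^+ k)%:E * iint k f)%E.
Proof.
move=> c0; elim: k m f => [|k IH] m f mf f0 /=; first by rewrite expr0 mul1e.
transitivity (\int[mu]_x ((c^-1 ^+ k)%:E *
    iint k (fun s => f ((c * x + m 0%N)%R :: s))))%E.
  apply: eq_integral => x _; rewrite -(IH (fun i => m i.+1))//.
  exact: meas_cons.
have mi : measurable_fun setT (fun x : R => iint k (fun s => f (x :: s))).
  by apply: measurable_iint => //; exact: pmeas_cons.
have i0 (x : R) : (0 <= iint k (fun s => f (x :: s)))%E by exact: iint_ge0.
rewrite ge0_integralZl_EFin//.
- rewrite (@integral_affine _ (fun x => iint k (fun s => f (x :: s))))//.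
  by rewrite muleA -EFinM exprSr.
- apply: (@measurableT_comp _ _ _ _ _ _ (fun x : R => iint k (fun s => f (x :: s)))) => //.
  by apply: measurable_funD; [exact: measurable_funM|exact: measurable_cst].
- by rewrite exprn_ge0// invr_ge0 ltW.
Qed.

Lemma vint_affine p (c : R) (m : 'cV[R]_p) (f : 'cV[R]_p -> \bar R) : 0 < c ->
  meas (@mx_elt R p 1) f -> (forall s, 0 <= f s)%E ->
  vint (fun v => f (c *: v + m)) = ((c^-1 ^+ p)%:E * vint f)%E.
Proof.
move=> c0 mf f0; rewrite /vint.
pose m' i := if insub i is Some k then m k 0 else 0.
rewrite -(@iint_affine _ _ m')//; last first.
  by move=> d T s ms; apply: mf; exact: mx_elt_col.
apply: eq_iint => s sp; congr f; apply/colP => i; rewrite !mxE.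
by rewrite nth_affine_seq ?sp// /m' valK.
Qed.

End iterated.

Section inverse_gamma.
Context (R : realType).
Local Notation mu := (@lebesgue_measure R).
Local Notation D0 := [set u : R | (0 < u)%R].

(** Unnormalized inverse gamma density; [h_sig2] is the instance [b := Rfun X y b' t l] by
    conversion. *)
Definition ig_fun (a b s : R) : R := powR s (- a - 1) * expR (- b / s).

Lemma measurable_pos : measurable D0.
Proof. by rewrite (_ : D0 = `]0, +oo[%classic)//; apply/seteqP; split => x /=; rewrite in_itv/= andbT. Qed.

Lemma ig_fun_ge0 a b s : 0 <= ig_fun a b s.
Proof. by rewrite mulr_ge0 ?powR_ge0// expR_ge0. Qed.

Lemma measurable_ig a b : measurable_fun setT (ig_fun a b).
Proof.
apply: measurable_funM; first exact: measurable_powR.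
by apply: measurable_expRf; apply: measurable_funM => //; exact: measurable_funV.
Qed.

Lemma le_ig_fun a b b' s : 0 < s -> b <= b' -> ig_fun a b' s <= ig_fun a b s.
Proof.
move=> s0 bb; rewrite ler_wpM2l ?powR_ge0// ler_expR ler_wpM2r ?invr_ge0 ?(ltW s0)//.
by rewrite lerN2.
Qed.

Lemma integral_ig_fin a b : 0 < a -> 0 < b -> (\int[mu]_(s in D0) (ig_fun a b s)%:E < +oo)%E.
Proof.
move=> a0 b0.
(* [C] bounds the integrand on [0, 1]; beyond 1 it is below [s `^ (- a - 1)]. *)
pose C := powR ((a + 1) / b) (a + 1).
have C0 : 0 <= C by exact: powR_ge0.
have a10 : 0 < a + 1 by rewrite addr_gt0.
have igC s : 0 < s -> ig_fun a b s <= C.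
  move=> s0; apply: le_trans (powR_expR_le a10 b0 (_ : 0 <= s^-1)); last first.
    by rewrite invr_ge0 ltW.
  rewrite /ig_fun mulNr ler_wpM2r ?expR_ge0//.
  rewrite -powR_inv1 ?(ltW s0)// -powRrM le_eqVlt; apply/orP; left; apply/eqP.
  by congr powR; ring.
have igT s : 1 <= s -> ig_fun a b s <= powR s (- a - 1).
  move=> s1; rewrite /ig_fun -[leRHS]mulr1 ler_wpM2l ?powR_ge0//.
  rewrite -expR0 ler_expR mulNr oppr_le0 divr_ge0 ?(ltW b0)//.
  by rewrite (le_trans _ s1).
pose g s := (C%:E * (\1_(`[0%R, 1%R] : set R) s)%:E +
  (powR s (- a - 1) * \1_(`[1%R, +oo[ : set R) s)%:E)%E.
have mg1 : measurable_fun setT (fun s => (C%:E * (\1_(`[0%R, 1%R] : set R) s)%:E)%E).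
  by apply: emeasurable_funM => //; apply/measurable_EFinP; exact: measurable_indic.
have mg2 : measurable_fun setT (fun s : R => (powR s (- a - 1) * \1_(`[1%R, +oo[ : set R) s)%:E).
  apply/measurable_EFinP; apply: measurable_funM; first exact: measurable_powR.
  exact: measurable_indic.
have g10 s : (0 <= C%:E * (\1_(`[0%R, 1%R] : set R) s)%:E)%E by rewrite mule_ge0.
have g20 s : (0 <= (powR s (- a - 1) * \1_(`[1%R, +oo[ : set R) s)%:E)%E.
  by rewrite lee_fin mulr_ge0// powR_ge0.
apply: (@le_lt_trans _ _ (\int[mu]_s g s)%E).
  rewrite integral_mkcond; apply: ge0_le_integral => //.
  - by move=> s _; apply: erestrict_ge0 => ? _; rewrite lee_fin ig_fun_ge0.
  - have mig : measurable_fun D0 (fun s => (ig_fun a b s)%:E).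
      by apply/measurable_EFinP; apply: measurable_funTS; exact: measurable_ig.
    exact: (measurable_restrictT _ measurable_pos).1 mig.
  - exact: emeasurable_funD.
  - move=> s _; rewrite patchE; case: ifPn => [/set_mem /= s0|_]; last by rewrite adde_ge0.
    rewrite /g; have [s1|s1] := leP s 1.
      rewrite -[leLHS]adde0 leeD// indicE mem_set ?mule1 ?lee_fin ?igC//=.
      by rewrite in_itv/= s1 ltW.
    rewrite -[leLHS]add0e leeD// indicE mem_set ?mulr1 ?lee_fin ?igT ?ltW//=.
    by rewrite in_itv/= andbT ltW.
rewrite ge0_integralD// ge0_integralZl_EFin//; last first.
  by apply/measurable_EFinP; exact: measurable_indic.
rewrite integral_indic//= setIT lebesgue_measure_itv/= lte_fin ltr01.
rewrite (_ : (\int[mu]_s _ = (a^-1)%:E)%E).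
  by rewrite sube0 mule1 -EFinD ltry.
rewrite -(integral_powR_tail a0) [RHS]integral_mkcond.
apply: eq_integral => s _; rewrite patchE indicE.
by case: ifP => _; rewrite ?mulr1 ?mulr0.
Qed.

Lemma integral_ig_gt0 a b : (0 < \int[mu]_(s in D0) (ig_fun a b s * (1 <= s)%R%:R)%:E)%E.
Proof.
(* The indicator of [1 <= s] is the weight, of infinite Lebesgue mass, and the density is the
   positive factor. *)
apply: integral_weight_gt0.
- exact: measurable_pos.
- by apply: measurable_ind; exact: measurable_cst || exact: measurable_id.
- exact: measurable_ig.
- by move=> s; case: (1 <= s).
- by move=> s s0; rewrite mulr_gt0 ?powR_gt0// expR_gt0.
- have E : (\int[mu]_(s in D0) ((1 <= s)%R%:R)%:E = \int[mu]_(s in D0) (\1_(`[1%R, +oo[ : set R) s)%:E)%E.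
    apply: eq_integral => s _; rewrite indicE; congr ((nat_of_bool _)%:R)%:E.
    by apply/idP/idP => [s1|/set_mem /=]; [apply/mem_set => /=|];
      rewrite in_itv/= andbT.
  rewrite E integral_indic//; last exact: measurable_pos.
  rewrite setIidl; last first.
    by move=> s /=; rewrite in_itv/= andbT; apply: lt_le_trans.
  have H : mu `[1%R, +oo[%classic = +oo%E by rewrite lebesgue_measure_itv/= ltry.
  by apply: (@lt_le_trans _ _ +oo%E); [exact: ltry|rewrite -H].
Qed.

End inverse_gamma.

(** * Quadratic forms *)

Section quadratic_forms.
Context (R : realType).
Implicit Types (m n p : nat).

Definition dot n (u v : 'cV[R]_n) : R := (u^T *m v) 0 0.
Definition sqn n (v : 'cV[R]_n) : R := dot v v.
Definition qf n (M : 'M[R]_n) (v : 'cV[R]_n) : R := (v^T *m M *m v) 0 0.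

Lemma dotE n (u v : 'cV[R]_n) : dot u v = \sum_i u i 0 * v i 0.
Proof. by rewrite /dot mxE; apply: eq_bigr => i _; rewrite mxE. Qed.

Lemma dotC n (u v : 'cV[R]_n) : dot u v = dot v u.
Proof. by rewrite !dotE; apply: eq_bigr => i _; rewrite mulrC. Qed.

Lemma dotDl n (u v w : 'cV[R]_n) : dot (u + v) w = dot u w + dot v w.
Proof. by rewrite /dot linearD mulmxDl mxE. Qed.

Lemma dotDr n (u v w : 'cV[R]_n) : dot u (v + w) = dot u v + dot u w.
Proof. by rewrite /dot mulmxDr mxE. Qed.

Lemma dotZl n k (u v : 'cV[R]_n) : dot (k *: u) v = k * dot u v.
Proof. by rewrite /dot linearZ -scalemxAl mxE. Qed.

Lemma dotZr n k (u v : 'cV[R]_n) : dot u (k *: v) = k * dot u v.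
Proof. by rewrite /dot -scalemxAr mxE. Qed.

Lemma dotMl m n (M : 'M[R]_(m, n)) u v : dot (M *m u) v = dot u (M^T *m v).
Proof. by rewrite /dot trmx_mul mulmxA. Qed.

Lemma sqnE n (v : 'cV[R]_n) : sqn v = \sum_i v i 0 ^+ 2.
Proof. by rewrite /sqn dotE. Qed.

Lemma sqn_ge0 n (v : 'cV[R]_n) : 0 <= sqn v.
Proof. by rewrite sqnE sumr_ge0// => i _; rewrite sqr_ge0. Qed.

Lemma sqnZ n k (v : 'cV[R]_n) : sqn (k *: v) = k ^+ 2 * sqn v.
Proof. by rewrite /sqn dotZl dotZr mulrA. Qed.

Lemma sqnD n (u v : 'cV[R]_n) : sqn (u + v) = sqn u + 2 * dot u v + sqn v.
Proof. by rewrite /sqn !dotDl !dotDr (dotC v u); ring. Qed.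

Lemma sqnN n (v : 'cV[R]_n) : sqn (- v) = sqn v.
Proof. by rewrite -scaleN1r sqnZ sqrrN expr1n mul1r. Qed.

Lemma sqr_le_sqn n (v : 'cV[R]_n) i : v i 0 ^+ 2 <= sqn v.
Proof.
by rewrite sqnE (bigD1 i)//= lerDl sumr_ge0// => j _; rewrite sqr_ge0.
Qed.

Lemma sqn_gt0 n (v : 'cV[R]_n) : v != 0 -> 0 < sqn v.
Proof.
move=> v0; rewrite lt_def sqn_ge0 andbT; apply: contra v0 => /eqP s0.
apply/eqP/colP => i; rewrite mxE; apply/eqP.
by rewrite -sqrf_eq0 eq_le sqr_ge0 andbT -s0 sqr_le_sqn.
Qed.

Lemma dot_le n (u v : 'cV[R]_n) : 2 * dot u v <= sqn u + sqn v.
Proof.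
have := sqn_ge0 (u - v); rewrite sqnD sqnN /dot mulmxN mxE -/(dot u v); lra.
Qed.

Lemma sqnD_le n (u v : 'cV[R]_n) : sqn (u + v) <= 2 * sqn u + 2 * sqn v.
Proof. by rewrite sqnD; have := dot_le u v; lra. Qed.

Lemma cauchy_schwarz n (u v : 'cV[R]_n) : dot u v ^+ 2 <= sqn u * sqn v.
Proof.
have [->|v0] := eqVneq v 0.
  by rewrite /sqn /dot !mulmx0 mxE expr0n mulr0.
have := sqn_ge0 (sqn v *: u - dot u v *: v).
rewrite sqnD sqnN !sqnZ dotZl -scaleNr dotZr.
rewrite (_ : _ + _ = sqn v * (sqn u * sqn v - dot u v ^+ 2)); last by ring.
by rewrite pmulr_rge0 ?sqn_gt0// subr_ge0.
Qed.

(** [C] is the squared Frobenius norm; Cauchy-Schwarz is applied to each row. *)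
Lemma sqn_mul_bound m n (M : 'M[R]_(m, n)) :
  exists2 C, 0 <= C & forall v, sqn (M *m v) <= C * sqn v.
Proof.
exists (\sum_i sqn (row i M)^T) => [|v]; first by rewrite sumr_ge0// => i _; exact: sqn_ge0.
rewrite sqnE mulr_suml; apply: ler_sum => i _.
apply: le_trans (cauchy_schwarz _ _); rewrite le_eqVlt; apply/orP; left; apply/eqP.
by congr (_ ^+ 2); rewrite /dot trmxK -row_mul [RHS]mxE.
Qed.

Lemma qfE n (M : 'M[R]_n) v : qf M v = dot v (M *m v).
Proof. by rewrite /qf /dot mulmxA. Qed.

Lemma qfZ n (M : 'M[R]_n) k v : qf M (k *: v) = k ^+ 2 * qf M v.
Proof. by rewrite !qfE -scalemxAr dotZl dotZr mulrA. Qed.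

Lemma qf_bound n (M : 'M[R]_n) : exists2 C, 0 < C & forall v, qf M v <= C * sqn v.
Proof.
have [C C0 H] := sqn_mul_bound M.
exists (1 + C) => [|v]; first by rewrite ltr_wpDr.
have := dot_le v (M *m v); rewrite -qfE; have := H v; have := sqn_ge0 v.
have := sqn_ge0 (M *m v); rewrite mulrDl mul1r; lra.
Qed.

Lemma qf_unitmx n (M : 'M[R]_n) : (forall v, v != 0 -> 0 < qf M v) -> M \in unitmx.
Proof.
move=> pos; rewrite unitmxE unitfE; apply/det0P => -[v v0 vM].
have /pos : v^T != 0.
  by apply: contra v0 => /eqP/(congr1 trmx); rewrite trmxK trmx0 => ->.
by rewrite /qf trmxK vM mul0mx mxE ltxx.
Qed.

Section schur.
Context (p : nat) (a : R) (u : 'cV[R]_p) (B : 'M[R]_p).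
Let M : 'M[R]_(1 + p) := block_mx a%:M u^T u B.
Let S : 'M[R]_p := B - a^-1 *: (u *m u^T).

(** The unipotent matrix [L] eliminates the lower left block. *)
Lemma det_schur : a != 0 -> \det M = a * \det S.
Proof.
move=> a0.
pose L : 'M[R]_(1 + p) := block_mx 1%:M 0 (- (a^-1 *: u)) 1%:M.
have dL : \det L = 1 by rewrite det_lblock !det1 mulr1.
rewrite -[LHS]mul1r -dL -det_mulmx mulmx_block.
rewrite !mul1mx !mul0mx !addr0 mulNmx -scalemxAl mul_mx_scalar scalerA mulVf//.
by rewrite scale1r addNr mulNmx -scalemxAl addrC det_ublock det_scalar1.
Qed.

(** Completing the square in the first coordinate; the square vanishes at [x = - (dot u v / a)]. *)
Lemma qf_schur x v : a != 0 ->
  qf M (col_mx x%:M v) = a * (x + dot u v / a) ^+ 2 + qf S v.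
Proof.
move=> a0.
have -> : qf M (col_mx x%:M v) = a * x ^+ 2 + 2 * (x * dot u v) + qf B v.
  have D11 (P Q : 'M[R]_1) : (P + Q) 0 0 = P 0 0 + Q 0 0 by rewrite mxE.
  rewrite /qf tr_col_mx mul_row_block mul_row_col !mulmxDl tr_scalar_mx !D11.
  have -> : (x%:M *m a%:M *m x%:M : 'M[R]_1) 0 0 = a * x ^+ 2.
    by rewrite -!scalar_mxM mxE eqxx mulr1n; ring.
  have -> : (v^T *m u *m x%:M) 0 0 = x * dot u v.
    by rewrite mul_mx_scalar mxE -/(dot v u) dotC.
  have -> : (x%:M *m u^T *m v) 0 0 = x * dot u v.
    by rewrite mul_scalar_mx -scalemxAl mxE.
  by ring.
have -> : qf S v = qf B v - dot u v ^+ 2 / a.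
  have E : v^T *m S *m v = v^T *m B *m v - a^-1 *: ((v^T *m u) *m (u^T *m v)).
    by rewrite /S mulmxBr mulmxBl -scalemxAr -scalemxAl !mulmxA.
  have B11 (P Q : 'M[R]_1) k : (P - k *: Q) 0 0 = P 0 0 - k * Q 0 0 by rewrite !mxE.
  have M11 (P Q : 'M[R]_1) : (P *m Q) 0 0 = P 0 0 * Q 0 0 by rewrite mxE big_ord1.
  rewrite /qf E B11 M11 -/(dot v u) -/(dot u v) (dotC v u).
  by congr (_ - _); rewrite mulrC expr2.
by field.
Qed.

End schur.

(* The Schur complement form at [v] is the minimum over [x] of the form at
   [col_mx x v], so Schur complements are monotone too; induct on the size. *)
Lemma det_le_qf p (M N : 'M[R]_p) : M^T = M -> N^T = N ->
  (forall v, v != 0 -> 0 < qf M v) -> (forall v, qf M v <= qf N v) ->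
  0 < \det M <= \det N.
Proof.
elim: p M N => [|p IH] M N sM sN pM MN.
  by rewrite !det_mx00 lexx ltr01.
have dec (Q : 'M[R]_(1 + p)) : Q^T = Q ->
    Q = block_mx (Q 0 0)%:M (dlsubmx Q)^T (dlsubmx Q) (drsubmx Q).
  move=> sQ; rewrite -{1}(submxK Q); congr block_mx.
    by apply/matrixP => i j; rewrite !ord1 !mxE eqxx; congr (Q _ _); apply: val_inj.
  by rewrite trmx_dlsub sQ.
have := dec M sM; have := dec N sN.
set a := M 0 0; set u := dlsubmx (M : 'M[R]_(1 + p)); set B := drsubmx (M : 'M[R]_(1 + p)).
set a' := N 0 0; set u' := dlsubmx (N : 'M[R]_(1 + p)); set B' := drsubmx (N : 'M[R]_(1 + p)).
move=> eN eM; rewrite eM in pM; rewrite eM eN in MN; rewrite eM eN.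
have col0 x (v : 'cV[R]_p) : v != 0 -> col_mx (x%:M : 'M[R]_1) v != 0.
  by apply: contra => /eqP; rewrite -col_mx0 => /eq_col_mx [_ ->].
have e0 (c : R) (w : 'cV[R]_p) (Q : 'M[R]_p) :
    qf (block_mx c%:M w^T w Q) (col_mx 1%:M 0) = c.
  rewrite /qf tr_col_mx mul_row_block mul_row_col trmx0 trmx1 !mul0mx !mulmx0 !addr0.
  by rewrite mul1mx mulmx1 mxE eqxx.
have col1 : col_mx (1%:M : 'M[R]_1) (0 : 'cV[R]_p) != 0.
  apply/negP => /eqP; rewrite -col_mx0 => /eq_col_mx [/matrixP/(_ 0 0)/eqP + _].
  by rewrite !mxE eqxx oner_eq0.
have a0 : 0 < a by rewrite -(e0 a u B); apply: pM; exact: col1.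
have aa' : a <= a' by rewrite -(e0 a u B) -(e0 a' u' B').
have a'0 : 0 < a' := lt_le_trans a0 aa'.
have an : a != 0 by rewrite gt_eqF.
have an' : a' != 0 by rewrite gt_eqF.
rewrite !det_schur//.
have qS v : qf (B - a^-1 *: (u *m u^T)) v =
    qf (block_mx a%:M u^T u B) (col_mx (- (dot u v / a))%:M v).
  by rewrite qf_schur// addNr expr0n mulr0 add0r.
have qS' v : qf (B' - a'^-1 *: (u' *m u'^T)) v =
    qf (block_mx a'%:M u'^T u' B') (col_mx (- (dot u' v / a'))%:M v).
  by rewrite qf_schur// addNr expr0n mulr0 add0r.
have symS (c : R) (w : 'cV[R]_p) (Q : 'M[R]_p) : Q^T = Q ->
    (Q - c *: (w *m w^T))^T = Q - c *: (w *m w^T).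
  by move=> sQ; rewrite linearB linearZ /= trmx_mul trmxK sQ.
have sB : B^T = B by rewrite /B trmx_drsub sM.
have sB' : B'^T = B' by rewrite /B' trmx_drsub sN.
have /andP[d1 d2] : 0 < \det (B - a^-1 *: (u *m u^T)) <= \det (B' - a'^-1 *: (u' *m u'^T)).
  apply: IH; try exact: symS.
    by move=> v v0; rewrite qS pM// col0.
  (* The minimizer belonging to [N] is merely a competitor in the minimization for [M]. *)
  move=> v; rewrite qS'; apply: le_trans (MN _).
  by rewrite qf_schur// lerDr mulr_ge0 ?sqr_ge0// ltW.
rewrite mulr_gt0//=; apply: ler_pM => //; exact: ltW.
Qed.

End quadratic_forms.

(** * Gaussian vectors *)

Lemma measurable_qf (R : realType) d (T : measurableType d) p
    (M : T -> 'M[R]_p) (v : T -> 'cV[R]_p) :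
  mx_elt d T M -> mx_elt d T v -> measurable_fun setT (fun z => qf (M z) (v z)).
Proof.
move=> mM mv; rewrite /qf.
have mm : mx_elt d T (fun z => (v z)^T *m M z *m v z).
  by apply: mx_elt_mul => //; apply: mx_elt_mul => //; exact: mx_elt_tr.
exact: mm.
Qed.

Lemma measurable_sqn (R : realType) d (T : measurableType d) p (v : T -> 'cV[R]_p) :
  mx_elt d T v -> measurable_fun setT (fun z => sqn (v z)).
Proof.
move=> mv; under eq_fun do rewrite sqnE.
by apply: measurable_sumR => i; apply: measurable_funX; exact: mv.
Qed.

Section gaussian.
Context (R : realType) (p : nat).

(** Unnormalized Gaussian density with precision matrix [M / s]; [h_beta] and [h_theta] are
    instances by conversion. *)
Definition gauss_vec (M : 'M[R]_p) (m : 'cV[R]_p) (s : R) (v : 'cV[R]_p) : R :=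
  expR (- qf M (v - m) / (2 * s)).

Lemma measurable_gauss_vec d (T : measurableType d) (M : T -> 'M[R]_p)
    (m : T -> 'cV[R]_p) (s : T -> R) (v : T -> 'cV[R]_p) :
  mx_elt d T M -> mx_elt d T m -> measurable_fun setT s -> mx_elt d T v ->
  measurable_fun setT (fun z => gauss_vec (M z) (m z) (s z) (v z)).
Proof.
move=> mM mm ms mv; apply: measurable_expRf; apply: measurable_funM.
  apply: measurable_funN; apply: measurable_qf => //.
  by apply: mx_elt_add => //; exact: mx_elt_opp.
by apply: measurable_funV; exact: measurable_funM.
Qed.

Context (M : 'M[R]_p) (c : R) (c0 : 0 < c).
Hypothesis Mc : forall v, c * sqn v <= qf M v.
Context (m : 'cV[R]_p) (s : R) (s0 : 0 < s).

Lemma meas_gauss_vec : meas (@mx_elt R p 1) (fun v => (gauss_vec M m s v)%:E).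
Proof.
move=> d T v mv; apply/measurable_EFinP; apply: measurable_gauss_vec => //;
  exact: mx_elt_cst.
Qed.

Lemma gauss_vec_ge0 v : 0 <= gauss_vec M m s v. Proof. exact: expR_ge0. Qed.

Let P k (v : 'cV[R]_p) := \prod_(i < p) expR (- (k * (v i 0 - m i 0) ^+ 2)).

Let PE k v : P k v = expR (- (k * sqn (v - m))).
Proof.
rewrite /P -expR_sum; congr expR.
rewrite sqnE mulr_sumr -sumrN; apply: eq_bigr => i _; by rewrite !mxE.
Qed.

Let vint_P k : 0 < k -> exists2 a : R, 0 < a & vint (fun v => (P k v)%:E) = a%:E.
Proof.
move=> k0.
have H (i : 'I_p) := integral_gauss_fin (m i 0) k0.
pose a i := xget 0 [set a : R | 0 < a /\
  (\int[@lebesgue_measure R]_x (expR (- (k * (x - m i 0) ^+ 2)))%:E = a%:E)%E].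
have aP i : 0 < a i /\
  (\int[@lebesgue_measure R]_x (expR (- (k * (x - m i 0) ^+ 2)))%:E = (a i)%:E)%E.
  exact: (xgetPex 0 (H i)).
exists (\prod_i a i); first by apply: prodr_gt0 => i _; exact: (aP i).1.
rewrite (@vint_prod _ _ (fun i x => expR (- (k * (x - m i 0) ^+ 2))) a)//.
- move=> i; apply: measurable_expRf; apply: measurable_funN.
  apply: measurable_funM => //; apply: measurable_funX.
  by apply: measurable_funB => //; exact: measurable_cst.
- by move=> i; exact: (aP i).2.
Qed.

Let meas_P k : meas (@mx_elt R p 1) (fun v => (P k v)%:E).
Proof.
move=> d T v mv; apply/measurable_EFinP; under eq_fun do rewrite PE.
apply: measurable_expRf; apply: measurable_funN; apply: measurable_funM => //.
apply: measurable_sqn; apply: mx_elt_add => //; exact: mx_elt_cst.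
Qed.

(** The form lies between [c * sqn v] and [C * sqn v], so the integral lies between those of two
    isotropic Gaussians, which are products of one-dimensional ones. This avoids diagonalizing
    [M]. *)
Lemma vint_gauss_vec : (0 < vint (fun v => (gauss_vec M m s v)%:E) < +oo)%E.
Proof.
have s20 : 0 < 2 * s by rewrite mulr_gt0.
have vi := vint_integrator R p.
have [C C0 MC] := qf_bound M.
have [a a0 aE] := vint_P (divr_gt0 C0 s20).
have [b b0 bE] := vint_P (divr_gt0 c0 s20).
have P0 k v : (0 <= (P k v)%:E)%E by rewrite lee_fin PE expR_ge0.
have g0 v : (0 <= (gauss_vec M m s v)%:E)%E by rewrite lee_fin gauss_vec_ge0.
apply/andP; split.
  apply: (@lt_le_trans _ _ a%:E); first by rewrite lte_fin.
  rewrite -aE; apply: (int_le vi (@meas_P _) meas_gauss_vec) => // v _.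
  rewrite lee_fin PE ler_expR mulNr lerN2 mulrAC.
  by rewrite ler_wpM2r// invr_ge0 ltW.
apply: (@le_lt_trans _ _ b%:E); last by rewrite ltry.
rewrite -bE; apply: (int_le vi meas_gauss_vec (@meas_P _)) => // v _.
rewrite lee_fin PE ler_expR mulNr lerN2 mulrAC.
by rewrite ler_wpM2r// invr_ge0 ltW.
Qed.

End gaussian.

(* Chernoff bound: dilating by 2 around [m] turns [s] into [4 s], so the mass of
   [qf M (v - m) > K s] is at most [expR (- 3 K / 8) * 2 ^ p] of the total. *)
Lemma vint_gauss_vec_concentrates (R : realType) (p : nat) :
  exists2 K : R, 0 < K & forall (M : 'M[R]_p) (c : R) m s, 0 < c ->
    (forall v, c * sqn v <= qf M v) -> 0 < s ->
    (2^-1%:E * vint (fun v => (gauss_vec M m s v)%:E) <=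
     vint (fun v => (gauss_vec M m s v)%:E *
       ((qf M (v - m) <= K * s)%R%:R)%:E))%E.
Proof.
pose y : R := 2 ^+ p.+1.
have y0 : 0 < y by rewrite exprn_gt0.
have y1 : 1 < y by rewrite exprn_egt1// ltr1n.
(* so that [expR (- 3 K / 8) * 2 ^ p = 1 / 2] *)
exists (8 / 3 * ln y); first by rewrite mulr_gt0 ?divr_gt0// ln_gt0.
set K := 8 / 3 * ln y.
move=> M c m s c0 Mc s0.
have vi := vint_integrator R p.
pose g := gauss_vec M m s; pose g' := gauss_vec M m (4 * s).
have s40 : 0 < 4 * s by rewrite mulr_gt0.
have mg : meas (@mx_elt R p 1) (fun v => (g v)%:E) by exact: meas_gauss_vec.
have mg' : meas (@mx_elt R p 1) (fun v => (g' v)%:E) by exact: meas_gauss_vec.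
have g0 v : (0 <= (g v)%:E)%E by rewrite lee_fin gauss_vec_ge0.
have g'0 v : (0 <= (g' v)%:E)%E by rewrite lee_fin gauss_vec_ge0.
have scal : vint (fun v => (g v)%:E) = ((2^-1 ^+ p)%:E * vint (fun v => (g' v)%:E))%E.
  rewrite -(@vint_affine _ _ 2 (- m))//; congr vint; apply/funext => v.
  rewrite /g /g' /gauss_vec; congr (expR _)%:E.
  have -> : 2 *: v + - m - m = 2 *: (v - m).
    by apply/colP => i; rewrite !mxE; ring.
  by rewrite qfZ; field; rewrite gt_eqF.
have /andP[I0 Iy] := @vint_gauss_vec _ _ M c c0 Mc m s s0.
have /andP[I0' Iy'] := @vint_gauss_vec _ _ M c c0 Mc m (4 * s) s40.
pose ind v : \bar R := ((qf M (v - m) <= K * s)%R%:R)%:E.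
have mind : meas (@mx_elt R p 1) ind.
  move=> d T v mv; apply/measurable_EFinP; apply: measurable_ind => //.
  apply: measurable_qf; first exact: mx_elt_cst.
  by apply: mx_elt_add => //; exact: mx_elt_cst.
have ind0 v : (0 <= ind v)%E by rewrite lee_fin.
have mgi : meas (@mx_elt R p 1) (fun v => (g v)%:E * ind v)%E.
  by move=> d T v mv; apply: emeasurable_funM; [exact: mg|exact: mind].
have gi0 v : (0 <= (g v)%:E * ind v)%E by rewrite mule_ge0.
(* Inside the ellipsoid the indicator retains [g]. Outside, the exponents of [g] and [g'] differ by
   [(1 / 2 - 1 / 8) * q / s], which exceeds [3 / 8 * K = ln y]. *)
have key : (vint (fun v => (g v)%:E) <=
    vint (fun v => (g v)%:E * ind v) + (y^-1)%:E * vint (fun v => (g' v)%:E))%E.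
  rewrite -(int_scale vi)//; last by rewrite invr_ge0 ltW.
  have myg : meas (@mx_elt R p 1) (fun v => (y^-1)%:E * (g' v)%:E)%E.
    by move=> d T v mv; apply: emeasurable_funM => //; exact: mg'.
  have yg0 v : (0 <= (y^-1)%:E * (g' v)%:E)%E.
    by rewrite mule_ge0// lee_fin invr_ge0 ltW.
  rewrite -(int_add vi)//; apply: (int_le vi) => //.
  - by move=> d T v mv; apply: emeasurable_funD; [exact: mgi|exact: myg].
  - by move=> v; rewrite adde_ge0.
  move=> v _; rewrite /ind; case: (leP (qf M (v - m)) (K * s)) => hK.
    by rewrite mule1 leeDl.
  rewrite mule0 add0e lee_fin /g /g' /gauss_vec.
  rewrite -[y^-1](_ : expR (- ln y) = _); last by rewrite expRN lnK// posrE.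
  rewrite -expRD ler_expR.
  set q := qf M (v - m).
  have -> : - q / (2 * s) = - q / (2 * (4 * s)) - 3 / 8 * (q / s).
    by field; rewrite gt_eqF.
  rewrite [leRHS]addrC lerD2l lerN2.
  rewrite [ln y](_ : _ = 3 / 8 * K); last by rewrite /K; field.
  by rewrite ler_pM2l ?divr_gt0// ler_pdivlMr// ltW.
have If : vint (fun v => (g v)%:E) \is a fin_num by rewrite ge0_fin_numE// ltW.
have If' : vint (fun v => (g' v)%:E) \is a fin_num by rewrite ge0_fin_numE// ltW.
have half : ((y^-1)%:E * vint (fun v => (g' v)%:E) = 2^-1%:E * vint (fun v => (g v)%:E))%E.
  by rewrite scal muleA -EFinM -exprS exprVn.
rewrite half -(fineK If) in key.
rewrite -/g -(fineK If); move: key.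
rewrite -/g; case: (vint (fun v => (g v)%:E * ind v)%E) => [u| |] //.
  by rewrite -!EFinM -EFinD !lee_fin => key; lra.
by move=> _; rewrite leey.
Qed.

(** * Bounds on the regression model *)

Section model.
Context (R : realType) (n p : nat) (X : 'M[R]_(n, p)) (y : 'cV[R]_n).
Implicit Types (l v : 'cV[R]_p) (t s : R).

Definition Mmat t l : 'M[R]_p := 1%:M + t *: (Lam l *m XtX X *m Lam l).

Definition beta_mean t l : 'cV[R]_p :=
  Num.sqrt t *: (invmx (Mmat t l) *m Lam l *m X^T *m y).

Lemma Lam_tr l : (Lam l)^T = Lam l.
Proof. by rewrite /Lam tr_diag_mx. Qed.

Lemma Lam_gram l : Lam l *m XtX X *m Lam l = (X *m Lam l)^T *m (X *m Lam l).
Proof. by rewrite trmx_mul Lam_tr /XtX !mulmxA. Qed.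

Lemma qfD (M N : 'M[R]_p) v : qf (M + N) v = qf M v + qf N v.
Proof. by rewrite !qfE mulmxDl dotDr. Qed.

Lemma qfS k (M : 'M[R]_p) v : qf (k *: M) v = k * qf M v.
Proof. by rewrite !qfE -scalemxAl dotZr. Qed.

Lemma qf1 v : qf 1%:M v = sqn v.
Proof. by rewrite qfE mul1mx. Qed.

Lemma qf_gram l v : qf (Lam l *m XtX X *m Lam l) v = sqn (X *m Lam l *m v).
Proof. by rewrite Lam_gram qfE -mulmxA -dotMl. Qed.

Lemma qf_Mmat t l v : qf (Mmat t l) v = sqn v + t * sqn (X *m Lam l *m v).
Proof. by rewrite qfD qfS qf1 qf_gram. Qed.

Lemma qf_Mmat_ge t l v : 0 <= t -> 1 * sqn v <= qf (Mmat t l) v.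
Proof. by move=> t0; rewrite mul1r qf_Mmat lerDl mulr_ge0// sqn_ge0. Qed.

Lemma Mmat_unit t l : 0 <= t -> Mmat t l \in unitmx.
Proof.
move=> t0; apply: qf_unitmx => v v0; apply: lt_le_trans (qf_Mmat_ge l v t0).
by rewrite mul1r sqn_gt0.
Qed.

Lemma Mmat_sym t l : (Mmat t l)^T = Mmat t l.
Proof.
rewrite /Mmat linearD linearZ /= trmx1; congr (_ + _ *: _).
by rewrite Lam_gram trmx_mul trmxK.
Qed.

Lemma det_Mmat_le t t' l : 0 <= t -> t <= t' ->
  0 < \det (Mmat t l) <= \det (Mmat t' l).
Proof.
move=> t0 tt; apply: det_le_qf; try exact: Mmat_sym.
  move=> v v0; apply: lt_le_trans (qf_Mmat_ge l v t0).
  by rewrite mul1r sqn_gt0.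
by move=> v; rewrite !qf_Mmat lerD2l ler_wpM2r// sqn_ge0.
Qed.

(** With [W := X *m Lam l], testing the normal equation for the mean [m] against [m] gives [sqn m +
    t * sqn (W *m m) = Num.sqrt t * dot (W *m m) y], and the right side is at most
    [(t * sqn (W *m m) + sqn y) / 2]. Neither [t] nor [l] enters the resulting bound. *)
Lemma beta_mean_bound t l : 0 < t ->
  sqn (beta_mean t l) <= sqn y /\ t * sqn (X *m Lam l *m beta_mean t l) <= sqn y.
Proof.
move=> t0; set m := beta_mean t l; set W := X *m Lam l.
have Mm : Mmat t l *m m = Num.sqrt t *: (W^T *m y).
  rewrite /m /beta_mean -scalemxAr -!mulmxA mulKVmx ?Mmat_unit ?ltW//.
  by rewrite /W trmx_mul Lam_tr !mulmxA.
have e1 : sqn m + t * sqn (W *m m) = Num.sqrt t * dot (W *m m) y.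
  by rewrite -qf_Mmat qfE Mm dotZr -dotMl.
have e2 : Num.sqrt t * dot (W *m m) y = dot (Num.sqrt t *: (W *m m)) y by rewrite dotZl.
have e3 : sqn (Num.sqrt t *: (W *m m)) = t * sqn (W *m m).
  by rewrite sqnZ sqr_sqrtr// ltW.
have := dot_le (Num.sqrt t *: (W *m m)) y.
rewrite e3 -e2 -e1 => H; have := sqn_ge0 m.
have : 0 <= t * sqn (W *m m) by rewrite mulr_ge0 ?sqn_ge0// ltW.
by move=> h1 h2; split; lra.
Qed.

(** [z] solves the ridge equation, so [dot (W *m z) y] equals [t^-1 * sqn z + sqn (W *m z)]. Hence
    it is nonnegative and at least [sqn (W *m z)], and [dot_le] then bounds it by [sqn y]. *)
Lemma Rfun_bounds (b' : R) t l : 0 < t -> b' <= Rfun X y b' t l <= sqn y / 2 + b'.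
Proof.
move=> t0; set W := X *m Lam l.
pose N := t^-1 *: 1%:M + Lam l *m XtX X *m Lam l.
have ti : 0 < t^-1 by rewrite invr_gt0.
have qN v : qf N v = t^-1 * sqn v + sqn (W *m v) by rewrite qfD qfS qf1 qf_gram.
have Nu : N \in unitmx.
  apply: qf_unitmx => v v0; rewrite qN ltr_pwDl ?sqn_ge0// mulr_gt0//.
  exact: sqn_gt0.
pose z := invmx N *m (W^T *m y).
have Nz : N *m z = W^T *m y by rewrite /z mulKVmx.
have e1 : t^-1 * sqn z + sqn (W *m z) = dot (W *m z) y.
  by rewrite -qN qfE Nz -dotMl.
have RE : Rfun X y b' t l = (sqn y - dot (W *m z) y) / 2 + b'.
  rewrite /Rfun -/N; congr (_ / 2 + b').
  rewrite mulmxBr mulmx1 mulmxBl mxE [X in _ + X]mxE -/(dot y y) -/(sqn y).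
  congr (_ - _); rewrite dotC /dot /z /W trmx_mul Lam_tr !mulmxA.
  by [].
have h1 := dot_le (W *m z) y.
have h2 : 0 <= t^-1 * sqn z by rewrite mulr_ge0 ?sqn_ge0// ltW.
have h3 := sqn_ge0 (W *m z).
by rewrite RE; apply/andP; split; lra.
Qed.

(** [invmx (XtX X) *m X^T] is a left inverse of [X]. *)
Lemma full_rank_bound : XtX X \in unitmx ->
  exists2 C, 0 <= C & forall v, sqn v <= C * sqn (X *m v).
Proof.
move=> uX; have [C C0 H] := sqn_mul_bound (invmx (XtX X) *m X^T).
by exists C => // v; have := H (X *m v); rewrite -!mulmxA (mulmxA X^T) mulKmx.
Qed.

Context (d : R).

(** The second summand of [Amat] is the inverse of a positive definite [S], and
    [qf (invmx S) v = qf S (invmx S *m v)] is nonnegative. *)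
Lemma qf_Amat_ge v : 0 < d -> pos_def (invmx (XtX X) - d *: 1%:M) ->
  d^-1 * sqn v <= qf (Amat X d) v.
Proof.
move=> d0 [_ pd]; rewrite /Amat qfD qfS qf1 lerDl.
set S := _ - _ in pd *.
have Su : S \in unitmx by apply: qf_unitmx.
have -> : qf (invmx S) v = qf S (invmx S *m v).
  by rewrite !qfE mulmxA mulmxV// mul1mx dotC.
have [->|v0] := eqVneq (invmx S *m v) 0; first by rewrite /qf mulmx0 mxE.
exact/ltW/pd.
Qed.

Definition theta_mean t l (be : 'cV[R]_p) : 'cV[R]_p :=
  invmx (Amat X d) *m ((Num.sqrt t / d) *: (Lam l *m be) + bvec X y d).

Lemma beta_region (K : R) : XtX X \in unitmx -> 0 < K ->
  exists2 K' : R, 0 < K' & forall t s l v, 0 < t -> 1 <= s ->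
    qf (Mmat t l) (v - beta_mean t l) <= K * s ->
    sqn v <= K' * s /\ t * sqn (Lam l *m v) <= K' * s.
Proof.
move=> uX K0; have [C C0 HC] := full_rank_bound uX.
have y0 := sqn_ge0 y.
pose K1 := 2 * K + 2 * sqn y.
have K10 : 0 < K1 by rewrite /K1; lra.
exists ((1 + C) * K1); first by rewrite mulr_gt0// ltr_wpDr.
move=> t s l v t0 s1; rewrite qf_Mmat; set m := beta_mean t l; set W := X *m Lam l.
have [m1 m2] := beta_mean_bound l t0; rewrite -/m -/W in m1 m2.
move=> H.
have s0 : 0 < s by rewrite (lt_le_trans _ s1).
(* The mean is bounded by a constant, the deviation by a multiple of [s]; the assumption [1 <= s]
   merges the two. *)
have ys : sqn y <= sqn y * s by rewrite ler_peMr.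
have h0 := sqn_ge0 (v - m).
have h1 : 0 <= t * sqn (W *m (v - m)) by rewrite mulr_ge0 ?sqn_ge0// ltW.
have vE : v = (v - m) + m by rewrite subrK.
have b1 : sqn v <= K1 * s.
  rewrite vE; apply: (le_trans (sqnD_le _ _)); rewrite /K1.
    have -> : (2 * K + 2 * sqn y) * s = 2 * (K * s) + 2 * (sqn y * s) by ring.
    lra.
have b2 : t * sqn (W *m v) <= K1 * s.
  have -> : W *m v = W *m (v - m) + W *m m by rewrite -mulmxDr -vE.
  have := sqnD_le (W *m (v - m)) (W *m m); rewrite -(ler_pM2l t0) => /le_trans; apply.
  have -> : K1 * s = 2 * (K * s) + 2 * (sqn y * s) by rewrite /K1; ring.
  have -> : t * (2 * sqn (W *m (v - m)) + 2 * sqn (W *m m)) =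
    2 * (t * sqn (W *m (v - m))) + 2 * (t * sqn (W *m m)) by ring.
  lra.
have Ks : 0 <= K1 * s by rewrite mulr_ge0// ltW.
have -> : (1 + C) * K1 * s = K1 * s + C * (K1 * s) by ring.
split; first by apply: (le_trans b1); rewrite lerDl mulr_ge0.
apply: (@le_trans _ _ (t * (C * sqn (X *m (Lam l *m v))))).
  by rewrite ler_pM2l.
rewrite mulmxA -/W mulrCA.
apply: (@le_trans _ _ (C * (K1 * s))); first by rewrite ler_wpM2l.
by rewrite lerDr.
Qed.

Lemma theta_region (K K1 : R) : 0 < d -> pos_def (invmx (XtX X) - d *: 1%:M) ->
  0 < K -> 0 < K1 ->
  exists2 K' : R, 0 < K' & forall t s l be v, 0 < t -> 1 <= s ->
    t * sqn (Lam l *m be) <= K1 * s ->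
    qf (Amat X d) (v - theta_mean t l be) <= K * s -> sqn v <= K' * s.
Proof.
move=> d0 pd K0 K10.
have [C C0 HC] := sqn_mul_bound (invmx (Amat X d)).
have b0 := sqn_ge0 (bvec X y d).
pose Q := 2 * (K1 / d ^+ 2) + 2 * sqn (bvec X y d).
have Q0 : 0 <= Q by rewrite addr_ge0// mulr_ge0// divr_ge0 ?sqr_ge0// ltW.
(* [d * K] bounds the deviation, as the form of [Amat] is at least [d^-1 * sqn]; [C * Q] bounds the
   mean, [C] coming from the inverse of [Amat] and [Q] from the vector it is applied to. *)
exists (2 * (d * K) + 2 * (C * Q)).
  by rewrite ltr_pwDl ?mulr_gt0// mulr_ge0// mulr_ge0.
move=> t s l be v t0 s1 hb; set m := theta_mean t l be => hq.
have s0 : 0 < s by rewrite (lt_le_trans _ s1).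
have h1 : sqn (v - m) <= d * K * s.
  have := qf_Amat_ge (v - m) d0 pd => /le_trans/(_ hq).
  by rewrite mulrC ler_pdivrMr// => H; apply: (le_trans H); rewrite mulrC mulrA.
have h2 : sqn m <= C * Q * s.
  apply: (le_trans (HC _)); rewrite -mulrA ler_wpM2l//.
  apply: (le_trans (sqnD_le _ _)); rewrite sqnZ exprMn sqr_sqrtr ?(ltW t0)// exprVn.
  have bs : sqn (bvec X y d) <= sqn (bvec X y d) * s by rewrite ler_peMr.
  have hb' : t / d ^+ 2 * sqn (Lam l *m be) <= K1 / d ^+ 2 * s.
    by rewrite mulrAC [leRHS]mulrAC ler_wpM2r// invr_ge0 sqr_ge0.
  have -> : Q * s = 2 * (K1 / d ^+ 2 * s) + 2 * (sqn (bvec X y d) * s) by rewrite /Q; ring.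
  lra.
rewrite -(subrK m v); apply: (le_trans (sqnD_le _ _)).
have -> : (2 * (d * K) + 2 * (C * Q)) * s = 2 * (d * K * s) + 2 * (C * Q * s) by ring.
lra.
Qed.

End model.

(** * The five conditional updates *)

Ltac mx_meas := lazymatch goal with
  | |- mx_elt _ _ (fun _ => ?M) => exact: mx_elt_cst
  | |- mx_elt _ _ (fun z => mulmx _ _) => apply: mx_elt_mul; mx_meas
  | |- mx_elt _ _ (fun z => _ + _) => apply: mx_elt_add; mx_meas
  | |- mx_elt _ _ (fun z => - _) => apply: mx_elt_opp; mx_meas
  | |- mx_elt _ _ (fun z => _ *: _) => apply: mx_elt_scale; [try assumption|mx_meas]
  | |- mx_elt _ _ (fun z => trmx _) => apply: mx_elt_tr; mx_meas
  | |- mx_elt _ _ (fun z => invmx _) => apply: mx_elt_inv; mx_meas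
  | |- mx_elt _ _ (fun z => Lam _) => apply: mx_elt_Lam; mx_meas
  | |- mx_elt _ _ _ => assumption
  | |- _ => idtac
  end.

Lemma meas2_density (R : realType) (S U : Type) (eltS : elements S)
    (eltU : elements U) (D : set U) (I : (U -> \bar R) -> \bar R) (h : S -> U -> R) :
  integrator eltU D I ->
  (forall d d' (T : measurableType d) (T' : measurableType d')
    (x : T' -> S) (phi : T -> T'), measurable_fun [set: T] phi -> eltS d' T' x ->
    eltS d T (x \o phi)) ->
  (forall x u, 0 <= h x u) -> meas2 eltS eltU h ->
  meas2 eltS eltU (fun x u => h x u / fine (I (fun u => (h x u)%:E))).
Proof.
move=> int compS h0 mh d T x u mx mu; apply: measurable_funM; first exact: mh.
apply: measurable_funV; apply: measurableT_comp => //.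
apply: (int_meas int (g := fun z u => (h (x z) u)%:E)).
  move=> d' T' phi v mphi mv; apply/measurable_EFinP.
  exact: (mh _ _ (x \o phi) v (compS _ _ _ _ _ _ mphi mx)).
by move=> z v; rewrite lee_fin.
Qed.

Section sampler.
Context (R : realType) (n p : nat) (X : 'M[R]_(n, p)) (y : 'cV[R]_n).
Context (a' b' d : R) (pil : R -> R).
Local Notation D0 := [set u : R | (0 < u)%R].
Local Notation S := (state R p).
Local Notation elt := (@state_elt R p).
Local Notation valid := (@valid_state R p).
Local Notation I0 := (fun f : R -> \bar R => (\int[@lebesgue_measure R]_(u in D0) f u)%E).
Implicit Types (x : S) (l v : 'cV[R]_p) (t s : R).

Hypothesis a0 : 0 < a'.
Hypothesis b0 : 0 < b'.
Hypothesis uX : XtX X \in unitmx.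
Hypothesis d0 : 0 < d.
Hypothesis pd : pos_def (invmx (XtX X) - d *: 1%:M).
Hypothesis pil_prob : prob_density setT pil.

Let mpil : measurable_fun setT pil := pil_prob.1.
Let pil0 u : 0 <= pil u := pil_prob.2.1 u.
Let pil1 : (\int[@lebesgue_measure R]_u (pil u)%:E = 1)%E := pil_prob.2.2.

Let intv := vint_integrator R p.
Let int0 : integrator (@real_elt R) D0 I0 := real_integrator (@measurable_pos R).

Definition upd_theta x v := mkState v (s_beta x) (s_sig2 x) (s_tau2 x) (s_lam x).
Definition upd_beta x v := mkState (s_theta x) v (s_sig2 x) (s_tau2 x) (s_lam x).
Definition upd_sig2 x s := mkState (s_theta x) (s_beta x) s (s_tau2 x) (s_lam x).
Definition upd_tau2 x t := mkState (s_theta x) (s_beta x) (s_sig2 x) t (s_lam x).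
Definition upd_lam x l := mkState (s_theta x) (s_beta x) (s_sig2 x) (s_tau2 x) l.

Definition w_theta x v :=
  ndensv (h_theta X y d (s_tau2 x) (s_sig2 x) (s_lam x) (s_beta x)) v.
Definition w_beta x v := ndensv (h_beta X y (s_tau2 x) (s_sig2 x) (s_lam x)) v.
Definition w_sig2 x s := ndens D0 (h_sig2 X y a' b' (s_tau2 x) (s_lam x)) s.
Definition w_lam x l := \prod_(k < p) ndens setT
  (h_lam d pil (s_tau2 x) (s_beta x k 0) (s_theta x k 0) (s_sig2 x)) (l k 0).

Let ex := @state_elt_comp R p.
Let ec := @state_elt_cst R p.

Lemma meas_upd_theta : meas_upd elt (@mx_elt R p 1) upd_theta.
Proof. by move=> dd T x u [h1 h2 h3 h4 h5] hu; split. Qed.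
Lemma meas_upd_beta : meas_upd elt (@mx_elt R p 1) upd_beta.
Proof. by move=> dd T x u [h1 h2 h3 h4 h5] hu; split. Qed.
Lemma meas_upd_sig2 : meas_upd elt (@real_elt R) upd_sig2.
Proof. by move=> dd T x u [h1 h2 h3 h4 h5] hu; split. Qed.
Lemma meas_upd_tau2 : meas_upd elt (@real_elt R) upd_tau2.
Proof. by move=> dd T x u [h1 h2 h3 h4 h5] hu; split. Qed.
Lemma meas_upd_lam : meas_upd elt (@mx_elt R p 1) upd_lam.
Proof. by move=> dd T x u [h1 h2 h3 h4 h5] hu; split. Qed.

Lemma measurable_Rfun dd (T : measurableType dd) (t : T -> R) (l : T -> 'cV[R]_p) :
  measurable_fun setT t -> mx_elt dd T l ->
  measurable_fun setT (fun z => Rfun X y b' (t z) (l z)).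
Proof.
move=> mt ml; apply: measurable_funD => //; apply: measurable_funM => //.
have mti := measurable_funV mt.
have h : mx_elt dd T (fun z => y^T *m (1%:M - X *m Lam (l z) *m
    invmx ((t z)^-1 *: 1%:M + Lam (l z) *m XtX X *m Lam (l z)) *m Lam (l z) *m X^T) *m y).
  by mx_meas.
exact: h.
Qed.

Lemma meas2_theta : meas2 elt (@mx_elt R p 1) w_theta.
Proof.
apply: (meas2_density intv ex).
  by move=> x u; exact: expR_ge0.
move=> dd T x u [h1 h2 h3 h4 h5] hu.
have ms : measurable_fun setT (fun z => Num.sqrt (s_tau2 (x z)) / d).
  by apply: measurable_funM => //; exact: measurable_sqrt.
by apply: (measurable_gauss_vec (M := fun _ => Amat X d)
  (m := fun z => theta_mean X y d (s_tau2 (x z)) (s_lam (x z)) (s_beta (x z)))) => //;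
  rewrite /theta_mean; mx_meas.
Qed.

Lemma meas2_beta : meas2 elt (@mx_elt R p 1) w_beta.
Proof.
apply: (meas2_density intv ex).
  by move=> x u; exact: expR_ge0.
move=> dd T x u [h1 h2 h3 h4 h5] hu.
have ms := measurable_sqrt h4.
by apply: (measurable_gauss_vec (M := fun z => Mmat X (s_tau2 (x z)) (s_lam (x z)))
  (m := fun z => beta_mean X y (s_tau2 (x z)) (s_lam (x z)))) => //;
  rewrite /beta_mean /Mmat; mx_meas.
Qed.

Lemma h_sig2_ge0 t l s : 0 <= h_sig2 X y a' b' t l s.
Proof. by rewrite mulr_ge0 ?powR_ge0// expR_ge0. Qed.

Lemma meas2_sig2 : meas2 elt (@real_elt R) w_sig2.
Proof.
apply: (meas2_density int0 ex).
  by move=> x u; exact: h_sig2_ge0.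
move=> dd T x u [h1 h2 h3 h4 h5] hu.
apply: measurable_funM; first exact: measurable_powRl.
apply: measurable_expRf; apply: measurable_funM; last exact: measurable_funV.
by apply: measurable_funN; exact: measurable_Rfun.
Qed.

Lemma h_lam_ge0 t bk thk s u : 0 <= h_lam d pil t bk thk s u.
Proof. by rewrite mulr_ge0// expR_ge0. Qed.

Lemma meas2_h_lam k : meas2 elt (@real_elt R)
  (fun x u => h_lam d pil (s_tau2 x) (s_beta x k 0) (s_theta x k 0) (s_sig2 x) u).
Proof.
move=> dd T x u [h1 h2 h3 h4 h5] hu.
apply: measurable_funM; last exact: (measurableT_comp mpil).
apply: measurable_expRf; apply: measurable_funM; last first.
  by apply: measurable_funV; exact: measurable_funM.
apply: measurable_funN; apply: measurable_funX; apply: measurable_funB; last exact: h1.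
apply: measurable_funM; last exact: h2.
by apply: measurable_funM => //; exact: measurable_sqrt.
Qed.

Lemma meas2_lam : meas2 elt (@mx_elt R p 1) w_lam.
Proof.
move=> dd T x u hx hu; apply: measurable_prodR => k.
have h := meas2_density (real_integrator (measurableT : measurable (setT : set R)))
  ex (fun x u => h_lam_ge0 (s_tau2 x) (s_beta x k 0) (s_theta x k 0) (s_sig2 x) u)
  (@meas2_h_lam k).
exact: (h _ _ x (fun z => u z k 0) hx (hu k 0)).
Qed.

Lemma w_theta_ge0 x v : 0 <= w_theta x v.
Proof. by apply: (density_ge0 intv) => u; exact: expR_ge0. Qed.
Lemma w_beta_ge0 x v : 0 <= w_beta x v.
Proof. by apply: (density_ge0 intv) => u; exact: expR_ge0. Qed.
Lemma w_sig2_ge0 x s : 0 <= w_sig2 x s.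
Proof. by apply: ndens_ge0 => u; exact: h_sig2_ge0. Qed.
Lemma w_lam_ge0 x l : 0 <= w_lam x l.
Proof. by apply: prodr_ge0 => k _; apply: ndens_ge0 => u; exact: h_lam_ge0. Qed.

Definition U_theta := stage (@vint R p) w_theta upd_theta.
Definition U_beta := stage (@vint R p) w_beta upd_beta.
Definition U_sig2 := stage I0 w_sig2 upd_sig2.
Definition U_tau2 (w : S -> R -> R) := stage I0 w upd_tau2.
Definition U_lam (w : S -> 'cV[R]_p -> R) := stage (@vint R p) w upd_lam.

Lemma pos_op_theta : pos_op elt valid U_theta.
Proof.
by apply: (stage_pos_op intv ec ex w_theta_ge0 meas2_theta meas_upd_theta).
Qed.

Lemma pos_op_beta : pos_op elt valid U_beta.
Proof.
by apply: (stage_pos_op intv ec ex w_beta_ge0 meas2_beta meas_upd_beta).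
Qed.

Lemma pos_op_sig2 : pos_op elt valid U_sig2.
Proof.
apply: (stage_pos_op int0 ec ex w_sig2_ge0 meas2_sig2 meas_upd_sig2).
by move=> x u [h1 h2] hu; split.
Qed.

Lemma pos_op_tau2 w : (forall x t, 0 <= w x t) -> meas2 elt (@real_elt R) w ->
  pos_op elt valid (U_tau2 w).
Proof.
move=> w0 mw; apply: (stage_pos_op int0 ec ex w0 mw meas_upd_tau2).
by move=> x u [h1 h2] hu; split.
Qed.

Lemma pos_op_lam w : (forall x l, 0 <= w x l) -> meas2 elt (@mx_elt R p 1) w ->
  pos_op elt valid (U_lam w).
Proof. by move=> w0 mw; apply: (stage_pos_op intv ec ex w0 mw meas_upd_lam). Qed.

Lemma theta_normalizer x : valid x ->
  (0 < vint (fun v => (h_theta X y d (s_tau2 x) (s_sig2 x) (s_lam x) (s_beta x) v)%:E) < +oo)%E.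
Proof.
move=> [s0 t0]; have di : 0 < d^-1 by rewrite invr_gt0.
exact: (vint_gauss_vec di (fun v => qf_Amat_ge v d0 pd) _ s0).
Qed.

Lemma beta_normalizer x : valid x ->
  (0 < vint (fun v => (h_beta X y (s_tau2 x) (s_sig2 x) (s_lam x) v)%:E) < +oo)%E.
Proof.
move=> [s0 t0].
exact: (vint_gauss_vec ltr01 (fun v => qf_Mmat_ge X (s_lam x) v (ltW t0)) _ s0).
Qed.

Let al : R := n%:R / 2 + a'.
Let al0 : 0 < al. Proof. by rewrite ltr_wpDl// divr_ge0. Qed.

Let measig b : meas (@real_elt R) (fun s => (ig_fun al b s)%:E).
Proof. by apply: meas_real; apply/measurable_EFinP; exact: measurable_ig. Qed.

Let sigind s : \bar R := ((1 <= s)%R%:R)%:E.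
Let msigind : meas (@real_elt R) sigind.
Proof.
apply: meas_real; apply/measurable_EFinP; apply: measurable_ind => //.
Qed.
Let sigind0 s : (0 <= sigind s)%E. Proof. by rewrite lee_fin. Qed.

Let int_ig_gt0 b : (0 < I0 (fun s => (ig_fun al b s)%:E * sigind s))%E.
Proof.
rewrite [X in (_ < X)%E](_ : _ = I0 (fun s => (ig_fun al b s * (1 <= s)%R%:R)%:E)).
  exact: integral_ig_gt0.
by apply: eq_integral => s _; rewrite EFinM.
Qed.

Let int_ig_normalizer b : 0 < b -> (0 < I0 (fun s => (ig_fun al b s)%:E) < +oo)%E.
Proof.
move=> bp; rewrite integral_ig_fin// andbT.
apply: lt_le_trans (int_ig_gt0 b) _; apply: (int_le int0) => //.
- by move=> dd T u mu; apply: emeasurable_funM; [exact: measig|exact: msigind].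
- by move=> s; rewrite mule_ge0// lee_fin ig_fun_ge0.
- by move=> s; rewrite lee_fin ig_fun_ge0.
- move=> s _; rewrite /sigind; case: (1 <= s); rewrite ?mule1// mule0.
  by rewrite lee_fin ig_fun_ge0.
Qed.

Lemma sig2_normalizer x : valid x ->
  (0 < I0 (fun s => (h_sig2 X y a' b' (s_tau2 x) (s_lam x) s)%:E) < +oo)%E.
Proof.
move=> [s0 t0]; apply: int_ig_normalizer.
by have /andP[h _] := Rfun_bounds X y b' (s_lam x) t0; apply: lt_le_trans h.
Qed.

(** The Gaussian factor lies in [(0, 1]] and [pil] has mass 1. The bound by 1 later allows the
    normalizer to be dropped when the density is bounded below. *)
Lemma lam_normalizer t bk thk s :
  0 < s -> exists2 c : R, 0 < c <= 1 &
  (\int[@lebesgue_measure R]_u (h_lam d pil t bk thk s u)%:E = c%:E)%E.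
Proof.
move=> s0.
have me : measurable_fun setT (fun u => expR (- (Num.sqrt t * u * bk - thk) ^+ 2 / (2 * d * s))).
  apply: measurable_expRf; apply: measurable_funM => //; apply: measurable_funN.
  apply: measurable_funX; apply: measurable_funB => //.
  by apply: measurable_funM => //; exact: measurable_funM.
have h1 : (0 < \int[@lebesgue_measure R]_u (h_lam d pil t bk thk s u)%:E)%E.
  apply: integral_weight_gt0 => //; first by move=> u _; exact: expR_gt0.
  by rewrite pil1.
have h2 : (\int[@lebesgue_measure R]_u (h_lam d pil t bk thk s u)%:E <= 1)%E.
  rewrite -pil1; apply: ge0_le_integral => //.
  - by move=> u _; rewrite lee_fin h_lam_ge0.
  - by apply/measurable_EFinP; exact: measurable_funM.
  - by apply/measurable_EFinP.
  - move=> u _; rewrite lee_fin /h_lam -[leRHS]mul1r ler_wpM2r// -expR0 ler_expR.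
    by rewrite mulNr oppr_le0 divr_ge0 ?sqr_ge0// !mulr_ge0 ?ltW.
exists (fine (\int[@lebesgue_measure R]_u (h_lam d pil t bk thk s u)%:E)).
  rewrite fine_gt0 ?h1 ?(le_lt_trans h2) ?ltry//= -lee_fin fineK//.
  by rewrite ge0_fin_numE ?(le_lt_trans h2) ?ltry// ltW.
by rewrite fineK// ge0_fin_numE ?(le_lt_trans h2) ?ltry// ltW.
Qed.

Let cst1 U (eltU : elements U) : meas eltU (fun _ : U => 1%E : \bar R).
Proof. by move=> dd T u _; exact: measurable_cst. Qed.

Lemma meas_h_theta t s l be :
  meas (@mx_elt R p 1) (fun v => (h_theta X y d t s l be v)%:E).
Proof. exact: meas_gauss_vec. Qed.

Lemma meas_h_beta t s l : meas (@mx_elt R p 1) (fun v => (h_beta X y t s l v)%:E).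
Proof. exact: meas_gauss_vec. Qed.

Lemma unital_theta : unital valid U_theta.
Proof.
move=> x vx; have h0 v : 0 <= h_theta X y d (s_tau2 x) (s_sig2 x) (s_lam x) (s_beta x) v.
  exact: expR_ge0.
exact: (int_density1 intv (@meas_h_theta _ _ _ _) h0 (theta_normalizer vx)).
Qed.

Lemma unital_beta : unital valid U_beta.
Proof.
move=> x vx; have h0 v : 0 <= h_beta X y (s_tau2 x) (s_sig2 x) (s_lam x) v.
  exact: expR_ge0.
exact: (int_density1 intv (@meas_h_beta _ _ _) h0 (beta_normalizer vx)).
Qed.

Lemma unital_sig2 : unital valid U_sig2.
Proof.
move=> x vx.
exact: (int_density1 int0 (@measig _) (@h_sig2_ge0 _ _) (sig2_normalizer vx)).
Qed.

Lemma unital_lam : unital valid (U_lam w_lam).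
Proof.
move=> x [s0 t0]; rewrite /U_lam /stage.
rewrite (_ : (fun u => _) = (fun u => (w_lam x u)%:E)); last first.
  by apply/funext => u; rewrite mule1.
rewrite (@vint_prod _ _ (fun k => ndens setT
  (h_lam d pil (s_tau2 x) (s_beta x k 0) (s_theta x k 0) (s_sig2 x))) (fun=> 1)).
- by rewrite big1.
- move=> k; have h := meas2_density (real_integrator (measurableT : measurable (setT : set R)))
    ex (fun x u => h_lam_ge0 (s_tau2 x) (s_beta x k 0) (s_theta x k 0) (s_sig2 x) u)
    (@meas2_h_lam k).
  by apply: (h _ _ (fun=> x) id); [exact: ec|exact: measurable_id].
- by move=> k u; apply: ndens_ge0 => v; exact: h_lam_ge0.
- move=> k; have [c /andP[c0 _] cE] := lam_normalizer (s_tau2 x) (s_beta x k 0) (s_theta x k 0) s0.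
  apply: integral_ndens => //; last by rewrite cE lte_fin c0 ltry.
    by apply: (@meas2_h_lam k _ _ (fun=> x) id); [exact: ec|exact: measurable_id].
  by move=> u; exact: h_lam_ge0.
Qed.

(** Each region is named after the update that lands in it. In the last one, the bounds on tau^2
    beta~^2 and theta^2 control the exponent of the next lambda-update, and the bound on beta~^2
    alone controls the tau^2-update of Algorithm 3. The bound on tau^2 Lambda beta~ in [region_beta]
    is there for the mean of theta. *)
Definition region_theta (K : R) x := [&& 1 <= s_sig2 x, sqn (s_beta x) <= K * s_sig2 x,
  s_tau2 x * sqn (s_beta x) <= K * s_sig2 x & sqn (s_theta x) <= K * s_sig2 x].
Definition region_beta (K tbar : R) x := [&& 1 <= s_sig2 x, s_tau2 x <= tbar,
  sqn (s_beta x) <= K * s_sig2 x & s_tau2 x * sqn (Lam (s_lam x) *m s_beta x) <= K * s_sig2 x].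
Definition region_sig2 (tbar : R) x := (1 <= s_sig2 x) && (s_tau2 x <= tbar).
Definition region_tau2 (tbar : R) x := s_tau2 x <= tbar.

Let natrM_and (b1 b2 : bool) : (b1 && b2)%:R = b1%:R * b2%:R :> R.
Proof. by case: b1; rewrite ?mul1r ?mul0r. Qed.

Lemma meas_region_theta K : meas elt (ind R (region_theta K)).
Proof.
move=> dd T x [h1 h2 h3 h4 h5]; apply/measurable_EFinP.
rewrite /region_theta; under eq_fun do rewrite !natrM_and.
have mKs : measurable_fun setT (fun z => K * s_sig2 (x z)) by exact: measurable_funM.
have mb := measurable_sqn h2; have mt := measurable_sqn h1.
apply: measurable_funM; first exact: measurable_ind.
apply: measurable_funM; first exact: measurable_ind.
apply: measurable_funM; last exact: measurable_ind.
by apply: measurable_ind => //; exact: measurable_funM.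
Qed.

Lemma meas_region_beta K tbar : meas elt (ind R (region_beta K tbar)).
Proof.
move=> dd T x [h1 h2 h3 h4 h5]; apply/measurable_EFinP.
rewrite /region_beta; under eq_fun do rewrite !natrM_and.
have mKs : measurable_fun setT (fun z => K * s_sig2 (x z)) by exact: measurable_funM.
have mb := measurable_sqn h2.
have ml : measurable_fun setT (fun z => sqn (Lam (s_lam (x z)) *m s_beta (x z))).
  by apply: measurable_sqn; mx_meas.
apply: measurable_funM; first exact: measurable_ind.
apply: measurable_funM; first exact: measurable_ind.
apply: measurable_funM; first exact: measurable_ind.
by apply: measurable_ind => //; exact: measurable_funM.
Qed.

Lemma meas_region_sig2 tbar : meas elt (ind R (region_sig2 tbar)).
Proof.
move=> dd T x [h1 h2 h3 h4 h5]; apply/measurable_EFinP.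
rewrite /region_sig2; under eq_fun do rewrite !natrM_and.
by apply: measurable_funM; exact: measurable_ind.
Qed.

Lemma meas_region_tau2 tbar : meas elt (ind R (region_tau2 tbar)).
Proof.
by move=> dd T x [h1 h2 h3 h4 h5]; apply/measurable_EFinP; exact: measurable_ind.
Qed.

Lemma vint_gauss_half (K : R) (M : 'M[R]_p) (m : 'cV[R]_p) s (g : 'cV[R]_p -> \bar R) :
  (0 < vint (fun v => (gauss_vec M m s v)%:E) < +oo)%E ->
  (2^-1%:E * vint (fun v => (gauss_vec M m s v)%:E) <=
     vint (fun v => (gauss_vec M m s v)%:E * ((qf M (v - m) <= K * s)%R%:R)%:E))%E ->
  meas (@mx_elt R p 1) g -> (forall v, 0 <= g v)%E ->
  (forall v, (qf M (v - m) <= K * s)%R -> 1 <= g v)%E ->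
  (2^-1%:E <= vint (fun v => (gauss_vec M m s v /
     fine (vint (fun v => (gauss_vec M m s v)%:E)))%:E * g v))%E.
Proof.
move=> /andP[I_gt0 I_lty] conc mg g0 g1.
have If : vint (fun v => (gauss_vec M m s v)%:E) \is a fin_num by rewrite ge0_fin_numE// ltW.
set c := fine _; have c0 : 0 < c by rewrite /c fine_gt0// I_gt0.
have -> : 2^-1 = (2^-1 * c) / c by rewrite mulfK// gt_eqF.
apply: (int_density_ge intv) => //.
- exact: meas_gauss_vec.
- by move=> v; exact: expR_ge0.
- by rewrite mulr_gt0.
- by rewrite /c fineK.
rewrite EFinM /c fineK//; apply: (le_trans conc).
have mi : meas (@mx_elt R p 1) (fun v => ((qf M (v - m) <= K * s)%R%:R : R)%:E).
  move=> dd T v mv; apply/measurable_EFinP; apply: measurable_ind => //.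
  by apply: measurable_qf; mx_meas.
apply: (int_le intv) => //.
- by move=> dd T v mv; apply: emeasurable_funM; [exact: meas_gauss_vec|exact: mi].
- by move=> dd T v mv; apply: emeasurable_funM; [exact: meas_gauss_vec|exact: mg].
- by move=> v; rewrite mule_ge0// lee_fin expR_ge0.
- by move=> v; rewrite mule_ge0// lee_fin expR_ge0.
- move=> v _; rewrite lee_wpmul2l ?lee_fin ?expR_ge0//.
  by case: (leP (qf M (v - m)) (K * s)) => h; [exact: g1|exact: g0].
Qed.

Let meas_upd_ind (A : S -> bool) (upd : S -> 'cV[R]_p -> S) x : meas elt (ind R A) ->
  meas_upd elt (@mx_elt R p 1) upd -> meas (@mx_elt R p 1) (fun v => ind R A (upd x v)).
Proof.
by move=> mA mupd dd T v mv; apply: mA; exact: (mupd _ _ (fun=> x)).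
Qed.

Lemma beta_lower (tbar : R) : exists2 K1 : R, 0 < K1 & forall x, valid x ->
  (2^-1%:E * ind R (region_sig2 tbar) x <= U_beta (ind R (region_beta K1 tbar)) x)%E.
Proof.
have [K K0 conc] := vint_gauss_vec_concentrates R p.
have [K1 K10 reg] := @beta_region _ _ _ X y K uX K0.
exists K1 => // x vx; rewrite {1}/ind; case: (boolP (region_sig2 tbar x)) => [/andP[s1 tT]|_]; last first.
  by rewrite mule0; apply: (po_ge0 pos_op_beta) => z; exact: ind_ge0.
rewrite mule1; have [s0 t0] := vx.
apply: (@vint_gauss_half K (Mmat X (s_tau2 x) (s_lam x)) (beta_mean X y (s_tau2 x) (s_lam x)) (s_sig2 x)).
- exact: (beta_normalizer vx).
- apply: (conc _ 1) => // v; exact: (qf_Mmat_ge X (s_lam x) v (ltW t0)).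
- exact: (meas_upd_ind _ (@meas_region_beta _ _) meas_upd_beta).
- by move=> v; exact: ind_ge0.
- move=> v hv; have [r1 r2] := reg _ _ _ _ t0 s1 hv.
  by rewrite /ind /region_beta /= s1 tT r1 r2.
Qed.

Lemma theta_lower (tbar K1 : R) : 0 < tbar -> 0 < K1 ->
  exists2 K : R, 0 < K & forall x, valid x ->
  (2^-1%:E * ind R (region_beta K1 tbar) x <= U_theta (ind R (region_theta K)) x)%E.
Proof.
move=> T0 K10; have [K K0 conc] := vint_gauss_vec_concentrates R p.
have [K2 K20 reg] := @theta_region _ _ _ X y d K K1 d0 pd K0 K10.
have TK : 0 < tbar * K1 by rewrite mulr_gt0.
(* One summand for each of the bounds on beta~^2, tau^2 beta~^2 and theta^2. *)
exists (K1 + tbar * K1 + K2); first by lra.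
move=> x vx; rewrite {1}/ind.
case: (boolP (region_beta K1 tbar x)) => [/and4P[s1 tT hb1 hb2]|_]; last first.
  by rewrite mule0; apply: (po_ge0 pos_op_theta) => z; exact: ind_ge0.
rewrite mule1; have [s0 t0] := vx.
have di : 0 < d^-1 by rewrite invr_gt0.
apply: (@vint_gauss_half K (Amat X d) (theta_mean X y d (s_tau2 x) (s_lam x) (s_beta x)) (s_sig2 x)).
- exact: (theta_normalizer vx).
- by apply: (conc _ d^-1) => // v; exact: qf_Amat_ge.
- exact: (meas_upd_ind _ (@meas_region_theta _) meas_upd_theta).
- by move=> v; exact: ind_ge0.
- move=> v hv; have r := reg _ _ _ _ _ t0 s1 hb2 hv.
  have s0' := ltW s0.
  have e1 : 0 <= tbar * K1 * s_sig2 x by rewrite mulr_ge0// ltW.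
  have e2 : 0 <= K1 * s_sig2 x by rewrite mulr_ge0// ltW.
  have e3 : 0 <= K2 * s_sig2 x by rewrite mulr_ge0// ltW.
  have e4 : s_tau2 x * sqn (s_beta x) <= tbar * K1 * s_sig2 x.
    rewrite -mulrA; apply: ler_pM => //; [exact: ltW|exact: sqn_ge0].
  rewrite /ind /region_theta /= s1 !mulrDl.
  have -> : sqn (s_beta x) <= K1 * s_sig2 x + tbar * K1 * s_sig2 x + K2 * s_sig2 x by lra.
  have -> : s_tau2 x * sqn (s_beta x) <= K1 * s_sig2 x + tbar * K1 * s_sig2 x + K2 * s_sig2 x by lra.
  by have -> : sqn v <= K1 * s_sig2 x + tbar * K1 * s_sig2 x + K2 * s_sig2 x by lra.
Qed.

(** [ig_fun] decreases in its scale, and [Rfun] lies between [b'] and [B]: the mass beyond 1 is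
    bounded below with scale [B], the normalizer above with scale [b']. *)
Lemma sig2_lower (tbar : R) : exists2 c : R, 0 < c & forall x, valid x ->
  (c%:E * ind R (region_tau2 tbar) x <= U_sig2 (ind R (region_sig2 tbar)) x)%E.
Proof.
pose B := sqn y / 2 + b'.
have B0 : 0 < B by rewrite ltr_wpDl// divr_ge0// sqn_ge0.
have /andP[I2 I2y] := int_ig_normalizer b0.
have I1 := int_ig_gt0 B.
have mi b : meas (@real_elt R) (fun s => (ig_fun al b s)%:E * sigind s)%E.
  by move=> dd T u mu; apply: emeasurable_funM; [exact: measig|exact: msigind].
have i0 b s : (0 <= (ig_fun al b s)%:E * sigind s)%E.
  by rewrite mule_ge0// lee_fin ig_fun_ge0.
have I1y : (I0 (fun s => (ig_fun al B s)%:E * sigind s) < +oo)%E.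
  have /andP[_ h] := int_ig_normalizer B0; apply: le_lt_trans h.
  apply: (int_le int0) => //; first by move=> s; rewrite lee_fin ig_fun_ge0.
  move=> s _; rewrite /sigind; case: (1 <= s); rewrite ?mule1// mule0.
  by rewrite lee_fin ig_fun_ge0.
set c1 := I0 _ in I1 I1y; set c2 := I0 _ in I2 I2y.
have f1 : c1 = (fine c1)%:E by rewrite fineK// ge0_fin_numE// ltW.
have f2 : c2 = (fine c2)%:E by rewrite fineK// ge0_fin_numE// ltW.
exists (fine c1 / fine c2); first by rewrite divr_gt0// fine_gt0 ?I1 ?I2.
move=> x vx; rewrite {1}/ind.
case: (boolP (region_tau2 tbar x)) => [tT|_]; last first.
  by rewrite mule0; apply: (po_ge0 pos_op_sig2) => z; exact: ind_ge0.
rewrite mule1; have [s0 t0] := vx.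
have /andP[Rb RB] := Rfun_bounds X y b' (s_lam x) t0.
have /andP[IR _] := sig2_normalizer vx.
have m2 : meas (@real_elt R) (fun s => ind R (region_sig2 tbar) (upd_sig2 x s)).
  move=> dd T u mu; apply: meas_region_sig2; exact: (meas_upd_sig2 (x := fun=> x)).
apply: (int_density_ge int0 (@measig _) (@h_sig2_ge0 _ _)) => //.
- by rewrite fine_gt0 ?I1.
- rewrite -f2; apply: (int_le int0 (@measig _) (@measig _)) => s.
  + by rewrite lee_fin h_sig2_ge0.
  + by rewrite lee_fin ig_fun_ge0.
  + by move=> sp; rewrite lee_fin; exact: le_ig_fun.
  by move=> u; exact: ind_ge0.
rewrite -f1; apply: (int_le int0) => //.
- by move=> dd T u mu; apply: emeasurable_funM; [exact: measig|exact: m2].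
- move=> s; apply: mule_ge0; last exact: ind_ge0.
  by rewrite lee_fin ig_fun_ge0.
- move=> s sp; rewrite /sigind /ind /region_sig2 /= (_ : s_tau2 x <= tbar) ?andbT//.
  by rewrite lee_wpmul2r// lee_fin; exact: le_ig_fun.
Qed.

(** Unnormalized minorant of the lambda-update on [region_theta K]. The state argument gives it the
    type of a weight for [U_lam]. *)
Definition gamma (K : R) (_ : S) l :=
  \prod_(k < p) (expR (- (K / d * (1 + l k 0 ^+ 2))) * pil (l k 0)).

Let kernel_factor (K : R) u := expR (- (K / d * (1 + u ^+ 2))) * pil u.

Let measurable_kernel_factor K : measurable_fun setT (kernel_factor K).
Proof.
apply: measurable_funM => //; apply: measurable_expRf; apply: measurable_funN.
by apply: measurable_funM => //; apply: measurable_funD => //; exact: measurable_funX.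
Qed.

Lemma gamma_ge0 K x l : 0 <= gamma K x l.
Proof. by apply: prodr_ge0 => k _; rewrite mulr_ge0// expR_ge0. Qed.

Lemma meas2_gamma K : meas2 elt (@mx_elt R p 1) (gamma K).
Proof.
move=> dd T x u hx hu; apply: measurable_prodR => k.
exact: (measurableT_comp (measurable_kernel_factor K) (hu k 0)).
Qed.

(** In each coordinate the normalizer is at most 1, and the square of a difference is at most twice
    the sum of the squares. On the region this is [2 * (1 + u ^+ 2) * K * s_sig2 x], from which the
    variance cancels. *)
Lemma gamma_le_w_lam K x l : 0 < K -> valid x -> region_theta K x -> gamma K x l <= w_lam x l.
Proof.
move=> K0 [s0 t0] /and4P[s1 _ hb ht]; apply: ler_prod => k _.
rewrite mulr_ge0 ?expR_ge0//=.
have [c /andP[c0 c1] cE] := lam_normalizer (s_tau2 x) (s_beta x k 0) (s_theta x k 0) s0.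
rewrite /ndens cE /= ler_pdivlMr//.
apply: (@le_trans _ _ (expR (- (K / d * (1 + l k 0 ^+ 2))) * pil (l k 0))).
  by rewrite ler_piMr// mulr_ge0// expR_ge0.
rewrite ler_wpM2r// ler_expR mulNr lerN2 ler_pdivrMr ?mulr_gt0//.
set u := l k 0; set be := s_beta x k 0; set th := s_theta x k 0.
have -> : K / d * (1 + u ^+ 2) * (2 * d * s_sig2 x) =
    2 * u ^+ 2 * (K * s_sig2 x) + 2 * (K * s_sig2 x).
  by field; rewrite gt_eqF.
have e1 : (Num.sqrt (s_tau2 x) * u * be) ^+ 2 = u ^+ 2 * (s_tau2 x * be ^+ 2).
  by rewrite !exprMn sqr_sqrtr ?(ltW t0)//; ring.
have e2 : s_tau2 x * be ^+ 2 <= K * s_sig2 x.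
  by apply: le_trans hb; rewrite ler_pM2l// sqr_le_sqn.
have e3 : th ^+ 2 <= K * s_sig2 x by apply: le_trans ht; exact: sqr_le_sqn.
have e4 : u ^+ 2 * (s_tau2 x * be ^+ 2) <= u ^+ 2 * (K * s_sig2 x).
  by rewrite ler_wpM2l// sqr_ge0.
have := sqr_ge0 (Num.sqrt (s_tau2 x) * u * be + th).
rewrite sqrrD sqrrB e1 -!mulrA; lra.
Qed.

(** Profile in lambda allowed for the loss of mass of the tau^2-minorant. *)
Definition gauss_lam (c k : R) x : \bar R := (c * expR (- (k * sqn (s_lam x))))%:E.

Lemma meas_gauss_lam c k : meas elt (gauss_lam c k).
Proof.
move=> dd T x [h1 h2 h3 h4 h5]; apply/measurable_EFinP.
apply: measurable_funM => //; apply: measurable_expRf; apply: measurable_funN.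
by apply: measurable_funM => //; exact: measurable_sqn.
Qed.

Lemma gauss_lam_ge0 c k : 0 <= c -> forall x, (0 <= gauss_lam c k x)%E.
Proof. by move=> c0 x; rewrite lee_fin mulr_ge0 ?expR_ge0. Qed.

(** The Gaussian profile factors over the coordinates just as [gamma] does, so the mass is [c] times
    a power of a one-dimensional integral, which is positive because a positive factor multiplies
    the probability density [pil]. *)
Lemma gamma_mass_gt0 (K c k : R) x : 0 < K -> 0 < c -> 0 <= k ->
  (0 < U_lam (gamma K) (gauss_lam c k) x)%E.
Proof.
move=> K0 c0 k0; pose F u := expR (- (k * u ^+ 2)) * kernel_factor K u.
have mF : measurable_fun setT F.
  apply: measurable_funM => //; apply: measurable_expRf; apply: measurable_funN.
  by apply: measurable_funM => //; exact: measurable_funX.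
have kf0 u : 0 <= kernel_factor K u by rewrite mulr_ge0// expR_ge0.
have F0 u : 0 <= F u by rewrite mulr_ge0// expR_ge0.
have Fpil u : F u <= pil u.
  rewrite /F /kernel_factor mulrA -[leRHS]mul1r ler_wpM2r// -expRD -expR0 ler_expR.
  rewrite -opprD oppr_le0 addr_ge0// mulr_ge0 ?sqr_ge0//; first by rewrite divr_ge0 ?ltW.
  by rewrite addr_ge0// sqr_ge0.
have IF0 : (0 < \int[@lebesgue_measure R]_u (F u)%:E)%E.
  rewrite [X in (_ < X)%E](_ : _ = \int[@lebesgue_measure R]_u
    ((expR (- (k * u ^+ 2)) * expR (- (K / d * (1 + u ^+ 2)))) * pil u)%:E)%E; last first.
    by apply: eq_integral => u _; rewrite /F /kernel_factor mulrA.
  apply: integral_weight_gt0 => //; last by rewrite pil1.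
    apply: measurable_funM; apply: measurable_expRf; apply: measurable_funN;
      apply: measurable_funM => //; last apply: measurable_funD => //; exact: measurable_funX.
  by move=> u _; rewrite mulr_gt0// expR_gt0.
have IF1 : (\int[@lebesgue_measure R]_u (F u)%:E <= 1)%E.
  rewrite -pil1; apply: ge0_le_integral => //; by [move=> u _; rewrite lee_fin|apply/measurable_EFinP].
have IFf : (\int[@lebesgue_measure R]_u (F u)%:E)%E \is a fin_num.
  by rewrite ge0_fin_numE ?(le_lt_trans IF1) ?ltry// ltW.
set a := fine (\int[@lebesgue_measure R]_u (F u)%:E)%E.
have a_gt0 : 0 < a by rewrite fine_gt0// IF0 (le_lt_trans IF1)// ltry.
rewrite [X in (_ < X)%E](_ : _ =
    vint (fun l : 'cV[R]_p => c%:E * (\prod_(i < p) F (l i 0))%:E)%E); last first.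
  rewrite /U_lam /stage; congr vint; apply/funext => l.
  rewrite /gamma /gauss_lam /= -!EFinM; congr EFin.
  rewrite mulrCA; congr (_ * _); rewrite sqnE mulr_sumr -sumrN expR_sum mulrC -big_split.
  by [].
rewrite (int_scale intv) ?ltW//.
- rewrite (@vint_prod _ _ (fun=> F) (fun=> a))//; last by move=> _; rewrite fineK.
  by rewrite -EFinM lte_fin mulr_gt0// prodr_gt0.
- move=> dd T l ml; apply/measurable_EFinP; apply: measurable_prodR => i.
  exact: (measurableT_comp mF (ml i 0)).
- by move=> l; rewrite lee_fin prodr_ge0.
Qed.

(** * Ergodicity for an abstract update of tau^2 *)

Context (htau : S -> 'cV[R]_p -> R -> R).
Definition w_tau2 x t := ndens D0 (htau x (s_lam x)) t.

(** The new lambda reaches [htau] through its second argument, so [htau] may be evaluated at the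
    state in which lambda has already been replaced. *)
Hypothesis htau_upd : forall x l l', htau (upd_lam x l) l' = htau x l'.
Hypothesis htau_ge0 : forall x l t, 0 <= htau x l t.
Hypothesis meas2_htau : meas2 elt (@real_elt R) (fun x t => htau x (s_lam x) t).
Hypothesis htau_normalizer : forall x, valid x ->
  (0 < I0 (fun t => (htau x (s_lam x) t)%:E) < +oo)%E.
Hypothesis htau_tight : exists tbar c : R, [/\ 0 < tbar, 0 < c &
  forall x, valid x ->
    (c%:E <= I0 (fun t => (w_tau2 x t)%:E * ((t <= tbar)%R%:R)%:E))%E].
(** The minorant may depend on the lambda just drawn and may lose mass as lambda grows, but it must
    not depend on the rest of the state. *)
Hypothesis htau_minor : forall K : R, 0 < K ->
  exists (eta : 'cV[R]_p -> R -> R) (c k : R), [/\ forall l t, 0 <= eta l t,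
    meas2 elt (@real_elt R) (fun x t => eta (s_lam x) t),
    0 < c /\ 0 <= k,
    forall l, ((c * expR (- (k * sqn l)))%:E <= I0 (fun t => (eta l t)%:E))%E &
    forall x, valid x -> region_theta K x ->
      forall t, 0 < t -> eta (s_lam x) t <= w_tau2 x t].

Let w_tau2_ge0 x t : 0 <= w_tau2 x t.
Proof. by apply: ndens_ge0 => u; exact: htau_ge0. Qed.

Let meas2_tau2 : meas2 elt (@real_elt R) w_tau2.
Proof. by apply: (meas2_density int0 ex) => // x u; exact: htau_ge0. Qed.

Let P := gibbs_op X y a' b' d pil htau.
Let W f := U_sig2 (U_beta (U_theta f)).

(** The nested integrals are this composition by conversion, except that [htau] takes the old state
    in one and the state with updated lambda in the other. *)
Let PE : P = fun f => U_lam w_lam (U_tau2 w_tau2 (W f)).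
Proof.
apply/funext => f; apply/funext => x; transitivity (vint (fun l => (w_lam x l)%:E *
  I0 (fun t => (ndens D0 (htau x l) t)%:E * W f (upd_tau2 (upd_lam x l) t)))%E); first by [].
apply: (congr1 (@vint R p)); apply/funext => l.
apply: (congr1 (mule (w_lam x l)%:E)).
apply: eq_integral => t _; congr mule; congr EFin.
by rewrite -(htau_upd x l l).
Qed.

Let opW : pos_op elt valid W.
Proof.
by apply: (pos_op_comp pos_op_sig2); exact: (pos_op_comp pos_op_beta pos_op_theta).
Qed.

Let op_tau := pos_op_tau2 w_tau2_ge0 meas2_tau2.
Let op_lam := pos_op_lam w_lam_ge0 meas2_lam.

Let opP : pos_op elt valid P.
Proof. by rewrite PE; apply: (pos_op_comp op_lam); exact: (pos_op_comp op_tau opW). Qed.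

Let unital_tau2 : unital valid (U_tau2 w_tau2).
Proof.
move=> x vx.
have mh : meas (@real_elt R) (fun t => (htau x (s_lam x) t)%:E).
  by move=> dd T u mu; apply/measurable_EFinP; exact: (@meas2_htau _ _ (fun=> x)).
exact: (int_density1 int0 mh (@htau_ge0 _ _) (htau_normalizer vx)).
Qed.

Let unitalW : unital valid W.
Proof.
apply: (unital_comp pos_op_sig2 (pos_op_comp pos_op_beta pos_op_theta) unital_sig2).
exact: (unital_comp pos_op_beta pos_op_theta unital_beta unital_theta).
Qed.

Let unitalP : unital valid P.
Proof.
rewrite PE; apply: (unital_comp op_lam (pos_op_comp op_tau opW) unital_lam).
exact: (unital_comp op_tau opW unital_tau2 unitalW).
Qed.

(** Assembled from the last update to the first. [delta] has one factor for each of theta, beta~,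
    sigma^2 and tau^2; the lambda-update costs nothing because the bounds for the others are uniform
    in lambda. *)
Let hits_region : exists K delta : R, [/\ 0 < K, 0 < delta & forall x, valid x ->
  (delta%:E * ind R (fun _ : S => true) x <= P (ind R (region_theta K)) x)%E].
Proof.
have [tbar [c [T0 c0 tight]]] := htau_tight.
have [K1 K10 h2] := beta_lower tbar.
have [K K0 h1] := theta_lower T0 K10.
have [c2 c20 h3] := sig2_lower tbar.
have half : (0 : R) < 2^-1 by rewrite invr_gt0.
have mC := @meas_region_theta K; have iC := @ind_ge0 R _ (region_theta K).
have g1 := lower_comp pos_op_beta (ltW half) (po_meas pos_op_theta mC iC)
  (po_ge0 pos_op_theta iC) (@meas_region_beta _ _) h1 h2.
have opbt := pos_op_comp pos_op_beta pos_op_theta.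
have q0 : 0 < (2^-1 : R) * 2^-1 by rewrite mulr_gt0.
have g2 := lower_comp pos_op_sig2 (ltW q0) (po_meas opbt mC iC)
  (po_ge0 opbt iC) (@meas_region_sig2 _) g1 h3.
have h4 x : valid x -> (c%:E * ind R (fun _ : S => true) x <=
    U_tau2 w_tau2 (ind R (region_tau2 tbar)) x)%E.
  by move=> vx; rewrite mule1; exact: tight.
have r0 : 0 < (2^-1 : R) * 2^-1 * c2 by rewrite mulr_gt0.
have g3 := lower_comp op_tau (ltW r0) (po_meas opW mC iC)
  (po_ge0 opW iC) (@meas_region_tau2 _) g2 h4.
have h5 x : valid x -> (1%:E * ind R (fun _ : S => true) x <=
    U_lam w_lam (ind R (fun _ : S => true)) x)%E.
  by move=> vx; rewrite mul1e [leRHS](unital_lam vx).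
have z0 : 0 < (2^-1 : R) * 2^-1 * c2 * c by rewrite mulr_gt0.
have opt := pos_op_comp op_tau opW.
have mT : meas elt (ind R (fun _ : S => true)) by exact: cst1.
have g4 := lower_comp op_lam (ltW z0) (po_meas opt mC iC) (po_ge0 opt iC) mT g3 h5.
exists K, (2^-1 * 2^-1 * c2 * c * 1); split; [exact: K0|by rewrite mulr1|].
by move=> x vx; rewrite PE; exact: (g4 x vx).
Qed.

Lemma gibbs_ergodic : geom_ergodic P.
Proof.
have [K [delta [K0 delta0 hit]]] := hits_region.
have [eta [c [k [eta0 meta [c0 k0] etaI etale]]]] := htau_minor K0.
pose w_eta x t := eta (s_lam x) t.
have w_eta0 x t : 0 <= w_eta x t by exact: eta0.
have opeta := pos_op_tau2 w_eta0 meta.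
have opgam := pos_op_lam (@gamma_ge0 K) (@meas2_gamma K).
(* Only the lambda- and tau^2-weights need minorants: the remaining updates [W] see just the new
   lambda and tau^2 and redraw everything else. Hence [VC] holds by conversion. *)
pose V f := U_lam (gamma K) (U_tau2 w_eta (W f)).
have opV : pos_op elt valid V by apply: (pos_op_comp opgam); exact: (pos_op_comp opeta opW).
pose x0 : S := mkState 0 0 1 1 0.
have vx0 : valid x0 by split; exact: ltr01.
have s00 : sqn (0 : 'cV[R]_p) = 0 by rewrite /sqn /dot mulmx0 mxE.
have C0 : region_theta K x0 by rewrite /region_theta /= s00 mulr0 mulr1 lexx (ltW K0).
have VC f x : V f x = V f x0 by [].
have minorC f x : meas elt f -> (forall x, 0 <= f x)%E -> valid x -> region_theta K x ->
    (V f x <= P f x)%E.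
  move=> mf f0 vx Cx; rewrite PE.
  have mWf := po_meas opW mf f0; have Wf0 := po_ge0 opW f0.
  have me := po_meas opeta mWf Wf0; have e0 := po_ge0 opeta Wf0.
  have mt := po_meas op_tau mWf Wf0; have t0 := po_ge0 op_tau Wf0.
  apply: (@le_trans _ _ (U_lam (gamma K) (U_tau2 w_tau2 (W f)) x)).
    apply: (le_stage intv ec ex (@gamma_ge0 K) (@meas2_gamma K) meas_upd_lam me mt e0 t0) => l _.
    apply: (stage_le_weight int0 ec ex w_eta0 w_tau2_ge0 meta meas2_tau2 meas_upd_tau2 mWf Wf0).
    (* [valid] and [region_theta] do not mention lambda, so they pass from [x] to [upd_lam x l] by
       conversion. *)
    by move=> t tp; apply: (etale (upd_lam x l)).
  apply: (stage_le_weight intv ec ex (@gamma_ge0 K) w_lam_ge0 (@meas2_gamma K)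
    meas2_lam meas_upd_lam mt t0) => l _.
  exact: gamma_le_w_lam.
have V1 : (0 < V (fun=> 1%E) x0)%E.
  (* As [W] maps 1 to 1 on valid states, the mass of [V] is at least the integral of [gauss_lam c k]
     against [gamma K]. *)
  have mf1 := @meas_gauss_lam c k; have f10 := @gauss_lam_ge0 c k (ltW c0).
  have one0 (x : S) : (0 <= 1 :> \bar R)%E by [].
  have m1 : meas elt (fun _ : S => 1%E : \bar R) by exact: cst1.
  have mW1 := po_meas opW m1 one0; have W10 := po_ge0 opW one0.
  have f1V x : valid x -> (gauss_lam c k x <= U_tau2 w_eta (W (fun=> 1%E)) x)%E.
    move=> vx; apply: (@le_trans _ _ (U_tau2 w_eta (fun=> 1%E) x)).
      rewrite /U_tau2 /stage; under eq_integral do rewrite mule1.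
      exact: etaI.
    by apply: (po_le opeta m1 mW1 one0 W10 _ vx) => z vz; rewrite unitalW.
  apply: (lt_le_trans _ (po_le opgam mf1 (po_meas opeta mW1 W10) f10
    (po_ge0 opeta W10) f1V vx0)).
  exact: gamma_mass_gt0.
have [rho rho01 H] := doeblin_local opP opV unitalP vx0 C0 (@meas_region_theta K)
  delta0 hit VC minorC V1.
have HA (A : set S) : state_measurable A -> exists l : R, forall m x, valid x ->
    (`| iter m P (fun z => (\1_A z : R)%:E) x - l%:E | <= (2 * rho ^+ m)%:E)%E.
  move=> mA; apply: H; first exact: meas_state_indic.
  by move=> x; rewrite !lee_fin indicE; case: (x \in A); rewrite ?lexx ler01.
(* The limit is chosen set by set; the convergence bound is uniform in the starting state, so one
   value serves all of them. *)
pose pi (A : set S) := xget 0 [set l : R | forall m x, valid x ->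
    (`| iter m P (fun z => (\1_A z : R)%:E) x - l%:E | <= (2 * rho ^+ m)%:E)%E].
exists pi, (fun=> 2), rho; split; first exact: rho01.
move=> x vx m A mA.
exact: (xgetPex 0 (HA A mA)).
Qed.

End sampler.

(** * The two updates of tau^2 *)

Section tau2_updates.
Context (R : realType) (n p : nat) (X : 'M[R]_(n, p)) (y : 'cV[R]_n).
Context (a' b' : R) (pit : R -> R).
Local Notation D0 := [set u : R | (0 < u)%R].
Local Notation S := (state R p).
Local Notation elt := (@state_elt R p).
Local Notation valid := (@valid_state R p).
Local Notation I0 := (fun f : R -> \bar R => (\int[@lebesgue_measure R]_(u in D0) f u)%E).
Implicit Types (x : S) (l v : 'cV[R]_p) (t s : R).

Hypothesis a0 : 0 < a'.
Hypothesis b0 : 0 < b'.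
Hypothesis pit_prob : prob_density D0 pit.

Let mpit : measurable_fun setT pit := pit_prob.1.
Let pit0 u : 0 <= pit u := pit_prob.2.1 u.
Let pit1 : I0 (fun u => (pit u)%:E) = 1%E := pit_prob.2.2.
Let int0 : integrator (@real_elt R) D0 I0 := real_integrator (@measurable_pos R).

Let low (T t : R) : R := (t <= T)%R%:R.
Let up (T t : R) : R := (T < t)%R%:R.

Let low_up T t : low T t + up T t = 1.
Proof. by rewrite /low /up; case: leP; rewrite ?addr0 ?add0r. Qed.
Let low0 T t : 0 <= low T t. Proof. by rewrite /low. Qed.
Let up0 T t : 0 <= up T t. Proof. by rewrite /up. Qed.

Let mlow T : measurable_fun setT (low T).
Proof. by apply: measurable_ind. Qed.
Let mup T : measurable_fun setT (up T).
Proof.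
rewrite (_ : up T = fun t => 1 - low T t); first exact: measurable_funB.
by apply/funext => t; rewrite -(low_up T t) addrC addKr.
Qed.

Let measR (f : R -> R) : measurable_fun setT f -> meas (@real_elt R) (fun t => (f t)%:E).
Proof. by move=> mf; apply: meas_real; exact/measurable_EFinP. Qed.

Let I0_le (f g : R -> R) : measurable_fun setT f -> measurable_fun setT g ->
  (forall t, 0 <= f t) -> (forall t, 0 <= g t) -> (forall t, 0 < t -> f t <= g t) ->
  (I0 (fun t => (f t)%:E) <= I0 (fun t => (g t)%:E))%E.
Proof.
move=> mf mg f0 g0 fg; apply: (int_le int0 (measR mf) (measR mg)) => t.
- by rewrite lee_fin.
- by rewrite lee_fin.
- by move=> tp; rewrite lee_fin; exact: fg.
Qed.

Let I0_add (f g : R -> R) : measurable_fun setT f -> measurable_fun setT g ->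
  (forall t, 0 <= f t) -> (forall t, 0 <= g t) ->
  I0 (fun t => (f t + g t)%:E) = (I0 (fun t => (f t)%:E) + I0 (fun t => (g t)%:E))%E.
Proof.
move=> mf mg f0 g0; rewrite -(int_add int0 (measR mf) (measR mg))//;
  by move=> t; rewrite lee_fin.
Qed.

Let I0_scale (k : R) (f : R -> R) : 0 <= k -> measurable_fun setT f ->
  (forall t, 0 <= f t) ->
  I0 (fun t => (k * f t)%:E) = (k%:E * I0 (fun t => (f t)%:E))%E.
Proof.
by move=> k0 mf f0; rewrite -(int_scale int0 k0 (measR mf))// => t; rewrite lee_fin.
Qed.

Let mass_split T : (I0 (fun t => (pit t * low T t)%:E) + I0 (fun t => (pit t * up T t)%:E) = 1)%E.
Proof.
rewrite -pit1 -I0_add//; try by move=> t; rewrite mulr_ge0.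
- by apply: eq_integral => t _; rewrite -mulrDr low_up mulr1.
- exact: measurable_funM.
- exact: measurable_funM.
Qed.

Let I0_scale_pit_fin (h : R -> R) (C : R) : measurable_fun setT h -> (forall t, 0 <= h t) ->
  0 <= C -> (forall t, 0 < t -> h t <= C * pit t) -> (I0 (fun t => (h t)%:E) <= C%:E)%E.
Proof.
move=> mh h0 C0 hC; apply: (@le_trans _ _ (I0 (fun t => (C * pit t)%:E))).
  by apply: I0_le => //; [exact: measurable_funM|move=> t; rewrite mulr_ge0].
by rewrite I0_scale// pit1 mule1.
Qed.

Let I0_weight_gt0 (e : R -> R) : measurable_fun setT e -> (forall t, 0 < t -> 0 < e t) ->
  (0 < I0 (fun t => (e t * pit t)%:E))%E.
Proof.
move=> me e0; apply: integral_weight_gt0 => //; first exact: measurable_pos.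
by rewrite [X in (_ < X)%E]pit1.
Qed.

(** * The prior of tau^2 times a nonincreasing factor and a bounded one *)

Section tilted_prior.
Context (D r h : R -> R) (rmin rmax : R).
Hypothesis mD : measurable_fun setT D.
Hypothesis mr : measurable_fun setT r.
Hypothesis mh : measurable_fun setT h.
Hypothesis D0_ge0 : forall t, 0 <= D t.
Hypothesis D_gt0 : forall t, 0 < t -> 0 < D t.
Hypothesis D_le1 : forall t, 0 < t -> D t <= 1.
Hypothesis D_le : forall t t', 0 < t -> t <= t' -> D t' <= D t.
Hypothesis r_ge0 : forall t, 0 <= r t.
Hypothesis rmin0 : 0 < rmin.
Hypothesis r_bounds : forall t, 0 < t -> rmin <= r t <= rmax.
Hypothesis hE : forall t, h t = D t * r t * pit t.

Let h_ge0 t : 0 <= h t. Proof. by rewrite hE !mulr_ge0. Qed.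

Let rmax0 : 0 < rmax.
Proof. by have /andP[h1 h2] := r_bounds ltr01; apply: lt_le_trans rmin0 (le_trans h1 h2). Qed.

Lemma tilted_normalizer : (0 < I0 (fun t => (h t)%:E) < +oo)%E.
Proof.
apply/andP; split.
  rewrite [X in (_ < X)%E](_ : _ = I0 (fun t => ((D t * r t) * pit t)%:E)); last first.
    by apply: eq_integral => t _; rewrite hE.
  apply: I0_weight_gt0; first exact: measurable_funM.
  move=> t t0; rewrite mulr_gt0// ?D_gt0//.
  by have /andP[h1 _] := r_bounds t0; apply: lt_le_trans h1.
apply: (@le_lt_trans _ _ rmax%:E); last by rewrite ltry.
apply: I0_scale_pit_fin => //; first exact: ltW.
move=> t t0; rewrite hE ler_wpM2r//.
have /andP[h1 h2] := r_bounds t0; rewrite -[leRHS]mul1r.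
by apply: ler_pM => //; exact: D_le1.
Qed.

(* As [D] is nonincreasing, it puts at least half of the mass below a median of
   [pit]; [r] costs only the ratio [rmin / rmax]. *)
Lemma tilted_tight (T : R) : 0 < T -> (I0 (fun t => (pit t * up T t)%:E) <= 2^-1%:E)%E ->
  ((rmin / (2 * rmax))%:E <= I0 (fun t => (ndens D0 h t)%:E * (low T t)%:E))%E.
Proof.
move=> T0 tail.
pose J := I0 (fun t => (D t * pit t * low T t)%:E).
have mDp : measurable_fun setT (fun t => D t * pit t) by exact: measurable_funM.
have mDpl : measurable_fun setT (fun t => D t * pit t * low T t) by exact: measurable_funM.
have mpl : measurable_fun setT (fun t => pit t * low T t) by exact: measurable_funM.
have mpu : measurable_fun setT (fun t => pit t * up T t) by exact: measurable_funM.
have Dp0 t : 0 <= D t * pit t by rewrite mulr_ge0.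
have Dpl0 t : 0 <= D t * pit t * low T t by rewrite mulr_ge0.
have pl0 t : 0 <= pit t * low T t by rewrite mulr_ge0.
have pu0 t : 0 <= pit t * up T t by rewrite mulr_ge0.
have DT0 := D_gt0 T0.
(* [D T] bounds [D] from below on [(0, T]], which has prior mass at least 1/2, and from above beyond
   [T]. So the mass above [T] is at most [D T / 2 <= J], without any lower bound on [D T] uniform in
   lambda. *)
have Jge : ((2^-1 * D T)%:E <= J)%E.
  apply: (@le_trans _ _ (I0 (fun t => (D T * (pit t * low T t))%:E))); last first.
    apply: I0_le => //; first exact: measurable_funM.
      by move=> t; rewrite mulr_ge0// ltW.
    move=> t t0; rewrite mulrA /low; case: (leP t T) => tT; rewrite ?mulr0// !mulr1.
    by rewrite ler_wpM2r//; exact: D_le.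
  rewrite I0_scale// ?(ltW DT0)// mulrC EFinM lee_wpmul2l ?lee_fin ?(ltW DT0)//.
  have := mass_split T; move: tail.
  have : (0 <= I0 (fun t => (pit t * up T t)%:E))%E.
    by apply: integral_ge0 => t _; rewrite lee_fin.
  case: (I0 (fun t => (pit t * up T t)%:E)) => [q| |] //.
  case: (I0 (fun t => (pit t * low T t)%:E)) => [q'| |] //.
  by rewrite -EFinD !lee_fin => _ q2 [E]; lra.
have Jle1 : (J <= 1)%E.
  apply: I0_scale_pit_fin => // t t0; rewrite mul1r -[leRHS]mul1r -mulrA.
  rewrite ler_pM//; first exact: D_le1.
  by rewrite -[leRHS]mulr1 ler_wpM2l// /low; case: (t <= T).
have Jf : J \is a fin_num.
  rewrite ge0_fin_numE ?(le_lt_trans Jle1) ?ltry//.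
  by apply: le_trans Jge; rewrite lee_fin mulr_ge0.
have J0 : 0 < fine J.
  by rewrite -lte_fin fineK//; apply: lt_le_trans Jge; rewrite lte_fin mulr_gt0.
have Jge' : 2^-1 * D T <= fine J by rewrite -lee_fin fineK.
(* The mass below [T] is at least [rmin * J] and the normalizer at most [rmax * (2 * J)]; [J]
   cancels. *)
have -> : rmin / (2 * rmax) = (rmin * fine J) / (rmax * (2 * fine J)).
  by field; rewrite !gt_eqF.
have /andP[N0 _] := tilted_normalizer.
apply: (int_density_ge int0 (measR mh) h_ge0) => //.
- by rewrite mulr_gt0.
- apply: (@le_trans _ _ (I0 (fun t => (rmax *
      (D t * pit t * low T t + D T * (pit t * up T t)))%:E))).
    have g0 t : 0 <= D t * pit t * low T t + D T * (pit t * up T t).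
      by rewrite addr_ge0// mulr_ge0.
    apply: I0_le => //.
    + by apply: measurable_funM => //; apply: measurable_funD => //; exact: measurable_funM.
    + by move=> t; rewrite mulr_ge0// ltW.
    + move=> t t0; rewrite hE mulrAC mulrC.
      have /andP[_ h2] := r_bounds t0.
      apply: ler_pM => //.
      rewrite /low /up; case: (leP t T) => tT; rewrite ?mulr1 ?mulr0 ?addr0 ?add0r//.
      by rewrite ler_wpM2r//; apply: D_le => //; exact: ltW.
  rewrite I0_scale ?(ltW rmax0)//; last 2 first.
  + by apply: measurable_funD => //; exact: measurable_funM.
  + by move=> t; rewrite addr_ge0// mulr_ge0.
  rewrite EFinM lee_wpmul2l ?lee_fin ?(ltW rmax0)//.
  rewrite I0_add//; last 2 first.
  + exact: measurable_funM.
  + by move=> t; rewrite mulr_ge0.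
  rewrite I0_scale ?(ltW DT0)// -/J -(fineK Jf).
  apply: (@le_trans _ _ ((fine J)%:E + (D T)%:E * 2^-1%:E)%E).
    by rewrite leeD2l// lee_wpmul2l// lee_fin.
  by rewrite -EFinM -EFinD lee_fin; lra.
- exact: measR.
- by move=> u; rewrite lee_fin.
- rewrite EFinM fineK// /J -I0_scale ?(ltW rmin0)//.
  rewrite [leRHS](_ : _ = I0 (fun t => (h t * low T t)%:E)); last first.
    by apply: eq_integral => t _; rewrite EFinM.
  apply: I0_le.
  + exact: measurable_funM.
  + exact: measurable_funM.
  + by move=> t; rewrite mulr_ge0// ltW.
  + by move=> t; rewrite mulr_ge0.
  + move=> t t0; rewrite mulrA ler_wpM2r// hE mulrA (mulrC rmin) ler_wpM2r//.
    by have /andP[h1 _] := r_bounds t0; rewrite ler_wpM2l.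
Qed.

End tilted_prior.

(** Domination by a multiple of [pit] turns the null tail of the prior into a null tail of [h], so
    all the normalized mass lies below [T]. *)
Lemma supported_tight (T C : R) (h : R -> R) : measurable_fun setT h ->
  (forall t, 0 <= h t) -> 0 <= C -> (forall t, 0 < t -> h t <= C * pit t) ->
  (0 < I0 (fun t => (h t)%:E))%E -> I0 (fun t => (pit t * up T t)%:E) = 0%E ->
  (1%:E <= I0 (fun t => (ndens D0 h t)%:E * (low T t)%:E))%E.
Proof.
move=> mh h0 C0 hC N0 tail0.
have Nle := I0_scale_pit_fin mh h0 C0 hC.
have Ny : (I0 (fun t => (h t)%:E) < +oo)%E by rewrite (le_lt_trans Nle)// ltry.
set N := I0 _ in N0 Ny Nle.
have NE : N = (fine N)%:E by rewrite fineK// ge0_fin_numE// ltW.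
have fN : 0 < fine N by rewrite fine_gt0// N0.
have -> : 1 = fine N / fine N by rewrite divff// gt_eqF.
apply: (int_density_ge int0 (measR mh) h0) => //.
- by rewrite -NE.
- exact: measR.
- by move=> u; rewrite lee_fin.
rewrite -NE /N.
have mlo : measurable_fun setT (fun t => h t * low T t) by exact: measurable_funM.
have mu' : measurable_fun setT (fun t => h t * up T t) by exact: measurable_funM.
have lo0 t : 0 <= h t * low T t by rewrite mulr_ge0.
have u0 t : 0 <= h t * up T t by rewrite mulr_ge0.
rewrite [leLHS](_ : _ = (I0 (fun t => (h t * low T t)%:E) +
    I0 (fun t => (h t * up T t)%:E))%E); last first.
  by rewrite -I0_add//; apply: eq_integral => t _; rewrite -mulrDr low_up mulr1.
have : (I0 (fun t => (h t * up T t)%:E) <= 0)%E.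
  apply: (@le_trans _ _ (I0 (fun t => (C * (pit t * up T t))%:E))).
    apply: I0_le => //.
    - by apply: measurable_funM => //; exact: measurable_funM.
    - by move=> t; rewrite mulr_ge0// mulr_ge0.
    - by move=> t t0; rewrite mulrA ler_wpM2r//; exact: hC.
  rewrite I0_scale// ?tail0 ?mule0//; first exact: measurable_funM.
  by move=> t; rewrite mulr_ge0.
move=> le0; apply: (@le_trans _ _ (I0 (fun t => (h t * low T t)%:E) + 0)%E).
  by rewrite leeD2l.
by rewrite adde0 le_eqVlt; apply/orP; left; apply/eqP; apply: eq_integral => t _; rewrite EFinM.
Qed.

Section algorithm2.
Hypothesis moment : exists eps : R, 0 < eps /\
  (I0 (fun t => (powR t eps * pit t)%:E) < +oo)%E.

Let Dl l t : R := powR (\det (1%:M + t *: (Lam l *m XtX X *m Lam l))) (- (1 / 2)).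
Let Rl l t : R := powR (Rfun X y b' t l) (- (n%:R / 2 + a')).
Let al : R := n%:R / 2 + a'.
Let al0 : 0 < al. Proof. by rewrite ltr_wpDl// divr_ge0. Qed.
Let Rmin := powR (sqn y / 2 + b') (- al).
Let Rmax := powR b' (- al).

Let B0 : 0 < sqn y / 2 + b'. Proof. by rewrite ltr_wpDl// divr_ge0// sqn_ge0. Qed.
Let Rmin0 : 0 < Rmin. Proof. exact: powR_gt0. Qed.
Let Rmax0 : 0 < Rmax. Proof. exact: powR_gt0. Qed.

Let powRN_le (r u v : R) : 0 <= r -> 0 < u -> u <= v -> powR v (- r) <= powR u (- r).
Proof.
move=> r0 u0 uv; rewrite !powRN lef_pV2 ?posrE ?powR_gt0//; last exact: lt_le_trans uv.
by apply: ge0_ler_powR; rewrite ?nnegrE ?(ltW u0)// (le_trans _ uv)// ltW.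
Qed.

Let Rl_bounds l t : 0 < t -> Rmin <= Rl l t <= Rmax.
Proof.
move=> t0; have /andP[h1 h2] := Rfun_bounds X y b' l t0.
by rewrite !powRN_le ?(ltW al0)//; exact: lt_le_trans h1.
Qed.

Let Dl_gt0 l t : 0 < t -> 0 < Dl l t.
Proof.
by move=> t0; apply: powR_gt0; have /andP[] := det_Mmat_le X l (ltW t0) (lexx t).
Qed.

Let Dl_le l t t' : 0 <= t -> t <= t' -> Dl l t' <= Dl l t.
Proof.
move=> t0 tt; have /andP[h1 h2] := det_Mmat_le X l t0 tt.
by apply: powRN_le => //; rewrite divr_ge0.
Qed.

Let Dl_le1 l t : 0 < t -> Dl l t <= 1.
Proof.
move=> t0; apply: (le_trans (Dl_le l (lexx 0) (ltW t0))).
by rewrite /Dl scale0r addr0 det1 powR1.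
Qed.

Let h2E x l t : h_tau2 X y a' b' pit x l t = (Dl l t * Rl l t) * pit t.
Proof. by rewrite /h_tau2 -/(Dl l t) -/(Rl l t); ring. Qed.

Lemma h_tau2_ge0 x l t : 0 <= h_tau2 X y a' b' pit x l t.
Proof. by apply: mulr_ge0; [apply: mulr_ge0; [exact: pit0|]|]; exact: powR_ge0. Qed.

Let mDl dd (T : measurableType dd) (l : T -> 'cV[R]_p) (t : T -> R) :
  mx_elt dd T l -> measurable_fun setT t -> measurable_fun setT (fun z => Dl (l z) (t z)).
Proof.
by move=> ml mt; apply: measurable_powRl; apply: measurable_det; mx_meas.
Qed.

Let mRl dd (T : measurableType dd) (l : T -> 'cV[R]_p) (t : T -> R) :
  mx_elt dd T l -> measurable_fun setT t -> measurable_fun setT (fun z => Rl (l z) (t z)).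
Proof. by move=> ml mt; apply: measurable_powRl; exact: measurable_Rfun. Qed.

Lemma meas2_h_tau2 :
  meas2 elt (@real_elt R) (fun x t => h_tau2 X y a' b' pit x (s_lam x) t).
Proof.
move=> dd T x t [h1 h2 h3 h4 h5] mt.
apply: measurable_funM; last exact: mRl.
by apply: measurable_funM; [exact: (measurableT_comp mpit)|exact: mDl].
Qed.

Let mDl1 l : measurable_fun setT (Dl l).
Proof. by apply: (mDl (l := fun=> l) (t := id)) => //; exact: mx_elt_cst. Qed.
Let mRl1 l : measurable_fun setT (Rl l).
Proof. by apply: (mRl (l := fun=> l) (t := id)) => //; exact: mx_elt_cst. Qed.

Let mh2 x l : measurable_fun setT (h_tau2 X y a' b' pit x l).
Proof.
apply: measurable_funM; last exact: mRl1.
by apply: measurable_funM; [exact: mpit|exact: mDl1].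
Qed.

Let Dl_ge0 l t : 0 <= Dl l t. Proof. exact: powR_ge0. Qed.
Let Rl_ge0 l t : 0 <= Rl l t. Proof. exact: powR_ge0. Qed.
Let Dl_le' l t t' : 0 < t -> t <= t' -> Dl l t' <= Dl l t.
Proof. by move=> t0; apply: Dl_le; exact: ltW. Qed.

Lemma h_tau2_normalizer x l : (0 < I0 (fun t => (h_tau2 X y a' b' pit x l t)%:E) < +oo)%E.
Proof.
exact: (tilted_normalizer (mDl1 l) (mRl1 l) (mh2 x l) (Dl_ge0 l) (@Dl_gt0 l) (@Dl_le1 l)
  (Rl_ge0 l) Rmin0 (@Rl_bounds l) (h2E x l)).
Qed.

Let tail_half : exists2 T : R, 0 < T & (I0 (fun t => (pit t * up T t)%:E) <= 2^-1%:E)%E.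
Proof.
have [eps [e0 mfin]] := moment.
set m := I0 _ in mfin.
have m0 : (0 <= m)%E.
  by apply: integral_ge0 => t _; rewrite lee_fin mulr_ge0// powR_ge0.
have mE : m = (fine m)%:E by rewrite fineK// ge0_fin_numE.
have fm0 : 0 <= fine m by rewrite fine_ge0.
(* [m / K <= 1 / 2] is what Markov's inequality has to deliver; the summand 1 keeps [K] positive
   even if [m] vanishes. *)
pose K := 2 * fine m + 1; have K0 : 0 < K by rewrite /K; lra.
pose T := powR K eps^-1; have T0 : 0 < T by exact: powR_gt0.
have TK : powR T eps = K.
  by rewrite /T -powRrM mulVf ?gt_eqF// powRr1// ltW.
have meps : measurable_fun setT (fun t => powR t eps * pit t).
  by apply: measurable_funM => //; exact: measurable_powR.
have eps0 t : 0 <= powR t eps * pit t by rewrite mulr_ge0// powR_ge0.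
(* Markov's inequality for [t `^ eps]. *)
exists T => //; apply: (@le_trans _ _ (I0 (fun t => (K^-1 * (powR t eps * pit t))%:E))).
  apply: I0_le.
  - exact: measurable_funM.
  - exact: measurable_funM.
  - by move=> t; rewrite mulr_ge0.
  - by move=> t; rewrite mulr_ge0// invr_ge0 ltW.
  - move=> t t0; rewrite /up; case: (ltP T t) => hT; last first.
      by rewrite mulr0 mulr_ge0// invr_ge0 ltW.
    rewrite mulr1 mulrA ler_peMl// mulrC ler_pdivlMr// mul1r -TK.
    by apply: ge0_ler_powR; rewrite ?nnegrE ?ltW.
rewrite I0_scale ?invr_ge0 ?(ltW K0)// -/m mE -EFinM lee_fin mulrC ler_pdivrMr// /K.
lra.
Qed.

Lemma h_tau2_tight : exists T c : R, [/\ 0 < T, 0 < c & forall x, valid x ->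
  (c%:E <= I0 (fun t => (ndens D0 (h_tau2 X y a' b' pit x (s_lam x)) t)%:E * (low T t)%:E))%E].
Proof.
have [T T0 tail] := tail_half; exists T, (Rmin / (2 * Rmax)).
split; [exact: T0|by rewrite divr_gt0// mulr_gt0|].
move=> x vx; set l := s_lam x.
exact: (tilted_tight (mDl1 l) (mRl1 l) (mh2 x l) (Dl_ge0 l) (@Dl_gt0 l) (@Dl_le1 l)
  (@Dl_le' l) (Rl_ge0 l) Rmin0 (@Rl_bounds l) (h2E x l) T0 tail).
Qed.

(** In Algorithm 2 the law of tau^2 is determined by the new lambda, so the density is its own
    minorant, of mass 1; [x0] is an arbitrary reference state. *)
Lemma h_tau2_minor (K : R) : 0 < K ->
  exists (eta : 'cV[R]_p -> R -> R) (c k : R), [/\ forall l t, 0 <= eta l t,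
    meas2 elt (@real_elt R) (fun x t => eta (s_lam x) t),
    0 < c /\ 0 <= k,
    forall l, ((c * expR (- (k * sqn l)))%:E <= I0 (fun t => (eta l t)%:E))%E &
    forall x, valid x -> region_theta K x ->
      forall t, 0 < t -> eta (s_lam x) t <= w_tau2 (h_tau2 X y a' b' pit) x t].
Proof.
move=> K0; pose x0 : S := mkState 0 0 1 1 0.
exists (fun l => ndens D0 (h_tau2 X y a' b' pit x0 l)), 1, 0; split => //.
- by move=> l t; apply: ndens_ge0 => u; exact: h_tau2_ge0.
- exact: (meas2_density int0 (@state_elt_comp R p) (fun x => h_tau2_ge0 x (s_lam x)) meas2_h_tau2).
- move=> l; rewrite mul0r oppr0 expR0 mulr1.
  have := int_density1 int0 (measR (mh2 x0 l)) (h_tau2_ge0 x0 l) (h_tau2_normalizer x0 l).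
  by under eq_integral do rewrite mule1; move=> ->.
Qed.

End algorithm2.

Section algorithm3.
Context (T : R).
Hypothesis T0 : 0 < T.
Hypothesis supp : (\int[@lebesgue_measure R]_(t in [set u : R | (T < u)%R]) (pit t)%:E = 0)%E.

Let ex3 (be : 'cV[R]_p) s l t : R :=
  - t * sqn (X *m Lam l *m be) / (2 * s) + Num.sqrt t * dot (X *m Lam l *m be) y / s.

Let h3E x l t : h_tau3 X y pit x l t = expR (ex3 (s_beta x) (s_sig2 x) l t) * pit t.
Proof.
have e1 : ((s_beta x)^T *m Lam l *m XtX X *m Lam l *m s_beta x) 0 0 =
    sqn (X *m Lam l *m s_beta x) by rewrite -qf_gram /qf !mulmxA.
have e2 : ((s_beta x)^T *m Lam l *m X^T *m y) 0 0 = dot (X *m Lam l *m s_beta x) y.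
  by rewrite /dot !trmx_mul Lam_tr !mulmxA.
by rewrite /h_tau3 /= e1 e2.
Qed.

(** The exponent is [(2 * r - t * q) / (2 * s)], where [q] is [sqn w] and [r] is
    [Num.sqrt t * dot w y], and [2 * r] is at most [t * q + sqn y] in absolute value. The upper
    bound is free of [be] and [l] and so controls the normalizer. *)
Let ex3_bounds be s l t : 0 < s -> 0 < t ->
  - (t * sqn (X *m Lam l *m be) / s) - sqn y / (2 * s) <= ex3 be s l t <= sqn y / (2 * s).
Proof.
move=> s0 t0; rewrite /ex3; set w := X *m Lam l *m be.
have e1 : Num.sqrt t * dot w y = dot (Num.sqrt t *: w) y by rewrite dotZl.
have e2 : sqn (Num.sqrt t *: w) = t * sqn w by rewrite sqnZ sqr_sqrtr// ltW.
have h1 := dot_le (Num.sqrt t *: w) y.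
have h2 := dot_le (- (Num.sqrt t *: w)) y.
rewrite sqnN e2 -scaleN1r dotZl -e1 in h2; rewrite e2 -e1 in h1.
set q := sqn w in h1 h2 *; set r := Num.sqrt t * dot w y in h1 h2 *.
have -> : - t * q / (2 * s) + r / s = (2 * r - t * q) / (2 * s) by field; rewrite gt_eqF.
have -> : - (t * q / s) - sqn y / (2 * s) = (- (2 * (t * q)) - sqn y) / (2 * s).
  by field; rewrite gt_eqF.
have i0 : 0 <= (2 * s)^-1 by rewrite invr_ge0 mulr_ge0// ltW.
by apply/andP; split; apply: ler_wpM2r => //; lra.
Qed.

Lemma h_tau3_ge0 x l t : 0 <= h_tau3 X y pit x l t.
Proof. by rewrite mulr_ge0// expR_ge0. Qed.

Lemma meas2_h_tau3 :
  meas2 elt (@real_elt R) (fun x t => h_tau3 X y pit x (s_lam x) t).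
Proof.
move=> dd U x t [h1 h2 h3 h4 h5] mt.
apply: measurable_funM; last exact: (measurableT_comp mpit).
have m1 : mx_elt dd U (fun z => (s_beta (x z))^T *m Lam (s_lam (x z)) *m XtX X
    *m Lam (s_lam (x z)) *m s_beta (x z)) by mx_meas.
have m2 : mx_elt dd U (fun z => (s_beta (x z))^T *m Lam (s_lam (x z)) *m X^T *m y).
  by mx_meas.
apply: measurable_expRf; apply: measurable_funD; apply: measurable_funM.
- by apply: measurable_funM; [exact: measurable_funN|exact: m1].
- by apply: measurable_funV; exact: measurable_funM.
- by apply: measurable_funM; [exact: measurable_sqrt|exact: m2].
- exact: measurable_funV.
Qed.

Let mh3 x l : measurable_fun setT (h_tau3 X y pit x l).
Proof.
apply: (@meas2_h_tau3 _ _ (fun=> upd_lam x l) id); first exact: state_elt_cst.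
exact: measurable_id.
Qed.

Let h3_le x l t : valid x -> 0 < t ->
  h_tau3 X y pit x l t <= expR (sqn y / (2 * s_sig2 x)) * pit t.
Proof.
move=> [s0 _] t0; rewrite h3E ler_wpM2r// ler_expR.
by have /andP[] := ex3_bounds (s_beta x) l s0 t0.
Qed.

Let h3_int_le x l : valid x ->
  (I0 (fun t => (h_tau3 X y pit x l t)%:E) <= (expR (sqn y / (2 * s_sig2 x)))%:E)%E.
Proof.
move=> vx.
exact: (I0_scale_pit_fin (mh3 x l) (h_tau3_ge0 x l) (expR_ge0 _) (fun t => @h3_le x l t vx)).
Qed.

Lemma h_tau3_normalizer x : valid x ->
  (0 < I0 (fun t => (h_tau3 X y pit x (s_lam x) t)%:E) < +oo)%E.
Proof.
move=> vx; apply/andP; split; last by apply: le_lt_trans (h3_int_le _ vx) _; rewrite ltry.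
have me : measurable_fun setT (ex3 (s_beta x) (s_sig2 x) (s_lam x)).
  apply: measurable_funD; apply: measurable_funM => //; apply: measurable_funM => //.
  exact: measurable_sqrt.
rewrite [X in (_ < X)%E](_ : _ = I0 (fun t =>
  (expR (ex3 (s_beta x) (s_sig2 x) (s_lam x) t) * pit t)%:E)); last first.
  by apply: eq_integral => t _; rewrite h3E.
apply: I0_weight_gt0; first exact: measurable_expRf.
by move=> t t0; exact: expR_gt0.
Qed.

Let tail0 : I0 (fun t => (pit t * up T t)%:E) = 0%E.
Proof.
rewrite -supp integral_mkcond [RHS]integral_mkcond.
apply: eq_integral => t _; rewrite !patchE /up.
have [tT|tT] := ltP T t.
  by rewrite !mem_set ?mulr1//=; apply: lt_trans T0 _.
by rewrite mulr0 [in RHS]memNset; [case: ifP|apply/negP; rewrite /= -leNgt].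
Qed.

Let low1 : I0 (fun t => (pit t * low T t)%:E) = 1%E.
Proof. by have := mass_split T; rewrite tail0 adde0. Qed.

Lemma h_tau3_tight : exists T' c : R, [/\ 0 < T', 0 < c & forall x, valid x ->
  (c%:E <= I0 (fun t => (ndens D0 (h_tau3 X y pit x (s_lam x)) t)%:E * (low T' t)%:E))%E].
Proof.
exists T, 1; split; [exact: T0|exact: ltr01|] => x vx.
have /andP[N0 _] := h_tau3_normalizer vx.
exact: (supported_tight (mh3 x (s_lam x)) (h_tau3_ge0 x (s_lam x))
  (expR_ge0 _) (fun t => @h3_le x (s_lam x) t vx) N0 tail0).
Qed.

Lemma h_tau3_minor (K : R) : 0 < K ->
  exists (eta : 'cV[R]_p -> R -> R) (c k : R), [/\ forall l t, 0 <= eta l t,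
    meas2 elt (@real_elt R) (fun x t => eta (s_lam x) t),
    0 < c /\ 0 <= k,
    forall l, ((c * expR (- (k * sqn l)))%:E <= I0 (fun t => (eta l t)%:E))%E &
    forall x, valid x -> region_theta K x ->
      forall t, 0 < t -> eta (s_lam x) t <= w_tau2 (h_tau3 X y pit) x t].
Proof.
move=> K0; have [C C0 HC] := sqn_mul_bound X.
(* [c] collects [sqn y / 2] from the normalizer and [sqn y / 2] from the lower bound on the
   exponent, both using [1 <= s_sig2 x]. [k] comes from [t <= T] and [sqn (X *m Lam l *m be) <= C *
   sqn l * sqn be] with [sqn be <= K * s_sig2 x]. *)
pose c := expR (- sqn y); pose k := T * (C * K).
have c0 : 0 < c by exact: expR_gt0.
have k0 : 0 <= k by rewrite !mulr_ge0// ltW.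
have mpl : measurable_fun setT (fun t => pit t * low T t) by exact: measurable_funM.
exists (fun l t => c * expR (- (k * sqn l)) * (pit t * low T t)), c, k; split => //.
- by move=> l t; rewrite !mulr_ge0 ?expR_ge0.
- move=> dd U x t [h1 h2 h3 h4 h5] mt; apply: measurable_funM.
    apply: measurable_funM => //; apply: measurable_expRf; apply: measurable_funN.
    by apply: measurable_funM => //; exact: measurable_sqn.
  exact: (measurableT_comp mpl).
- move=> l; rewrite I0_scale//; first by rewrite low1 mule1.
    by rewrite mulr_ge0// expR_ge0.
  by move=> t; rewrite mulr_ge0.
move=> x vx /and4P[s1 hb _ _] t t0; have [s0 _] := vx; set l := s_lam x.
rewrite {1}/low; case: (leP t T) => tT; last first.
  by rewrite !mulr0; apply: ndens_ge0 => u; exact: h_tau3_ge0.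
rewrite mulr1 /w_tau2 /ndens.
have /andP[N0 Ny] := h_tau3_normalizer vx.
have Nle := h3_int_le l vx.
set N := (\int[_]_(u in _) _)%E in N0 Ny Nle *.
have NE : N = (fine N)%:E by rewrite fineK// ge0_fin_numE// ltW.
have fN : 0 < fine N by rewrite fine_gt0// N0.
have sy : sqn y / (2 * s_sig2 x) <= sqn y / 2.
  rewrite ler_wpM2l ?sqn_ge0// lef_pV2 ?posrE ?mulr_gt0//; lra.
have Nle' : fine N <= expR (sqn y / 2).
  by rewrite -lee_fin -NE; apply: (le_trans Nle); rewrite lee_fin ler_expR.
rewrite ler_pdivlMr// h3E mulrAC ler_wpM2r//.
apply: (@le_trans _ _ (c * expR (- (k * sqn l)) * expR (sqn y / 2))).
  by rewrite ler_wpM2l// mulr_ge0 ?expR_ge0// ltW.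
rewrite /c -!expRD ler_expR.
have /andP[hlow _] := ex3_bounds (s_beta x) l s0 t0.
apply: le_trans hlow.
have hw : sqn (X *m Lam l *m s_beta x) <= C * (sqn l * (K * s_sig2 x)).
  rewrite -mulmxA; apply: (le_trans (HC _)); rewrite ler_wpM2l//.
  apply: (@le_trans _ _ (sqn l * sqn (s_beta x))); last first.
    by rewrite ler_wpM2l// sqn_ge0.
  rewrite [sqn (Lam l *m _)]sqnE [sqn (s_beta x)]sqnE mulr_sumr; apply: ler_sum => i _.
  have -> : (Lam l *m s_beta x) i 0 = l i 0 * s_beta x i 0.
    by rewrite /Lam mul_diag_mx !mxE.
  by rewrite exprMn ler_wpM2r ?sqr_ge0// sqr_le_sqn.
have e1 : t * sqn (X *m Lam l *m s_beta x) / s_sig2 x <= k * sqn l.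
  rewrite ler_pdivrMr//; apply: (@le_trans _ _ (T * (C * (sqn l * (K * s_sig2 x))))).
    by apply: ler_pM => //; [exact: ltW|exact: sqn_ge0].
  by rewrite le_eqVlt; apply/orP; left; apply/eqP; rewrite /k; ring.
lra.
Qed.

End algorithm3.

End tau2_updates.

Theorem theorem2 (R : realType) (n p : nat) (y : 'cV[R]_n) (X : 'M[R]_(n, p))
  (a' b' : R) (pit pil : R -> R) (d : R) :
  (1 <= p)%N -> (p <= n)%N ->
  XtX X \in unitmx ->
  0 < a' -> 0 < b' ->
  prob_density [set u : R | (0 < u)%R] pit ->
  prob_density setT pil ->
  0 < d -> pos_def (invmx (XtX X) - d *: 1%:M) ->
  ((exists eps : R, 0 < eps /\
      (\int[@lebesgue_measure R]_(t in [set u : R | (0 < u)%R]) (powR t eps * pit t)%:E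
         < +oo)%E) ->
     geom_ergodic (alg2_op X y a' b' d pit pil))
  /\
  ((exists taubar : R, 0 < taubar /\
      (\int[@lebesgue_measure R]_(t in [set u : R | (taubar < u)%R]) (pit t)%:E = 0)%E) ->
     geom_ergodic (alg3_op X y a' b' d pit pil)).
Proof.
move=> _ _ uX a0 b0 ppit ppil d0 pd; split=> [moment|[T [T0 supp]]].
- apply: gibbs_ergodic => //.
  + exact: (h_tau2_ge0 X y a' b' ppit).
  + exact: meas2_h_tau2.
  + by move=> x _; exact: h_tau2_normalizer.
  + exact: h_tau2_tight.
  + by move=> K K0; exact: h_tau2_minor.
- apply: gibbs_ergodic => //.
  + exact: (h_tau3_ge0 X y ppit).
  + exact: meas2_h_tau3.
  + by move=> x vx; exact: h_tau3_normalizer.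
  + exact: (h_tau3_tight X y ppit T0 supp).
  + by move=> K K0; exact: (h_tau3_minor X y ppit T0 supp).
Qed.
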